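(* Let $(G,\mu)$ and $(H,\nu)$ be pmp groupoids. Then both $(G,\mu)$ and $(H,\nu)$ are sofic if and only if $(G\times H,\mu\times\nu)$ is sofic.
   Context: A groupoid is a small category with all arrows invertible, identified with its set of arrows $G$; $s(g)=g^{-1}g$, $r(g)=gg^{-1}$, the unit space is $G^{(0)}=s(G)=r(G)$, and $gh$ is defined iff $s(g)=r(h)$. A discrete measurable groupoid is a groupoid with a standard Borel structure for which product and inverse are Borel and $s^{-1}(x)$ is countable for all $x\in G^{(0)}$. Its Borel full semigroup $[[G]]_B$ is the set of Borel $\alpha\subseteq G$ such that $s|_\alpha$ and $r|_\alpha$ are injective; it is an inverse monoid with $\alpha\beta=\{ab:a\in\alpha,b\in\beta,s(a)=r(b)\}$, $\alpha^{-1}=\{a^{-1}:a\in\alpha\}$ and unit $G^{(0)}$. A pmp groupoid $(G,\mu)$ is a discrete measurable groupoid $G$ with a Borel probability measure $\mu$ on $G^{(0)}$ such that $\mu(s(\alpha))=\mu(r(\alpha))$ for all $\alpha\in[[G]]_B$. The full semigroup $[[G]]$ is the metric quotient of $[[G]]_B$ under the pseudometric $d_\mu(\alpha,\beta)=\mu(s(\alpha\triangle\beta))$; it inherits the inverse monoid structure. Fix a free ultrafilter $\mathcal U$ on $\mathbb N$. For metric spaces $(M_k,d_k)$ of diameter $\le 1$, $\prod_{\mathcal U}M_k$ is the metric quotient of $\prod_kM_k$ under $d_{\mathcal U}((x_k),(y_k))=\lim_{k\to\mathcal U}d_k(x_k,y_k)$. Ultraproducts of full semigroups are inverse monoids with coordinatewise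 operations. A pmp groupoid $G$ is sofic if there are a sequence $(G_k)$ of finite pmp groupoids and an isometric embedding (isometric semigroup homomorphism) $[[G]]\to\prod_{\mathcal U}[[G_k]]$. The product $G\times H$ has componentwise groupoid operations and the product Borel structure, its unit space is $G^{(0)}\times H^{(0)}$, and $\mu\times\nu$ is the product measure. *)

(* Defs.v *)
From HB Require Import structures.
From mathcomp Require Import all_boot all_order all_algebra.
From mathcomp Require Import all_classical all_reals all_analysis.

Set Implicit Arguments.
Unset Strict Implicit.
Unset Printing Implicit Defensive.

Import Order.TTheory GRing.Theory Num.Theory.
Import numFieldNormedType.Exports.

Local Open Scope classical_set_scope.
Local Open Scope ring_scope.

#[short(type="completeMetricType")]
HB.structure Definition CompleteMetric (R : numDomainType) :=
  {T of Metric R T & Complete T}.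

Definition separable (T : topologicalType) : Prop :=
  exists2 D : set T, countable D & dense D.

(* Borel isomorphic to a Polish space. *)
Definition standard_borel (R : realType) d (T : measurableType d) : Prop :=
  exists (P : completeMetricType R) (f : T -> P),
    [/\ separable P, bijective f &
        measurable = [set f @^-1` B | B in <<s @open P >>]].

(* A small category with invertible arrows, identified with its set of arrows;
   objects are identified with identity arrows.  [gmul g h] is meaningful only
   when [gsrc g = gtgt h] (functional composition order); its other values are
   unconstrained. *)
HB.mixin Record isGroupoid G := {
  gmul : G -> G -> G;
  ginv : G -> G;
  gsrc : G -> G;
  gtgt : G -> G;
  gsrc_src : forall g, gsrc (gsrc g) = gsrc g;
  gtgt_src : forall g, gtgt (gsrc g) = gsrc g;
  gsrc_tgt : forall g, gsrc (gtgt g) = gtgt g;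
  gtgt_tgt : forall g, gtgt (gtgt g) = gtgt g;
  gsrc_mul : forall g h, gsrc g = gtgt h -> gsrc (gmul g h) = gsrc h;
  gtgt_mul : forall g h, gsrc g = gtgt h -> gtgt (gmul g h) = gtgt g;
  gmulA : forall g h k, gsrc g = gtgt h -> gsrc h = gtgt k ->
    gmul g (gmul h k) = gmul (gmul g h) k;
  gmul_src : forall g, gmul g (gsrc g) = g;
  gmul_tgt : forall g, gmul (gtgt g) g = g;
  gsrc_inv : forall g, gsrc (ginv g) = gtgt g;
  gtgt_inv : forall g, gtgt (ginv g) = gsrc g;
  gmulVg : forall g, gmul (ginv g) g = gsrc g;
  gmulgV : forall g, gmul g (ginv g) = gtgt g
}.

#[short(type="groupoidType")]
HB.structure Definition Groupoid := {G of isGroupoid G}.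

(* The groupoid operations and the sigma-algebra are not yet related: see
   [discrete_measurable]. *)
#[short(type="mgroupoidType")]
HB.structure Definition MGroupoid d := {G of Groupoid G & Measurable d G}.

Definition gunits (G : groupoidType) : set G := range (@gsrc G).

Definition composable (G : groupoidType) : set (G * G) :=
  [set p | gsrc p.1 = gtgt p.2].

Section product_groupoid.
Context (G H : groupoidType).
Implicit Types p q r : G * H.

Let mul p q := (gmul p.1 q.1, gmul p.2 q.2).
Let inv p := (ginv p.1, ginv p.2).
Let src p := (gsrc p.1, gsrc p.2).
Let tgt p := (gtgt p.1, gtgt p.2).

Let src_src p : src (src p) = src p.
Proof. by rewrite /src !gsrc_src. Qed.
Let tgt_src p : tgt (src p) = src p.
Proof. by rewrite /src /tgt !gtgt_src. Qed.
Let src_tgt p : src (tgt p) = tgt p.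
Proof. by rewrite /src /tgt !gsrc_tgt. Qed.
Let tgt_tgt p : tgt (tgt p) = tgt p.
Proof. by rewrite /tgt !gtgt_tgt. Qed.
Let src_mul p q : src p = tgt q -> src (mul p q) = src q.
Proof. by case=> e1 e2; rewrite /src !gsrc_mul. Qed.
Let tgt_mul p q : src p = tgt q -> tgt (mul p q) = tgt p.
Proof. by case=> e1 e2; rewrite /tgt !gtgt_mul. Qed.
Let mulA p q r : src p = tgt q -> src q = tgt r ->
  mul p (mul q r) = mul (mul p q) r.
Proof. by case=> e1 e2 [e3 e4]; rewrite /mul !gmulA. Qed.
Let mul_src p : mul p (src p) = p.
Proof. by rewrite /mul !gmul_src -surjective_pairing. Qed.
Let mul_tgt p : mul (tgt p) p = p.
Proof. by rewrite /mul !gmul_tgt -surjective_pairing. Qed.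
Let src_inv p : src (inv p) = tgt p.
Proof. by rewrite /src !gsrc_inv. Qed.
Let tgt_inv p : tgt (inv p) = src p.
Proof. by rewrite /tgt !gtgt_inv. Qed.
Let mulVp p : mul (inv p) p = src p.
Proof. by rewrite /mul !gmulVg. Qed.
Let mulpV p : mul p (inv p) = tgt p.
Proof. by rewrite /mul !gmulgV. Qed.

HB.instance Definition _ := isGroupoid.Build (G * H)%type
  src_src tgt_src src_tgt tgt_tgt src_mul tgt_mul mulA mul_src mul_tgt
  src_inv tgt_inv mulVp mulpV.

End product_groupoid.

HB.instance Definition _ d1 d2 (G : mgroupoidType d1) (H : mgroupoidType d2) :=
  Groupoid.on (G * H)%type.

(* [composable] carries the Borel structure induced from the product, so that
   its multiplication is Borel iff preimages are traces of measurable sets. *)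
Definition discrete_measurable (R : realType) d (G : mgroupoidType d) : Prop :=
  [/\ standard_borel R G,
      forall A : set G, measurable A ->
        exists2 B : set (G * G), measurable B &
          @composable G `&` (fun p => gmul p.1 p.2) @^-1` A =
          @composable G `&` B,
      measurable_fun [set: G] (@ginv G) &
      forall x : G, gunits x -> countable (@gsrc G @^-1` [set x])].

Definition borel_bisection d (G : mgroupoidType d) : set (set G) :=
  [set A | [/\ measurable A, set_inj A (@gsrc G) & set_inj A (@gtgt G)]].

(* A Borel probability measure on the unit space is encoded as one on the whole
   groupoid that is concentrated on the unit space. *)
Definition pmp_groupoid (R : realType) d (G : mgroupoidType d)
    (mu : probability G R) : Prop :=
  [/\ discrete_measurable R G, mu (@gunits G) = 1%E &
      forall A, borel_bisection A -> mu (@gsrc G @` A) = mu (@gtgt G @` A)].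

(* A set [ms_dom] with a product and a pseudometric.  Both operations are total
   on the ambient type [ms_sort], but only their values on [ms_dom] matter.
   Closure of [ms_dom] and the pseudometric laws are theorems, not fields: for
   Borel bisections they hold because injective Borel images are Borel. *)
Record metricSemigroup (R : realType) := MetricSemigroup {
  ms_sort :> pointedType;
  ms_dom : set ms_sort;
  ms_mul : ms_sort -> ms_sort -> ms_sort;
  ms_dist : ms_sort -> ms_sort -> R
}.

Definition metric_class (R : realType) (M : metricSemigroup R) (x : M) : set M :=
  [set y | ms_dom y /\ ms_dist x y = 0].

(* The quotient has the classes as elements, [get C] being a representative of
   the class [C]; the choice is irrelevant when [ms_dist] is a pseudometric for
   which the product is continuous. *)
Definition metric_quotient (R : realType) (M : metricSemigroup R) :
    metricSemigroup R :=
  @MetricSemigroup R (set M)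
    [set metric_class x | x in @ms_dom R M]
    (fun C D => metric_class (ms_mul (get C) (get D)))
    (fun C D => ms_dist (get C) (get D)).

Definition ultraproduct (R : realType) (U : set_system nat)
    (M : nat -> metricSemigroup R) : metricSemigroup R :=
  metric_quotient (@MetricSemigroup R (forall k, M k)
    [set x | forall k, ms_dom (x k)]
    (fun x y k => ms_mul (x k) (y k))
    (fun x y => lim ((fun k => ms_dist (x k) (y k)) @ U))).

Definition isometric_embedding (R : realType) (M N : metricSemigroup R)
    (f : M -> N) : Prop :=
  [/\ forall x, ms_dom x -> ms_dom (f x),
      forall x y, ms_dom x -> ms_dom y -> ms_dist (f x) (f y) = ms_dist x y &
      forall x y, ms_dom x -> ms_dom y -> f (ms_mul x y) = ms_mul (f x) (f y)].

Definition bisection_mul (G : groupoidType) (A B : set G) : set G :=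
  [set g | exists a b, [/\ A a, B b, gsrc a = gtgt b & g = gmul a b]].

Definition borel_full_semigroup (R : realType) d (G : mgroupoidType d)
    (mu : probability G R) : metricSemigroup R :=
  @MetricSemigroup R (set G) (@borel_bisection d G) (@bisection_mul G)
    (fun A B => fine (mu (@gsrc G @` (A `+` B)))).

Definition full_semigroup (R : realType) d (G : mgroupoidType d)
    (mu : probability G R) : metricSemigroup R :=
  metric_quotient (borel_full_semigroup mu).

Definition free_ultrafilter (U : set_system nat) : Prop :=
  UltraFilter U /\ forall n, ~ U [set n].

(* Meant for [mu] satisfying [pmp_groupoid]. *)
Definition sofic (R : realType) (U : set_system nat) d (G : mgroupoidType d)
    (mu : probability G R) : Prop :=
  exists (e : nat -> measure_display) (K : forall k, mgroupoidType (e k))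
      (nu : forall k, probability (K k) R),
    (forall k, finite_set [set: K k] /\ pmp_groupoid (nu k)) /\
    exists f : full_semigroup mu -> ultraproduct U (fun k => full_semigroup (nu k)),
      isometric_embedding f.

(* Main.v *)
Require Import Defs.
From HB Require Import structures.
From mathcomp Require Import all_boot all_order all_algebra.
From mathcomp Require Import all_classical all_reals all_analysis.
From mathcomp Require Import measurable_realfun ring lra.
From Stdlib Require Cantor.

(* If [G * H] is sofic, then so is [G], because [A |-> A * H^(0)] is an isometric
   embedding of full semigroups; likewise for [H].

   Conversely, by a diagonal argument an embedding into an ultraproduct of full
   semigroups of finite groupoids is the same as a sequence of maps that are
   asymptotically isometric and multiplicative, and it suffices to give it on a dense
   subsemigroup.  The finite disjoint unions of rectangles [A * B] of bisections that
   are themselves bisections are dense in [[[G * H]]].  Given approximations [theta] of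
   [G] in [K k] and [psi] of [H] in [L k], the union of the [A_i * B_i] is sent to the
   union of the [theta A_i * psi B_i], an almost bisection of [K k * L k]: the masses
   of the intersections of two sources, of two ranges and of two bisections are
   expressed by the distance and the product, hence are asymptotically preserved.
   Removing the small overlaps of sources and ranges gives a bisection.

   Images of Borel sets under the source map of a product bisection are Borel by the
   Lusin-Souslin theorem.  That [mu \x nu] is invariant follows because a bisection of
   the product is, up to a null set, a countable disjoint union of its intersections
   with rectangles of bisections. *)

Set Implicit Arguments.
Unset Strict Implicit.
Unset Printing Implicit Defensive.

Import Order.TTheory GRing.Theory Num.Theory.
Import numFieldNormedType.Exports.

Local Open Scope classical_set_scope.

(** * Lusin-Souslin theorem *)

(** Two obstacles shape the proof. An embedding is only known to preserve products and distances,
    and a distance sees nothing but sources. Distances of rectangles are not determined by distances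
    of factors, while the masses of intersections of sources, of ranges and of bisections multiply
    exactly, so these masses have to be recovered. Even the empty bisection is not assumed to go to
    something small. For a set [E] of units, [A E] has source [s(A)] cut by [s(E)]; since an almost
    idempotent bisection is almost a set of units, products with the images of [s(B)] and [t(B)]
    measure the meets.

    The other obstacle is that a bisection of the product projects to no bisection of [G]: only
    pairs of sources are distinguished. An arrow [g] is therefore weighted by the measure of the
    sources in [H] of the section over [g]. Over a fixed source in [G] these sections have disjoint
    sources, so arrows of positive weight can be cut into countably many bisections of [G], while
    arrows of weight zero contribute a null set by Fubini and countability of the fibres. Invariance
    of the measure on [H] makes the weights by sources and by ranges equal. *)

Definition cylinder (k m : nat) : set (nat -> nat) := [set z | z k = m].

Definition cylinders : set (set (nat -> nat)) :=
  [set A | exists k m, A = cylinder k m].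

Definition baire := g_sigma_algebraType cylinders.

Definition agree (T : Type) n (z w : nat -> T) := forall k, (k < n)%N -> z k = w k.

Definition seq_closed (C : set baire) :=
  forall z, (forall n, exists2 w, C w & agree n z w) -> C z.

(* [e] reindexes sequences; [A] is an injective continuous image of a closed
   subset of the Baire space, the map being a projection on coordinates. *)
Definition unique_souslin (A : set baire) := exists (C : set baire) (e : nat -> nat),
  [/\ seq_closed C, set_inj C (fun w => w \o e) & A = (fun w => w \o e) @` C].

Lemma measurable_cylinder k m : measurable (cylinder k m : set baire).
Proof. by apply: sub_sigma_algebra; exists k, m. Qed.

Lemma measurable_coord_eq a b : measurable [set w : baire | w a = w b].
Proof.
rewrite (_ : [set w | _] = \bigcup_m (cylinder a m `&` cylinder b m)).
  apply: bigcupT_measurable => m.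
  by apply: measurableI; exact: measurable_cylinder.
apply/seteqP; split=> [w /= wab|w [m _ [/= -> ->]]//].
by exists (w a).
Qed.

Lemma measurable_reindex (u : nat -> nat) :
  measurable_fun setT (fun w : baire => (w \o u : baire)).
Proof.
apply: (@measurability _ _ baire baire _ _ cylinders) => //.
move=> _ [_ [k [m ->]] <-]; rewrite setTI.
exact: measurable_cylinder.
Qed.

Definition cidx i k := Cantor.to_nat (i, k).

Lemma cantor_ext (z w : baire) : (forall i k, z (cidx i k) = w (cidx i k)) -> z = w.
Proof.
move=> h; apply/funext => n; rewrite -(Cantor.cancel_to_of n).
by case: (Cantor.of_nat n) => i k; exact: h.
Qed.

Lemma cantor_glue (f : nat -> baire) :
  exists w : baire, forall i k, w (cidx i k) = f i k.
Proof.
exists (fun n => f (Cantor.of_nat n).1 (Cantor.of_nat n).2) => i k.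
by rewrite /cidx Cantor.cancel_of_to.
Qed.

Lemma agree_trunc_reindex (u : nat -> nat) n :
  exists m, forall z w : baire, agree m z w -> agree n (z \o u) (w \o u).
Proof.
exists (\max_(k < n) (u k).+1)%N => z w zw k kn /=; apply: zw.
exact: (leq_trans _ (leq_bigmax (Ordinal kn))).
Qed.

Lemma seq_closed_reindex (C : set baire) u : seq_closed C ->
  seq_closed [set w : baire | C ((w : nat -> nat) \o u)].
Proof.
move=> cC z h; apply: cC => n.
have [m hm] := agree_trunc_reindex u n; have [w Cw zw] := h m.
by exists (w \o u) => //; apply: hm.
Qed.

Lemma seq_closed_coord (a b : nat) : seq_closed [set w : baire | w a = w b].
Proof.
move=> z /(_ (maxn a b).+1)[w /= wab zw].
by rewrite zw ?ltnS ?leq_maxl// wab zw ?ltnS ?leq_maxr.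
Qed.

Lemma seq_closed_val (Q : nat -> set nat) : seq_closed [set w : baire | forall k, Q k (w k)].
Proof.
move=> z h k; have [w /= wQ zw] := h k.+1.
by rewrite zw.
Qed.

Lemma seq_closedI (C D : set baire) : seq_closed C -> seq_closed D ->
  seq_closed (C `&` D).
Proof.
move=> cC cD z h; split; [apply: cC|apply: cD] => n.
all: by have [w [Cw Dw] zw] := h n; exists w.
Qed.

Lemma seq_closed_all I (C : I -> set baire) : (forall i, seq_closed (C i)) ->
  seq_closed [set w | forall i, C i w].
Proof.
by move=> cC z h i; apply: cC => n; have [w Cw zw] := h n; exists w.
Qed.

Lemma unique_souslin_cylinder k (Q : set nat) :
  unique_souslin [set w : baire | Q (w k)].
Proof.
exists [set w | Q (w k)], id; split => //.
- have := @seq_closed_val (fun j => [set m | j = k -> Q m]).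
  congr seq_closed; apply/seteqP; split=> [w /= /(_ k erefl)//|w /= ? ? ->//].
- by apply/seteqP; split=> [w Qw|w [v Qv <-]]//; exists w.
Qed.

(** A fibre product: row [i] of the Cantor pairing holds a preimage of the point in [C i], and all
    rows must map to the same point. Injectivity of each parametrization leaves one choice per
    row. *)
Lemma unique_souslin_bigcap (A : nat -> set baire) :
  (forall i, unique_souslin (A i)) -> unique_souslin (\bigcap_i A i).
Proof.
move=> /choice[C] /choice[e] h.
pose sub i (w : baire) : baire := w \o (fun k => cidx i k).
exists [set w | (forall i, C i (sub i w)) /\
  forall i, forall k, w (cidx i (e i k)) = w (cidx 0%N (e 0%N k))].
exists (fun k => cidx 0%N (e 0%N k)); split.
- apply: seq_closedI.
    apply: seq_closed_all => i; apply: seq_closed_reindex.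
    by have [] := h i.
  by apply: seq_closed_all => i; apply: seq_closed_all => k; apply: seq_closed_coord.
- move=> w v /set_mem[Cw Ew] /set_mem[Cv Ev] /= wv.
  apply: cantor_ext => i k.
  have [_ inj _] := h i.
  have := inj (sub i w) (sub i v) (mem_set (Cw i)) (mem_set (Cv i)).
  move=> inj'; suff /(congr1 (@^~ k)) : sub i w = sub i v by [].
  apply: inj'; apply/funext => j /=; rewrite /sub /= Ew Ev.
  exact: (congr1 (@^~ j) wv).
- apply/seteqP; split=> [z Az|_ [w [Cw Ew] <-] i _].
    have /choice[v hv] : forall i, exists v, C i v /\ v \o e i = z.
      by move=> i; have [_ _ AE] := h i; have := Az i I; rewrite AE => -[v Cv <-]; exists v.
    have [w wE] := cantor_glue v.
    have subE i : sub i w = v i by apply/funext => k; rewrite /sub /= wE.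
    have vz i k : v i (e i k) = z k by have [_ <-] := hv i.
    exists w; last by apply/funext => k /=; rewrite wE vz.
    split=> i; first by rewrite subE; case: (hv i).
    by move=> k; rewrite !wE !vz.
  have [_ _ ->] := h i; exists (sub i w); first exact: Cw.
  by apply/funext => k; rewrite /= -(Ew i).
Qed.

(** Row 1 holds a preimage in [C i], and row 0 a copy of the point, because [e i] varies with [i]
    while the final projection must not. All further rows repeat the index [i], so no coordinate
    stays free; disjointness of the [A i] makes [i] a function of the point, whence injectivity. *)
Lemma unique_souslin_bigcup (A : nat -> set baire) : trivIset setT A ->
  (forall i, unique_souslin (A i)) -> unique_souslin (\bigcup_i A i).
Proof.
move=> tA /choice[C] /choice[e] h.
pose sub i (w : baire) : baire := w \o (fun k => cidx i k).
pose idx (w : baire) := w (cidx 2 0%N).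
exists [set w | (forall j k, w (cidx j.+2 k) = idx w) /\
   (C (idx w) (sub 1%N w) /\ forall k, w (cidx 0%N k) = w (cidx 1%N (e (idx w) k)))].
exists (fun k => cidx 0%N k); split.
- apply: seq_closedI.
    by apply: seq_closed_all => j; apply: seq_closed_all => k; apply: seq_closed_coord.
  (* The index is itself a coordinate: approximations agreeing with [z] past position [cidx 2 0]
     share its index, which may thus be treated as fixed. *)
  move=> z hz.
  have key i : i = idx z -> C i (sub 1%N z) /\ forall k, z (cidx 0%N k) = z (cidx 1%N (e i k)).
    move=> iz; have : (seq_closed ([set w | C i (sub 1%N w)] `&`
         [set w | forall k, w (cidx 0%N k) = w (cidx 1%N (e i k))])).
      apply: seq_closedI; first by apply: seq_closed_reindex; case: (h i).
      by apply: seq_closed_all => k; apply: seq_closed_coord.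
    apply => n; have [w [Cw Ew] zw] := hz (maxn n (cidx 2 0%N).+1).
    have iw : idx w = i by rewrite iz /idx zw// leq_max ltnSn orbT.
    exists w; first by split; rewrite /= -iw.
    by move=> k kn; apply: zw; rewrite leq_max kn.
  by have := key _ erefl.
- move=> w v /set_mem[Iw [Cw Ew]] /set_mem[Iv [Cv Ev]] /= wv.
  have Aw : A (idx w) (w \o (fun k => cidx 0%N k)).
    have [_ _ ->] := h (idx w); exists (sub 1%N w) => //.
    by apply/funext => k /=; rewrite Ew.
  have Av : A (idx v) (w \o (fun k => cidx 0%N k)).
    have [_ _ ->] := h (idx v); exists (sub 1%N v) => //.
    by rewrite wv; apply/funext => k /=; rewrite Ev.
  have ii : idx w = idx v by apply: tA => //; exists (w \o (fun k => cidx 0%N k)).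
  have [_ inj _] := h (idx w).
  have s1 : sub 1%N w = sub 1%N v.
    apply: inj; rewrite ?inE//; first by rewrite ii.
    apply/funext => k /=; rewrite /sub /= -Ew ii -Ev.
    exact: (congr1 (@^~ k) wv).
  apply: cantor_ext => -[|[|j]] k.
  + exact: (congr1 (@^~ k) wv).
  + exact: (congr1 (@^~ k) s1).
  + by rewrite Iw Iv.
- apply/seteqP; split=> [z [i _ ]|_ [w [Iw [Cw Ew]] <-]].
    have [_ _ ->] := h i => -[v Cv vz].
    have [w wE] := cantor_glue (fun j => if j is j'.+2 then (fun=> i) else
      if j is 1%N then v else z).
    have iw : idx w = i by rewrite /idx wE.
    exists w; last by apply/funext => k /=; rewrite wE.
    split; first by move=> j k; rewrite wE iw.
    rewrite iw; split.
      by rewrite (_ : sub _ _ = v)//; apply/funext => k; rewrite /sub/= wE.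
    by move=> k; rewrite !wE -vz.
  exists (idx w) => //; have [_ _ ->] := h (idx w).
  by exists (sub 1%N w) => //; apply/funext => k /=; rewrite Ew.
Qed.

(** Complements are not directly accessible for such images, so the set and its complement are
    carried together through the induction on the sigma-algebra; only countable intersections and
    disjoint unions are then needed. *)
Lemma measurable_unique_souslin (A : set baire) : measurable A -> unique_souslin A.
Proof.
suff : measurable A -> unique_souslin A /\ unique_souslin (~` A) by move=> h /h[].
move: A; apply: smallest_sub; last first.
  move=> _ [k [m ->]]; split.
    exact: (unique_souslin_cylinder k [set m]).
  exact: (unique_souslin_cylinder k (~` [set m])).
have us0 : unique_souslin set0.
  by have := unique_souslin_cylinder 0 set0; rewrite (_ : [set _ | _] = set0).
have usT : unique_souslin setT.
  by have := unique_souslin_cylinder 0 setT; rewrite (_ : [set _ | _] = setT).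
split => /=.
- by rewrite setC0.
- by move=> A [uA uAC]; rewrite setTD setCK.
- move=> F uF.
  have uC : unique_souslin (~` \bigcup_i F i).
    by rewrite setC_bigcup; apply: unique_souslin_bigcap => i; case: (uF i).
  split => //.
  have -> : \bigcup_i F i = \bigcup_i seqDU F i by rewrite seqDU_bigcup_eq.
  apply: unique_souslin_bigcup; first exact: trivIset_seqDU.
  move=> i; rewrite /seqDU.
  (* Indices [j >= i] are padded with [F i], which turns the difference into a countable
     intersection. *)
  rewrite (_ : _ `\` _ = \bigcap_j (if (j < i)%N then ~` F j else F i)).
    by apply: unique_souslin_bigcap => j; case: ifP => _; case: (uF i); case: (uF j).
  apply/seteqP; split=> [z [Fz nz] j _|z hz].
    case: ifP => // ji Fj; apply: nz.
    by rewrite -bigcup_mkord; exists j.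
  split; first by have := hz i I; rewrite ltnn.
  by rewrite -bigcup_mkord => -[j /= ji Fj]; have := hz j I; rewrite ji.
Qed.

(** * Lusin separation, and Borel images of closed sets *)

Section separation.
Variables (C : set baire) (e : nat -> nat).
Hypotheses (cC : seq_closed C) (injC : set_inj C (fun w : baire => w \o e)).

Definition separated (P Q : set baire) :=
  exists2 B : set baire, measurable B & P `<=` B /\ Q `<=` ~` B.

Lemma separated_bigcup (P Q : nat -> set baire) :
  (forall i j, separated (P i) (Q j)) -> separated (\bigcup_i P i) (\bigcup_j Q j).
Proof.
move=> h.
have /choice[B hB] : forall i, exists B : nat -> set baire, forall j,
    measurable (B j) /\ (P i `<=` B j /\ Q j `<=` ~` B j).
  move=> i; have /choice[B hB] : forall j, exists B : set baire,
      measurable B /\ (P i `<=` B /\ Q j `<=` ~` B).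
    by move=> j; have [B mB sB] := h i j; exists B.
  by exists B.
exists (\bigcup_i \bigcap_j B i j).
  apply: bigcupT_measurable => i; apply: bigcapT_measurable => j.
  by case: (hB i j).
split.
  move=> z [i _ Pz]; exists i => // j _.
  by have [_ [+ _]] := hB i j; apply.
move=> z [j _ Qz] [i _ Bz].
by have [_ [_ /(_ _ Qz)]] := hB i j; apply; apply: Bz.
Qed.

Definition start n (a : nat -> nat) : set baire :=
  [set w \o e | w in [set w | C w /\ agree n a w]].

Definition upd (a : nat -> nat) n m := fun k => if k == n then m else a k.

Lemma start_bigcup n a : start n a = \bigcup_m start n.+1 (upd a n m).
Proof.
apply/seteqP; split.
  move=> _ [w [Cw aw] <-]; exists (w n) => //; exists w => //; split=> // k.
  by rewrite ltnS leq_eqVlt /upd; case: eqVneq => [->//|_ /= kn]; exact: aw.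
move=> _ [m _ [w [Cw aw] <-]]; exists w => //; split=> // k kn.
by rewrite -aw ?ltnS ?(ltnW kn)// /upd ifN// neq_ltn kn.
Qed.

(** Inseparability passes to some pair of longer prefixes, by [separated_bigcup]. Iterating gives
    two points of [C], different because the prefixes disagree, whose images differ by injectivity;
    a cylinder separates these images, and hence the pieces around them. *)
Lemma separated_start n a b : ~ agree n a b -> separated (start n a) (start n b).
Proof.
move=> nab; apply: contrapT => ns.
pose bad (p : nat * ((nat -> nat) * (nat -> nat))) :=
  ~ separated (start p.1 p.2.1) (start p.1 p.2.2).
have step n1 a1 b1 : ~ separated (start n1 a1) (start n1 b1) -> exists c : nat * nat,
    ~ separated (start n1.+1 (upd a1 n1 c.1)) (start n1.+1 (upd b1 n1 c.2)).
  rewrite (start_bigcup n1 a1) (start_bigcup n1 b1) => nsep.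
  apply: contrapT => nex; apply: nsep; apply: separated_bigcup => i j.
  by apply: contrapT => nij; apply: nex; exists (i, j).
have /choice[next hnext] : forall p : nat * ((nat -> nat) * (nat -> nat)), exists q,
    bad p -> bad q /\ (q.1 = p.1.+1 /\ agree p.1 p.2.1 q.2.1 /\ agree p.1 p.2.2 q.2.2).
  move=> [n1 [a1 b1]]; have [bp|] := pselect (bad (n1, (a1, b1))); last first.
    by move=> nb; exists (0%N, (a1, b1)).
  have [[i j] hij] := step _ _ _ bp.
  exists (n1.+1, (upd a1 n1 i, upd b1 n1 j)) => _; split=> //; split=> //=.
  by split=> k kn; rewrite /upd ifN// neq_ltn kn.
pose p i := iter i next (n, (a, b)).
have badp i : bad (p i).
  by elim: i => //= i ih; have [] := hnext _ ih.
have p1 i : (p i).1 = (n + i)%N.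
  elim: i => [|i ih]; first by rewrite addn0.
  by have [_ [/= -> _]] := hnext _ (badp i); rewrite ih addnS.
have agr i j : agree (n + i) (p i).2.1 (p (i + j)%N).2.1 /\
               agree (n + i) (p i).2.2 (p (i + j)%N).2.2.
  elim: j => [|j [iha ihb]]; first by rewrite addn0.
  have [_ [_ [ga gb]]] := hnext _ (badp (i + j)%N).
  rewrite addnS; split=> k kn; [rewrite iha//; apply: ga|rewrite ihb//; apply: gb].
  1,2: by rewrite p1 (leq_trans kn)// leq_add2l leq_addr.
(* After [k.+1] steps the prefixes have length [n + k.+1], so coordinate [k] no longer changes. *)
pose za : baire := fun k => (p k.+1).2.1 k; pose zb : baire := fun k => (p k.+1).2.2 k.
have agr' i : agree (n + i) (p i).2.1 za /\ agree (n + i) (p i).2.2 zb.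
  split=> k kn; rewrite /za /zb.
    have [ki|ki] := leqP i k.+1.
      by have [+ _] := agr i (k.+1 - i)%N; rewrite subnKC//; apply.
    have [+ _] := agr k.+1 (i - k.+1)%N; rewrite subnKC; last exact: ltnW.
    by move=> ->//; rewrite addnS ltnS leq_addl.
  have [ki|ki] := leqP i k.+1.
    by have [_ +] := agr i (k.+1 - i)%N; rewrite subnKC//; apply.
  have [_ +] := agr k.+1 (i - k.+1)%N; rewrite subnKC; last exact: ltnW.
  by move=> ->//; rewrite addnS ltnS leq_addl.
have startE i : start (n + i) (p i).2.1 = start (n + i) za /\
                start (n + i) (p i).2.2 = start (n + i) zb.
  have [ga gb] := agr' i.
  by split; apply/seteqP; split=> _ [w [Cw aw] <-]; exists w => //; split=> // k kn;
    rewrite -aw// ?ga// ?gb.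
have nsz i : ~ separated (start (n + i) za) (start (n + i) zb).
  by have := badp i; rewrite /bad p1; have [-> ->] := startE i.
(* If no point of [C] agreed with [za] that far, the piece would be empty and separated from the
   other one trivially. *)
have Cza : C za.
  apply: cC => i; apply: contrapT => nex; apply: (nsz i).
  exists set0 => //; split=> [_ [w [Cw aw] <-]|z _ []]; exfalso; apply: nex; exists w => //.
  by move=> k ki; apply: aw; rewrite ltn_addl.
have Czb : C zb.
  apply: cC => i; apply: contrapT => nex; apply: (nsz i).
  exists setT => //; split=> [//|_ [w [Cw aw] <-]]; exfalso; apply: nex; exists w => //.
  by move=> k ki; apply: aw; rewrite ltn_addl.
have [zz|/eqP zz] := pselect (za = zb).
  apply: nab => k kn.
  have [ga gb] := agr' 0%N.
  have /= -> := ga k; last by rewrite addn0.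
  by rewrite zz; have /= -> := gb k; last by rewrite addn0.
have [k ke] : exists k, za (e k) <> zb (e k).
  apply: contrapT => nex; apply/negP: zz; rewrite negbK; apply/eqP.
  apply: injC; rewrite ?inE//; apply/funext => k /=.
  by apply: contrapT => nk; apply: nex; exists k.
apply: (nsz (e k).+1).
have lt : (e k < n + (e k).+1)%N by rewrite addnS ltnS leq_addl.
exists (cylinder k (za (e k))); first exact: measurable_cylinder.
split=> _ [w [Cw aw] <-] /=; first by rewrite /cylinder /= aw.
by rewrite /cylinder /= -aw// => /esym.
Qed.

(** The images of the pieces of [C] with prefixes of a given length can be enclosed in pairwise
    disjoint Borel sets. The image of [C] consists of the points that lie, at every length, in one
    such enclosure. *)
Lemma measurable_unique_souslin_image : measurable ((fun w : baire => w \o e) @` C : set baire).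
Proof.
pose st (p : seq nat) := start (size p) (nth 0%N p).
have sepp (p q : seq nat) : exists B : set baire, measurable B /\
    (size p = size q -> p <> q -> st p `<=` B /\ st q `<=` ~` B).
  have [[spq npq]|] := pselect (size p = size q /\ p <> q); last first.
    by move=> nn; exists set0; split=> // s1 s2; case: nn.
  have [|B mB hB] := @separated_start (size p) (nth 0%N p) (nth 0%N q).
    by move=> ag; apply: npq; apply: (@eq_from_nth _ 0%N).
  by exists B; split=> // _ _; rewrite /st -spq.
have /choice[E hE] : forall p, exists E : seq nat -> set baire, forall q,
    measurable (E q) /\ (size p = size q -> p <> q -> st p `<=` E q /\ st q `<=` ~` E q).
  by move=> p; have /choice[E hE] := sepp p; exists E.
(* [E p q] and [E q p] are chosen independently; membership in one and exclusion from the other make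
   the sets [B p] of one length disjoint. *)
pose B p := \bigcap_(q in [set q | size p = size q /\ p <> q]) (E p q `\` E q p) .
have mB p : measurable (B p).
  rewrite /B -[X in measurable X]setCK setC_bigcap bigcup_mkcond; apply: measurableC.
  apply: countable_bigcupT_measurable => // q; case: ifP => // _; apply: measurableC.
  by apply: measurableD; [case: (hE p q)|case: (hE q p)].
have stB p : st p `<=` B p.
  move=> z pz q [/= spq npq]; split; first by have [_ /(_ spq npq)[+ _]] := hE p q; apply.
  move=> Ez; have [_ /(_ (esym spq) (fun h => npq (esym h)))[_ /(_ _ pz)]] := hE q p.
  exact.
have B_disj p q z : size p = size q -> B p z -> B q z -> p = q.
  move=> spq pz qz; apply: contrapT => npq.
  have [Ez _] := pz q (conj spq npq).
  by have [_] := qz p (conj (esym spq) (fun h => npq (esym h))).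
(* Intersecting along all prefixes forces the prefixes found at different lengths to be nested.
   Nonemptiness of the piece later puts the limit sequence into [C], which is closed. *)
pose B' p := (\bigcap_(k in [set: nat]) B (take k p)) `&` [set z | st p !=set0] .
have mB' p : measurable (B' p).
  apply: measurableI; first by apply: bigcapT_measurable => k.
  have [h|h] := pselect (st p !=set0).
    by rewrite (_ : [set _ | _] = setT)//; apply/seteqP; split.
  by rewrite (_ : [set _ | _] = set0)//; apply/seteqP; split.
(* Plays the role of the closure of a piece: the coordinates of [z] that the prefix already
   determines must have the right values, which identifies [z] as the image of the limit. *)
pose B'' p := B' p `&` [set z : baire | forall k, (e k < size p)%N -> z k = nth 0%N p (e k)].
have mB'' p : measurable (B'' p).
  apply: measurableI => //.
  rewrite (_ : [set _ | _] = \bigcap_k (if (e k < size p)%N then cylinder k (nth 0%N p (e k)) else setT)).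
    apply: bigcapT_measurable => k; case: ifP => _ //.
    exact: measurable_cylinder.
  apply/seteqP; split=> z /= hz k; first by move=> _; case: ifP => // kp; apply: hz.
  by move=> kp; have := hz k I; rewrite kp.
rewrite (_ : _ @` _ = \bigcap_n \bigcup_(p in [set p | size p = n]) B'' p).
  apply: bigcapT_measurable => n.
  rewrite bigcup_mkcond; apply: countable_bigcupT_measurable => // p.
  by case: ifP.
apply/seteqP; split.
  move=> _ [w Cw <-] n _; exists (mkseq w n); rewrite /= ?size_mkseq//.
  have st_take k : st (take k (mkseq w n)) (w \o e).
    exists w => //; split=> // i; rewrite size_take_min size_mkseq leq_min => /andP[ik iN].
    by rewrite nth_take// nth_mkseq.
  split; last by move=> k; rewrite size_mkseq => kn; rewrite /= nth_mkseq.
  split; first by move=> k _; apply: stB.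
  exists (w \o e); have := st_take n; rewrite take_oversize// size_mkseq//.
move=> z hz.
have /choice[p hp] : forall n, exists p, size p = n /\ B'' p z.
  by move=> n; have [p] := hz n I; exists p.
have ptake n : take n (p n.+1) = p n.
  have [s1 [[b1 _] _]] := hp n.+1; have [s0 [[b0 _] _]] := hp n.
  apply: (B_disj _ _ z); first by rewrite size_take s1 ltnSn s0.
    exact: b1.
  by have := b0 n I; rewrite take_oversize// s0.
pose w : baire := fun k => nth 0%N (p k.+1) k.
have pw n k : (k < n)%N -> nth 0%N (p n) k = w k.
  elim: n => // n ih; rewrite ltnS leq_eqVlt => /predU1P[->//|kn].
  by rewrite -(ih kn) -[p n in RHS]ptake nth_take.
exists w.
  apply: cC => n; have [sp [[_ [_ [v [Cv av] _]]] _]] := hp n.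
  by exists v => // k kn; rewrite -av ?sp// pw.
apply/funext => k /=; have [sp [_ hz']] := hp (e k).+1.
by rewrite hz' ?sp// pw.
Qed.

End separation.

(** The Borel set [S] is itself an injective reindexing of a closed set, and reindexings compose. *)
Lemma measurable_reindex_image (S : set baire) (u : nat -> nat) :
  measurable S -> set_inj S (fun w : baire => w \o u) ->
  measurable ((fun w : baire => w \o u) @` S : set baire).
Proof.
move=> /measurable_unique_souslin[C [e [cC injC SE]]] injS.
have := @measurable_unique_souslin_image C (e \o u) cC.
rewrite (_ : _ @` _ = (fun w : baire => w \o u) @` S).
  apply; move=> w v Cw Cv wv; apply: injC => //; apply: injS => //.
    by rewrite inE SE; exists w => //; apply/set_mem.
  by rewrite inE SE; exists v => //; apply/set_mem.
rewrite SE; apply/seteqP; split=> [_ [w Cw <-]|_ [_ [w Cw <-] <-]].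
  by exists (w \o e) => //; exists w.
by exists w.
Qed.

(** A Borel isomorphism onto a Borel subset of the Baire space; through it the Lusin-Souslin theorem
    for sequences transfers to standard Borel spaces. *)
Definition borel_embedding d (T : measurableType d) (phi : T -> baire) :=
  [/\ injective phi, measurable (range phi) &
      measurable = [set phi @^-1` B | B in measurable]].

Lemma borel_embedding_fun d (T : measurableType d) (phi : T -> baire) :
  borel_embedding phi -> measurable_fun setT phi.
Proof.
by move=> [_ _ mE] _ B mB; rewrite setTI mE; exists B.
Qed.

Lemma borel_embedding_image d (T : measurableType d) (phi : T -> baire) A :
  borel_embedding phi -> measurable A -> measurable (phi @` A).
Proof.
move=> [inj mr ->] [B mB <-].
rewrite (_ : _ @` _ = B `&` range phi); first exact: measurableI.
apply/seteqP; split=> [_ [x Bx <-]|z [Bx [x _ xE]]].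
  by split=> //; exists x.
by exists x; rewrite /= ?xE.
Qed.

(** The map [f] is replaced by a projection: its graph is coded as a Borel set of sequences, and the
    image of [A] is the projection of the graph, which is injective because [f] is injective on
    [A]. *)
Lemma measurable_injective_image d d' (T : measurableType d) (T' : measurableType d')
    (phi : T -> baire) (psi : T' -> baire) (f : T -> T') (A : set T) :
  borel_embedding phi -> borel_embedding psi -> measurable A -> measurable_fun A f ->
  set_inj A f -> measurable (f @` A).
Proof.
move=> ephi epsi mA mf injf.
have [iphi mrphi mE] := ephi; have [ipsi _ mE'] := epsi.
pose sub i (w : baire) : baire := w \o (fun k => cidx i k).
(* Row 0 codes [f x] and row 1 codes [x]. The other rows repeat row 1 so that no coordinate is free.
   The last condition states the graph relation coordinate by coordinate, which exhibits it as
   Borel. *)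
pose S := [set w : baire | (phi @` A) (sub 1%N w)] `&`
  ([set w | forall j k, w (cidx j.+1 k) = w (cidx 1%N k)] `&`
   [set w | forall k m, w (cidx 0%N k) = m ->
      (phi @` (A `&` f @^-1` (psi @^-1` cylinder k m))) (sub 1%N w)]).
have mS : measurable S.
  apply: measurableI.
    have := measurable_reindex (fun k => cidx 1%N k) measurableT (borel_embedding_image ephi mA).
    by rewrite setTI.
  apply: measurableI.
    rewrite (_ : [set _ | _] = \bigcap_j \bigcap_k
       [set w : baire | w (cidx j.+1 k) = w (cidx 1%N k)]).
      by do 2! (apply: bigcapT_measurable => ?); exact: measurable_coord_eq.
    by apply/seteqP; split=> w /= h j; [move=> _ k _; apply: h|move=> k; exact: (h j I k I)].
  rewrite (_ : [set _ | _] = \bigcap_k \bigcap_m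
     (~` cylinder (cidx 0%N k) m `|`
     (sub 1%N) @^-1` (phi @` (A `&` f @^-1` (psi @^-1` cylinder k m))))).
    do 2! (apply: bigcapT_measurable => ?).
    apply: measurableU; first by apply: measurableC; exact: measurable_cylinder.
    rewrite -[X in measurable X]setTI; apply: measurable_reindex => //.
    apply: borel_embedding_image => //.
    apply: mf => //.
    rewrite -[X in measurable X]setTI; apply: (borel_embedding_fun epsi) => //.
    exact: measurable_cylinder.
  apply/seteqP; split=> w /= h k.
    move=> _ m _; have [hm|hm] := pselect (w (cidx 0%N k) = m); last by left.
    by right; apply: h.
  by move=> m hm; have [|//] := h k I m I; case.
have S0 w x : S w -> sub 1%N w = phi x -> sub 0%N w = psi (f x).
  move=> [_ [_ h]] wx; apply/funext => k.
  have [y /= [_ fy]] := h k _ erefl; rewrite wx => /iphi yx.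
  by rewrite /sub /= -fy yx.
have injS : set_inj S (sub 0%N).
  move=> w v /set_mem Sw /set_mem Sv wv.
  have [[x Ax xw] [jw _]] := Sw; have [[y Ay yv] [jv _]] := Sv.
  have fxy : f x = f y.
    by apply: ipsi; rewrite -(S0 _ _ Sw (esym xw)) -(S0 _ _ Sv (esym yv)).
  have xy : x = y by apply: injf; rewrite ?inE.
  apply: cantor_ext => -[|j] k; first exact: (congr1 (@^~ k) wv).
  rewrite jw jv; have : sub 1%N w = sub 1%N v by rewrite -xw -yv xy.
  by move/(congr1 (@^~ k)).
rewrite mE'; exists (sub 0%N @` S); first exact: measurable_reindex_image.
apply/seteqP; split=> [y [w Sw wy]|_ [x Ax <-]].
  have [[x Ax xw] _] := Sw; exists x => //; apply: ipsi.
  by rewrite -(S0 _ _ Sw (esym xw)).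
have [w wE] := cantor_glue (fun j => if j is 0%N then psi (f x) else phi x).
have subE i : sub i w = if i is 0%N then psi (f x) else phi x.
  by apply/funext => k; rewrite /sub /= wE.
exists w; last by rewrite subE.
split; first by exists x => //; rewrite subE.
split; first by move=> j k; rewrite !wE.
move=> k m; rewrite wE => km; exists x => //; first by rewrite subE.
Qed.

Local Open Scope ring_scope.

(** * Borel sets defined by formulas with countable quantifiers *)

Section measurable_pred.
Context d (T : measurableType d).
Implicit Types P Q : T -> Prop.

Lemma measurable_pred_cst (P : Prop) : measurable [set _ : T | P].
Proof.
have [p|np] := pselect P.
  by rewrite (_ : [set _ | _] = setT)//; apply/seteqP; split.
by rewrite (_ : [set _ | _] = set0)//; apply/seteqP; split.
Qed.

Lemma measurable_pred_all (P : nat -> T -> Prop) :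
  (forall n, measurable [set z | P n z]) -> measurable [set z | forall n, P n z].
Proof.
move=> h; rewrite (_ : [set _ | _] = \bigcap_n [set z | P n z]).
  exact: bigcapT_measurable.
by apply/seteqP; split=> z /= hz n; [move=> _; exact: hz|exact: (hz n I)].
Qed.

Lemma measurable_pred_ex (P : nat -> T -> Prop) :
  (forall n, measurable [set z | P n z]) -> measurable [set z | exists n, P n z].
Proof.
move=> h; rewrite (_ : [set _ | _] = \bigcup_n [set z | P n z]).
  exact: bigcupT_measurable.
by apply/seteqP; split=> z /= [n]; [exists n|move=> _; exists n].
Qed.

Lemma measurable_pred_imply P Q : measurable [set z | P z] ->
  measurable [set z | Q z] -> measurable [set z | P z -> Q z].
Proof.
move=> mP mQ; rewrite (_ : [set _ | _] = ~` [set z | P z] `|` [set z | Q z]).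
  by apply: measurableU => //; exact: measurableC.
apply/seteqP; split=> z /=; last by move=> [].
by have [p|] := pselect (P z); [move=> /(_ p); right|left].
Qed.

Lemma measurable_pred_and P Q : measurable [set z | P z] ->
  measurable [set z | Q z] -> measurable [set z | P z /\ Q z].
Proof. exact: measurableI. Qed.

End measurable_pred.

(** * Coding a Polish space in the Baire space *)

Section polish.
Context (R : realType) (P : completeMetricType R).

Definition inv_succ (j : nat) : R := j.+1%:R^-1.
Local Notation r := inv_succ.

Lemma separable_seq : separable P -> exists u : nat -> P, forall (x : P) (e : R), 0 < e ->
  exists i, mdist x (u i) < e.
Proof.
move=> [D /countable_injP[f injf] dD].
have /choice[u hu] : forall n, exists x, forall y, D y -> f y = n -> x = y.
  move=> n; have [[y [Dy fy]]|ny] := pselect (exists y, D y /\ f y = n).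
    by exists y => z Dz fz; apply: injf; rewrite ?inE// fy fz.
  by exists point => y Dy fy; exfalso; apply: ny; exists y.
exists u => x e e0.
have /dD[//|y [yb Dy]] : (ball x e)^° !=set0.
  by exists x; exact: nbhsx_ballx.
  exact: open_interior.
exists (f y); rewrite (hu _ _ Dy erefl).
by have := interior_subset yb; rewrite ballEmdist.
Qed.

Lemma open_mball (x : P) (e : R) : open [set y | mdist x y < e].
Proof.
rewrite openE => y /= xy; apply/nbhs_ballP; exists (e - mdist x y); first by rewrite /= subr_gt0.
rewrite ballEmdist => z /= yz.
by rewrite (le_lt_trans (metric_triangle _ y _))// -ltrBrDl.
Qed.

Lemma inv_gt0 j : 0 < r j.
Proof. by rewrite /r invr_gt0. Qed.

Lemma inv_lt (e : R) : 0 < e -> exists j, r j < e.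
Proof. by move=> /ltr_add_invr[j]; rewrite add0r; exists j. Qed.

Variable u : nat -> P.
Hypothesis hu : forall (x : P) (e : R), 0 < e -> exists i, mdist x (u i) < e.

Let code n := Cantor.of_nat n.

(** The 0-1 list of the basic balls that contain [x]. It need not be continuous in [x], but it is a
    Borel isomorphism onto a Borel set. *)
Definition ball_code (x : P) : baire :=
  fun n => nat_of_bool (mdist x (u (code n).1) < r (code n).2).

Let ball_codeE x i j : ball_code x (cidx i j) = nat_of_bool (mdist x (u i) < r j).
Proof. by rewrite /ball_code /code /cidx Cantor.cancel_of_to. Qed.

Lemma ball_code_inj : injective ball_code.
Proof.
move=> x y xy; apply: mdist_positivity; apply/eqP; rewrite eq_le mdist_ge0 andbT.
rewrite leNgt; apply/negP => d0.
have [j hj] := inv_lt (divr_gt0 d0 (ltr0Sn R 1)).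
have [i hi] := hu x (inv_gt0 j).
have := congr1 (@^~ (cidx i j)) xy; rewrite /= !ball_codeE hi.
case: ltP => // yi _.
have := metric_triangle x (u i) y; rewrite (metric_sym (u i)).
by move=> h; have := lt_le_trans (ltrD (lt_trans hi hj) (lt_trans yi hj)) (lexx _); lra.
Qed.

(** What characterizes the lists of balls around a point: 0-1 values; every radius occurs; listed
    balls are close enough to meet; and a ball is listed exactly when some listed ball is formally
    strictly inside it. All quantifiers range over integers, so the set is Borel. *)
Let code_cond := [set z : baire |
  (forall n, z n = 0%N \/ z n = 1%N) /\
  ((forall j, exists i, z (cidx i j) = 1%N) /\
  ((forall i j i' j', z (cidx i j) = 1%N -> z (cidx i' j') = 1%N ->
     mdist (u i) (u i') < r j + r j') /\
   (forall i j, (z (cidx i j) = 1%N -> exists i' j', z (cidx i' j') = 1%N /\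
     mdist (u i) (u i') + r j' < r j) /\
     ((exists i' j', z (cidx i' j') = 1%N /\
     mdist (u i) (u i') + r j' < r j) -> z (cidx i j) = 1%N))))].

Let measurable_code_cond : measurable code_cond.
Proof.
have mc n k : measurable [set z : baire | z n = k] by exact: measurable_cylinder.
repeat first [ exact: mc | exact: measurable_pred_cst
  | apply: measurable_pred_all => ? | apply: measurable_pred_ex => ?
  | apply: measurable_pred_and | apply: measurable_pred_imply
  | apply: measurableU ].
Qed.

Let range_ball_code : range ball_code = code_cond.
Proof.
apply/seteqP; split.
  move=> _ [x _ <-]; split; first by move=> n; rewrite /ball_code; case: ltP; [right|left].
  split.
    move=> j; have [i hi] := hu x (inv_gt0 j).
    by exists i; rewrite ball_codeE hi.
  split.
    move=> i j i' j'; rewrite !ball_codeE; case: ltP => // h1 _; case: ltP => // h2 _.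
    by rewrite (le_lt_trans (metric_triangle _ x _))// (metric_sym _ x) ltrD.
  move=> i j; rewrite !ball_codeE; split; last first.
    move=> [i' [j' [+ h2]]]; rewrite ball_codeE; case: ltP => // h1 _.
    rewrite (le_lt_trans (metric_triangle _ (u i') _))//.
    by rewrite (metric_sym (u i')) (le_lt_trans _ h2)// addrC lerD2l ltW.
  case: ltP => // h _.
  have h' : 0 < (r j - mdist x (u i)) / 2 by rewrite divr_gt0// subr_gt0.
  have [j' hj'] := inv_lt h'.
  have [i' hi'] := hu x (inv_gt0 j').
  exists i', j'; rewrite ball_codeE hi'; split=> //.
  have := metric_triangle (u i) x (u i'); rewrite (metric_sym (u i) x) => h3.
  lra.
move=> z [z01 [zex [zco ziff]]].
have /choice[c hc] := zex.
pose v j := u (c j).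
have vco j j' : mdist (v j) (v j') < r j + r j' by exact: zco.
have rlt j j' : (j' <= j)%N -> r j <= r j'.
  by move=> jj; rewrite /r lef_pV2 ?posrE// ler_nat ltnS.
(* Completeness enters here: centres of listed balls of radius [r j] form a Cauchy sequence, whose
   limit is the coded point. *)
have /cauchy_cvgP/cvg_ex[/= x vx] : cauchy (v @ \oo).
  apply/cauchy_ballP => e e0.
  have [k hk] := inv_lt (divr_gt0 e0 (ltr0Sn R 1)).
  near=> xy.
  have: exists j1 j2, [/\ (k <= j1)%N, (k <= j2)%N, v j1 = xy.1 & v j2 = xy.2].
    near: xy.
    exists ([set y | exists2 j, (k <= j)%N & v j = y], [set y | exists2 j, (k <= j)%N & v j = y]).
      by split; exists k => // j /= kj; exists j.
    by move=> [y1 y2] /= [[j1 h1 <-] [j2 h2 <-]]; exists j1, j2.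
  move=> [j1 [j2 [h1 h2 <- <-]]]; rewrite ballEmdist /=.
  have := vco j1 j2; have := rlt _ _ h1; have := rlt _ _ h2; lra.
have xv j : mdist x (v j) <= r j.
  apply/ler_addgt0Pr => e e0.
  have [k hk] := inv_lt (divr_gt0 e0 (ltr0Sn R 1)).
  have /vx[N _ /(_ (maxn N k) (leq_maxl _ _))] : nbhs x (ball x (e / 2)).
    by apply: nbhsx_ballx; rewrite divr_gt0.
  rewrite /= ballEmdist /= => h1.
  have := vco (maxn N k) j; have := rlt _ _ (leq_maxr N k).
  have := metric_triangle x (v (maxn N k)) (v j); lra.
have xu i j : z (cidx i j) = 1%N -> mdist x (u i) <= r j.
  move=> zij; apply/ler_addgt0Pr => e e0.
  have [k hk] := inv_lt (divr_gt0 e0 (ltr0Sn R 1)).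
  have := zco _ _ _ _ (hc k) zij; rewrite -/(v k).
  have := metric_triangle x (v k) (u i); have := xv k; lra.
exists x => //; apply: cantor_ext => i j; rewrite ball_codeE.
(* The limit only yields non-strict inequalities; the clause on balls strictly inside restores the
   strict one. *)
have [zi zi'] := ziff i j.
case: ltP => h.
  apply/esym; apply: zi'.
  have h' : 0 < (r j - mdist x (u i)) / 2 by rewrite divr_gt0// subr_gt0.
  have [k hk] := inv_lt h'.
  exists (c k), k; split; first exact: hc.
  have := metric_triangle (u i) x (v k); rewrite (metric_sym (u i) x).
  have := xv k; rewrite /v; lra.
case: (z01 (cidx i j)) => // z1; exfalso.
have [i' [j' [/xu h1 h2]]] := zi z1.
have := metric_triangle x (u i') (u i); rewrite (metric_sym (u i')); lra.
Unshelve. all: by end_near. Qed.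

Lemma measurable_range_ball_code : measurable (range ball_code).
Proof. by rewrite range_ball_code. Qed.

Lemma borel_ball_code : <<s @open P >> = [set ball_code @^-1` B | B in measurable].
Proof.
apply/seteqP; split; last first.
  move=> _ [B + <-]; move: B; apply: smallest_sub.
    have /= := @sigma_algebra_image _ _ setT ball_code <<s @open P >>.
    move=> /(_ (smallest_sigma_algebra _ _)) [h1 h2 h3]; split.
    - by rewrite /= preimage_set0; exact: sigma_algebra0.
    - by move=> A hA; rewrite /= setTD preimage_setC -setTD; exact: sigma_algebraCD.
    - by move=> F hF; rewrite /= preimage_bigcup; exact: sigma_algebra_bigcup.
  move=> _ [n [m ->]] /=.
  have o1 : <<s @open P >> [set x | mdist (u (code n).1) x < r (code n).2].
    by apply: sub_sigma_algebra; exact: open_mball.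
  case: m => [|[|m]].
  - rewrite (_ : _ @^-1` _ = setT `\` [set x | mdist (u (code n).1) x < r (code n).2]).
      exact: sigma_algebraCD.
    apply/seteqP; split=> x; rewrite /= /cylinder /= /ball_code metric_sym.
      by case: ltP => // h _; split=> //; apply/negP; rewrite -leNgt.
    by move=> [_ /negP/negbTE ->].
  - rewrite (_ : _ @^-1` _ = [set x | mdist (u (code n).1) x < r (code n).2])//.
    apply/seteqP; split=> x; rewrite /= /cylinder /= /ball_code metric_sym.
      by case: ltP.
    by move=> ->.
  - rewrite (_ : _ @^-1` _ = set0); first exact: sigma_algebra0.
    by apply/seteqP; split=> x //=; rewrite /cylinder /= /ball_code; case: ltP.
have sa : sigma_algebra setT [set ball_code @^-1` B | B in @measurable _ baire].
  have := @sigma_algebra_preimage P baire (@measurable _ baire) setT ball_code.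
  move=> /(_ (@sigma_algebra_measurable _ baire)).
  congr sigma_algebra; apply/seteqP; split=> A [B mB <-]; exists B => //; by rewrite setTI.
apply: smallest_sub => // O oO.
(* An open set is the union of the basic balls it contains, and there are countably many of
   these. *)
have -> : O = ball_code @^-1` (\bigcup_i \bigcup_(j in [set j | [set x | mdist x (u i) < r j] `<=` O])
     cylinder (cidx i j) 1).
  apply/seteqP; split=> x /=.
    move=> Ox; have /nbhs_ballP[e /= e0 eO] : nbhs x O by exact: open_nbhs_nbhs.
    have [j hj] := inv_lt (divr_gt0 e0 (ltr0Sn R 1)).
    have [i hi] := hu x (inv_gt0 j).
    exists i => //; exists j; last by rewrite /cylinder/= ball_codeE hi.
    move=> y /= yi; apply: eO; rewrite ballEmdist /=.
    have h1 := metric_triangle x (u i) y; rewrite (metric_sym (u i)) in h1.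
    by apply: (le_lt_trans h1); rewrite (splitr e) ltrD// (lt_trans _ hj).
  move=> [i _ [j /= sO]]; rewrite /cylinder /= ball_codeE; case: ltP => // h _.
  exact: sO.
exists (\bigcup_i \bigcup_(j in [set j | [set x | mdist x (u i) < r j] `<=` O])
     cylinder (cidx i j) 1) => //.
by do 2! apply: bigcup_measurable => ? _; exact: measurable_cylinder.
Qed.

End polish.

Lemma standard_borel_embedding (R : realType) d (T : measurableType d) :
  standard_borel R T -> exists phi : T -> baire, borel_embedding phi.
Proof.
move=> [P [f [sP [g fK gK] mE]]].
have [u hu] := separable_seq sP.
exists (ball_code u \o f); split.
- by move=> x y /(ball_code_inj hu)/(can_inj fK).
- rewrite (_ : range _ = range (ball_code u)); first exact: measurable_range_ball_code.
  apply/seteqP; split=> [_ [x _ <-]|_ [x _ <-]]; first by exists (f x).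
  by exists (g x) => //=; rewrite gK.
- rewrite mE (borel_ball_code hu); apply/seteqP; split.
    by move=> _ [_ [B mB <-] <-]; exists B.
  by move=> _ [B mB <-]; exists (ball_code u @^-1` B) => //; exists B.
Qed.

Lemma measurable_image (R : realType) d d' (T : measurableType d) (T' : measurableType d')
    (f : T -> T') (A : set T) :
  standard_borel R T -> standard_borel R T' -> measurable A -> measurable_fun A f ->
  set_inj A f -> measurable (f @` A).
Proof.
move=> /standard_borel_embedding[phi ephi] /standard_borel_embedding[psi epsi].
exact: measurable_injective_image ephi epsi.
Qed.

(** * Products of standard Borel spaces *)

Section product_metric.
Context (R : realType) (P Q : completeMetricType R).

Let dist (p q : P * Q) : R := Num.max (mdist p.1 q.1) (mdist p.2 q.2).

Let dist_ge0 p q : 0 <= dist p q.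
Proof. by rewrite le_max mdist_ge0. Qed.

Let dist_eq0 p q : dist p q = 0 -> p = q.
Proof.
case: p q => [p1 p2] [q1 q2] h.
have : dist (p1, p2) (q1, q2) <= 0 by rewrite h.
rewrite ge_max => /andP[/= h1 h2].
by congr pair; apply: mdist_positivity; apply/eqP; rewrite eq_le mdist_ge0 andbT.
Qed.

Let ballE p e : ball p e = [set q | dist p q < e].
Proof.
apply/seteqP; split=> q; rewrite {1}/ball /= /prod_ball !ballEmdist /= /dist gt_max.
  by move=> [-> ->].
by move=> /andP.
Qed.

HB.instance Definition _ := PseudoMetric_isMetric.Build R (P * Q)%type
  dist_ge0 dist_eq0 ballE.

HB.instance Definition _ := Pointed.on (P * Q)%type.

Let prod_complete (F : set_system (P * Q)) : ProperFilter F -> cauchy F ->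
  [cvg F in (P * Q)%type].
Proof.
move=> PF /cauchy_ballP cF.
have c1 : cauchy (fst @ F).
  apply/cauchy_ballP => e e0; have := cF e e0 => -[[A B] /= [FA FB] AB].
  exists (fst @` A, fst @` B); first by
    split; [apply: filterS FA => x ?; exists x|apply: filterS FB => x ?; exists x].
  by move=> [_ _] [[/= x Ax <-] [y By <-]] /=; have [] := AB (x, y) (conj Ax By).
have c2 : cauchy (snd @ F).
  apply/cauchy_ballP => e e0; have := cF e e0 => -[[A B] /= [FA FB] AB].
  exists (snd @` A, snd @` B); first by
    split; [apply: filterS FA => x ?; exists x|apply: filterS FB => x ?; exists x].
  by move=> [_ _] [[/= x Ax <-] [y By <-]] /=; have [] := AB (x, y) (conj Ax By).
move/cauchy_cvgP/cvg_ex : c1 => [x /= x1]; move/cauchy_cvgP/cvg_ex : c2 => [y /= y2].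
apply/cvg_ex; exists (x, y).
apply/cvg_ballP => e e0; near=> z; split.
  by near: z; exact: (cvg_ball x1).
by near: z; exact: (cvg_ball y2).
Unshelve. all: by end_near. Qed.

HB.instance Definition _ := Uniform_isComplete.Build (P * Q)%type prod_complete.

End product_metric.

Lemma separable_prod (R : realType) (P Q : completeMetricType R) :
  separable P -> separable Q -> separable (P * Q)%type.
Proof.
move=> /separable_seq[u hu] /separable_seq[v hv].
exists (range (fun n => (u (Cantor.of_nat n).1, v (Cantor.of_nat n).2))).
  exact: card_image_le.
move=> O [x Ox] oO.
have /nbhs_ballP[e /= e0 eO] : nbhs x O by exact: open_nbhs_nbhs.
have [i hi] := hu x.1 e e0; have [j hj] := hv x.2 e e0.
exists (u i, v j); split; last by exists (Cantor.to_nat (i, j)); rewrite ?Cantor.cancel_of_to.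
by apply: eO; split; rewrite ballEmdist.
Qed.

Lemma standard_borel_prod (R : realType) d d' (T : measurableType d) (T' : measurableType d') :
  standard_borel R T -> standard_borel R T' -> standard_borel R (T * T')%type.
Proof.
move=> [P [f [sP [f' fK f'K] mE]]] [Q [g [sQ [g' gK g'K] mE']]].
exists (P * Q)%type, (fun x => (f x.1, g x.2)); split.
- exact: separable_prod.
- exists (fun y => (f' y.1, g' y.2)) => -[a b] /=; rewrite ?fK ?gK ?f'K ?g'K//.
have [u hu] := separable_seq sP; have [v hv] := separable_seq sQ.
pose h (x : T * T') := (f x.1, g x.2).
have cont1 (B : set P) : <<s open >> B -> <<s open >> [set x : P * Q | B x.1].
  move: B; apply: smallest_sub => [|O oO]; last first.
    by apply: sub_sigma_algebra; apply: open_comp => // x _; exact: cvg_fst.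
  split => /=; first by rewrite (_ : [set _ | _] = set0)//; exact: sigma_algebra0.
    move=> A hA; rewrite (_ : [set _ | _] = setT `\` [set x : P * Q | A x.1]).
      exact: sigma_algebraCD.
    by apply/seteqP; split=> x.
  move=> F hF; rewrite (_ : [set _ | _] = \bigcup_k [set x : P * Q | F k x.1]).
    exact: sigma_algebra_bigcup.
  by apply/seteqP; split=> x.
have cont2 (B : set Q) : <<s open >> B -> <<s open >> [set x : P * Q | B x.2].
  move: B; apply: smallest_sub => [|O oO]; last first.
    by apply: sub_sigma_algebra; apply: open_comp => // x _; exact: cvg_snd.
  split => /=; first by rewrite (_ : [set _ | _] = set0)//; exact: sigma_algebra0.
    move=> A hA; rewrite (_ : [set _ | _] = setT `\` [set x : P * Q | A x.2]).
      exact: sigma_algebraCD.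
    by apply/seteqP; split=> x.
  move=> F hF; rewrite (_ : [set _ | _] = \bigcup_k [set x : P * Q | F k x.2]).
    exact: sigma_algebra_bigcup.
  by apply/seteqP; split=> x.
apply/seteqP; split.
  have sa : sigma_algebra setT [set h @^-1` B | B in <<s @open (P * Q)%type >>].
    have := @sigma_algebra_preimage _ _ <<s @open (P * Q)%type >> setT h.
    move=> /(_ (smallest_sigma_algebra _ _)).
    by congr sigma_algebra; apply/seteqP; split=> A [B mB <-]; exists B => //; rewrite setTI.
  apply: smallest_sub => // A [[B]|[B]].
    rewrite mE => -[C oC <-] <-; rewrite setTI.
    by exists [set x | C x.1]; first exact: cont1.
  rewrite mE' => -[C oC <-] <-; rewrite setTI.
  by exists [set x | C x.2]; first exact: cont2.
move=> _ [B + <-]; move: B; apply: smallest_sub.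
  split => /=; first by rewrite preimage_set0.
    by move=> A hA; rewrite setTD preimage_setC; exact: measurableC.
  by move=> F hF; rewrite preimage_bigcup; exact: bigcupT_measurable.
move=> O oO /=.
(* Separability of the factors makes each open set of the product a countable union of boxes of
   balls, so that it belongs to the product sigma-algebra. *)
pose good i j k := [set x : P * Q | mdist x.1 (u i) < inv_succ R k /\ mdist x.2 (v j) < inv_succ R k] `<=` O.
rewrite (_ : _ @^-1` O = \bigcup_i \bigcup_j \bigcup_(k in [set k | good i j k])
   ((f @^-1` [set x | mdist (u i) x < inv_succ R k]) `*` (g @^-1` [set x | mdist (v j) x < inv_succ R k]))).
  do 3!apply: bigcup_measurable => ? _.
  apply: measurableX; rewrite ?mE ?mE'; eexists; try reflexivity.
    by apply: sub_sigma_algebra; exact: open_mball.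
  by apply: sub_sigma_algebra; exact: open_mball.
apply/seteqP; split=> x /=.
  move=> Ox; have /nbhs_ballP[e /= e0 eO] : nbhs (h x) O by exact: open_nbhs_nbhs.
  have [k hk] := inv_lt (divr_gt0 e0 (ltr0Sn R 1)).
  have [i hi] := hu (h x).1 _ (inv_gt0 R k); have [j hj] := hv (h x).2 _ (inv_gt0 R k).
  exists i => //; exists j => //; exists k; last first.
    by split; rewrite /= metric_sym.
  move=> y [/= y1 y2]; apply: eO; split; rewrite ballEmdist /=.
    have h1 := metric_triangle (h x).1 (u i) y.1; rewrite (metric_sym (u i)) in h1.
    by apply: (le_lt_trans h1); rewrite (splitr e) ltrD// (lt_trans _ hk).
  have h1 := metric_triangle (h x).2 (v j) y.2; rewrite (metric_sym (v j)) in h1.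
  by apply: (le_lt_trans h1); rewrite (splitr e) ltrD// (lt_trans _ hk).
move=> [i _ [j _ [k gk [/= h1 h2]]]]; apply: gk; split; rewrite /= metric_sym //.
Qed.

(** Equality is tested on the countably many coordinates of a Borel embedding. *)
Lemma measurable_eq (R : realType) d d' (T : measurableType d) (T' : measurableType d')
    (f g : T -> T') : standard_borel R T' ->
  measurable_fun setT f -> measurable_fun setT g -> measurable [set x | f x = g x].
Proof.
move=> /standard_borel_embedding[phi ephi] mf mg.
have [inj _ _] := ephi.
rewrite (_ : [set _ | _] = [set x | forall n m, phi (f x) n = m -> phi (g x) n = m]).
  apply: measurable_pred_all => n; apply: measurable_pred_all => m.
  apply: measurable_pred_imply.
    have := measurableT_comp (borel_embedding_fun ephi) mf.
    by move=> /(_ measurableT _ (measurable_cylinder n m)); rewrite setTI.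
  have := measurableT_comp (borel_embedding_fun ephi) mg.
  by move=> /(_ measurableT _ (measurable_cylinder n m)); rewrite setTI.
apply/seteqP; split=> x /=; first by move=> ->.
by move=> h; apply: inj; apply/funext => n; rewrite (h n _ erefl).
Qed.

(** * Discrete measurable groupoids *)

Lemma measurable_fun_pairD d d1 d2 (T : measurableType d) (T1 : measurableType d1)
    (T2 : measurableType d2) (D : set T) (f : T -> T1) (g : T -> T2) :
  measurable_fun D f -> measurable_fun D g -> measurable_fun D (fun x => (f x, g x)).
Proof.
move=> mf mg mD.
apply: (measurability _ (measurable_prod_measurableType T1 T2)) => //.
move=> _ [_ [A mA [B mB <-]] <-].
rewrite (_ : _ `&` _ = (D `&` f @^-1` A) `&` (D `&` g @^-1` B)).
  by apply: measurableI; [exact: mf|exact: mg].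
by apply/seteqP; split=> x /=; [move=> [? []]|move=> [[? ?] []]].
Qed.

Section groupoid_theory.
Context (G : groupoidType).
Implicit Types g h : G.

Lemma gunitsE : @gunits G = [set g | gsrc g = g].
Proof.
apply/seteqP; split=> g /=; first by move=> [h _ <-]; rewrite gsrc_src.
by move=> <-; exists g.
Qed.

Lemma gtgt_unit g : gsrc g = g -> gtgt g = g.
Proof. by move=> <-; rewrite gtgt_src. Qed.

Lemma gmulKr g h : gsrc g = gtgt h -> gmul g h = h -> g = gtgt h.
Proof.
move=> gh ghh; have : gmul g (gmul h (ginv h)) = gtgt h.
  by rewrite gmulA ?gtgt_inv// ghh gmulgV.
by rewrite gmulgV -gh gmul_src.
Qed.

End groupoid_theory.

Section measurable_groupoid.
Context (R : realType) d (G : mgroupoidType d).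
Hypothesis dmG : Defs.discrete_measurable R G.

Let sbG : standard_borel R G. Proof. by case: dmG. Qed.

(** The source of [g] is the product of [ginv g] and [g], a pair that is always composable. *)
Lemma measurable_gsrc : measurable_fun setT (@gsrc G).
Proof.
have [_ mmul minv _] := dmG.
move=> _ A mA; rewrite setTI.
have [B mB BE] := mmul A mA.
rewrite (_ : _ @^-1` _ = (fun g => (ginv g, g)) @^-1` B).
  rewrite -[X in measurable X]setTI.
  exact: (measurable_fun_pair minv (@measurable_id _ G setT)).
have BE' g : A (gsrc g) <-> B (ginv g, g).
  have cg : composable (ginv g, g) by rewrite /composable /= gsrc_inv.
  have := congr1 (@^~ (ginv g, g)) BE; rewrite /setI /= gmulVg => E.
  by split=> h; [have : composable (ginv g, g) /\ A (gsrc g) by []; rewrite E => -[]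
    | have : composable (ginv g, g) /\ B (ginv g, g) by []; rewrite -E => -[]].
by apply/seteqP; split=> g /BE'.
Qed.

Lemma measurable_gtgt : measurable_fun setT (@gtgt G).
Proof.
have [_ _ minv _] := dmG.
rewrite (_ : @gtgt G = @gsrc G \o @ginv G); last by apply/funext => g /=; rewrite gsrc_inv.
exact: measurableT_comp measurable_gsrc minv.
Qed.

Lemma measurable_gunits : measurable (@gunits G).
Proof.
rewrite gunitsE; apply: (measurable_eq sbG) => //.
exact: measurable_gsrc.
Qed.

Lemma measurable_composable : measurable (@composable G).
Proof.
apply: (measurable_eq sbG).
  exact: measurableT_comp measurable_gsrc measurable_fst.
exact: measurableT_comp measurable_gtgt measurable_snd.
Qed.

Lemma measurable_gmul d' (X : measurableType d') (f g : X -> G) (A : set X) :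
  measurable_fun setT f -> measurable_fun setT g ->
  (forall x, A x -> gsrc (f x) = gtgt (g x)) ->
  measurable_fun A (fun x => gmul (f x) (g x)).
Proof.
move=> mf mg fg mA C mC.
have [_ mmul _ _] := dmG; have [B mB BE] := mmul C mC.
have := measurable_funTS (measurable_fun_pair mf mg) mA mB.
congr measurable; apply/seteqP; split=> x [Ax /= h]; split => //=.
  suff : (@composable G `&` B) (f x, g x) by rewrite -BE => -[].
  by split=> //; exact: fg.
suff : (@composable G `&` (fun p => gmul p.1 p.2) @^-1` C) (f x, g x) by rewrite BE => -[].
by split=> //; exact: fg.
Qed.

Lemma borel_bisectionS (A B : set G) : borel_bisection A -> measurable B -> B `<=` A ->
  borel_bisection B.
Proof.
move=> [mA sA tA] mB BA; split=> //.
  by move=> x y /set_mem Bx /set_mem By; apply: sA; rewrite inE; exact: BA.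
by move=> x y /set_mem Bx /set_mem By; apply: tA; rewrite inE; exact: BA.
Qed.

Lemma borel_bisectionI (A B : set G) : borel_bisection A -> measurable B ->
  borel_bisection (A `&` B).
Proof. by move=> bA mB; apply: (borel_bisectionS bA) => //; apply: measurableI => //; case: bA. Qed.

Lemma borel_bisection_gunits : borel_bisection (@gunits G).
Proof.
rewrite gunitsE; split; first by rewrite -gunitsE; exact: measurable_gunits.
  by move=> x y /set_mem/= xx /set_mem/= yy; rewrite xx yy.
by move=> x y /set_mem/= /gtgt_unit xx /set_mem/= /gtgt_unit yy; rewrite xx yy.
Qed.

Lemma measurable_gsrc_image (A : set G) : measurable A -> set_inj A (@gsrc G) ->
  measurable (@gsrc G @` A).
Proof.
move=> mA; apply: (measurable_image sbG sbG) => //.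
exact: measurable_funTS measurable_gsrc.
Qed.

Lemma measurable_gtgt_image (A : set G) : measurable A -> set_inj A (@gtgt G) ->
  measurable (@gtgt G @` A).
Proof.
move=> mA; apply: (measurable_image sbG sbG) => //.
exact: measurable_funTS measurable_gtgt.
Qed.

Lemma borel_bisection_gsrc (A : set G) : borel_bisection A ->
  borel_bisection (@gsrc G @` A).
Proof.
move=> [mA sA tA]; apply: (borel_bisectionS borel_bisection_gunits).
  exact: measurable_gsrc_image.
by move=> _ [g _ <-]; exists g.
Qed.

Lemma borel_bisection_gtgt (A : set G) : borel_bisection A ->
  borel_bisection (@gtgt G @` A).
Proof.
move=> [mA sA tA]; apply: (borel_bisectionS borel_bisection_gunits).
  exact: measurable_gtgt_image.
by move=> _ [g _ <-]; rewrite gunitsE /= gsrc_tgt.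
Qed.

(** The source of [ab] determines [b] and then [a], so multiplication is injective on the composable
    pairs of [A] and [B], and the Lusin-Souslin theorem makes its image Borel. *)
Lemma borel_bisection_mul (A B : set G) : borel_bisection A -> borel_bisection B ->
  borel_bisection (bisection_mul A B).
Proof.
move=> [mA sA tA] [mB sB tB].
have decs a b a' b' : A a -> B b -> A a' -> B b' -> gsrc a = gtgt b -> gsrc a' = gtgt b' ->
    gsrc (gmul a b) = gsrc (gmul a' b') -> a = a' /\ b = b'.
  move=> Aa Bb Aa' Bb' ab ab'; rewrite !gsrc_mul// => sbb.
  have bb : b = b' by apply: sB => //; rewrite inE.
  by split=> //; apply: sA; rewrite ?inE// ab ab' bb.
have dect a b a' b' : A a -> B b -> A a' -> B b' -> gsrc a = gtgt b -> gsrc a' = gtgt b' ->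
    gtgt (gmul a b) = gtgt (gmul a' b') -> a = a' /\ b = b'.
  move=> Aa Bb Aa' Bb' ab ab'; rewrite !gtgt_mul// => taa.
  have aa : a = a' by apply: tA => //; rewrite inE.
  by split=> //; apply: tB; rewrite ?inE// -ab -ab' aa.
split.
- rewrite (_ : bisection_mul A B =
      (fun p => gmul p.1 p.2) @` ((A `*` B) `&` @composable G)); last first.
    apply/seteqP; split=> [_ [a [b [Aa Bb ab ->]]]|_ [[a b] [[/= Aa Bb] ab] <-]].
      by exists (a, b).
    by exists a, b.
  apply: (measurable_image (standard_borel_prod sbG sbG) sbG).
  + by apply: measurableI; [exact: measurableX|exact: measurable_composable].
  + apply: measurable_gmul => [||x [_ //]].
      exact: measurable_funTS measurable_fst.
    exact: measurable_funTS measurable_snd.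
  + move=> [a b] [a' b'] /set_mem[[/= Aa Bb] ab] /set_mem[[/= Aa' Bb'] ab'] E.
    by have [-> ->] := decs a b a' b' Aa Bb Aa' Bb' ab ab' (congr1 (@gsrc G) E).
- move=> _ _ /set_mem[a [b [Aa Bb ab ->]]] /set_mem[a' [b' [Aa' Bb' ab' ->]]] E.
  by have [-> ->] := decs a b a' b' Aa Bb Aa' Bb' ab ab' E.
- move=> _ _ /set_mem[a [b [Aa Bb ab ->]]] /set_mem[a' [b' [Aa' Bb' ab' ->]]] E.
  by have [-> ->] := dect a b a' b' Aa Bb Aa' Bb' ab ab' E.
Qed.

End measurable_groupoid.

Lemma discrete_measurable_prod (R : realType) d1 d2 (G : mgroupoidType d1)
    (H : mgroupoidType d2) : Defs.discrete_measurable R G -> Defs.discrete_measurable R H ->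
  Defs.discrete_measurable R (G * H)%type.
Proof.
move=> dG dH; have [sG mG iG cG] := dG; have [sH mH iH cH] := dH.
have sGH := standard_borel_prod sG sH.
have m11 : measurable_fun setT (fun p : (G * H) * (G * H) => p.1.1).
  exact: measurableT_comp measurable_fst measurable_fst.
have m12 : measurable_fun setT (fun p : (G * H) * (G * H) => p.1.2).
  exact: measurableT_comp measurable_snd measurable_fst.
have m21 : measurable_fun setT (fun p : (G * H) * (G * H) => p.2.1).
  exact: measurableT_comp measurable_fst measurable_snd.
have m22 : measurable_fun setT (fun p : (G * H) * (G * H) => p.2.2).
  exact: measurableT_comp measurable_snd measurable_snd.
have mC : measurable (@composable (G * H)%type).
  apply: (measurable_eq sGH).
    apply: measurable_fun_pair.
      exact: measurableT_comp (measurable_gsrc dG) m11.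
    exact: measurableT_comp (measurable_gsrc dH) m12.
  apply: measurable_fun_pair.
    exact: measurableT_comp (measurable_gtgt dG) m21.
  exact: measurableT_comp (measurable_gtgt dH) m22.
split => //.
- move=> A mA.
  have : measurable_fun (@composable (G * H)%type) (fun p => gmul p.1 p.2).
    apply: measurable_fun_pairD.
      apply: (measurable_gmul dG); [exact: m11|exact: m21|].
      by move=> p []. 
    apply: (measurable_gmul dH); [exact: m12|exact: m22|].
    by move=> p [].
  move=> /(_ mC _ mA) mCA; eexists; first exact: mCA.
  by rewrite setIA setIid.
- apply: measurable_fun_pair.
    exact: measurableT_comp iG measurable_fst.
  exact: measurableT_comp iH measurable_snd.
- move=> x; rewrite gunitsE => xu.
  have x1 : gunits x.1 by rewrite gunitsE /= -[in RHS]xu.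
  have x2 : gunits x.2 by rewrite gunitsE /= -[in RHS]xu.
  rewrite (_ : _ @^-1` _ = (@gsrc G @^-1` [set x.1]) `*` (@gsrc H @^-1` [set x.2])).
    exact: countableX (cG _ x1) (cH _ x2).
  case: x {xu x1 x2} => a b; apply/seteqP; split=> -[g h].
    by move=> -[ga hb]; split.
  by move=> [/= ga hb]; congr pair.
Qed.

(** * Product measures and bisections of a product groupoid *)

Section injective_pullback.
Context (R : realType) d d' (T : measurableType d) (T' : measurableType d').
Variables (c : T -> T') (D : set T) (P : {finite_measure set T' -> \bar R}).

(* Every Borel subset of [D] has a Borel image, so [E |-> P (c (D n E))] is a
   measure. *)
Definition measurable_injection :=
  [/\ standard_borel R T, standard_borel R T', measurable D, measurable_fun setT c & set_inj D c].

Hypothesis mc : measurable_injection.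

(** Taking the proof as an argument lets the measure instances be attached to [pullback mc]. *)
Definition pullback of measurable_injection := fun E : set T => P (c @` (D `&` E)).

Lemma measurable_injection_image E : measurable E -> measurable (c @` (D `&` E)).
Proof.
have [sT sT' mD mfc ic] := mc => mE.
apply: (measurable_image sT sT').
- exact: measurableI.
- exact: measurable_funTS.
- by move=> x y /set_mem[Dx _] /set_mem[Dy _]; apply: ic; rewrite inE.
Qed.

Let pb0 : pullback mc set0 = 0%E.
Proof. by rewrite /pullback setI0 image_set0 measure0. Qed.

Let pb_ge0 E : (0 <= pullback mc E)%E.
Proof. exact: measure_ge0. Qed.

Let pb_sigma : semi_sigma_additive (pullback mc).
Proof.
move=> F mF tF mUF; rewrite /pullback setI_bigcupr image_bigcup.
have [_ _ _ _ ic] := mc.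
apply: measure_semi_sigma_additive => [i||].
- exact: measurable_injection_image.
- move=> i j _ _ [_ [[x [Dx Fx] <-] [y [Dy Fy] yx]]].
  have xy : y = x by apply: ic; rewrite ?inE.
  by apply: tF => //; exists x; split=> //; rewrite -xy.
- by rewrite -image_bigcup -setI_bigcupr; exact: measurable_injection_image.
Qed.

HB.instance Definition _ := isMeasure.Build _ _ _ (pullback mc) pb0 pb_ge0 pb_sigma.

Let pb_fin : fin_num_fun (pullback mc).
Proof. by move=> E mE; rewrite fin_num_measure//; exact: measurable_injection_image. Qed.

HB.instance Definition _ := Measure_isFinite.Build _ _ _ (pullback mc) pb_fin.

End injective_pullback.

Lemma measure_countable_bigcup0 (R : realType) d (T : measurableType d)
    (P : {measure set T -> \bar R}) (I : choiceType) (D : set I) (F : I -> set T) :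
  countable D -> (forall i, D i -> measurable (F i)) ->
  (forall i, D i -> P (F i) = 0%E) -> P (\bigcup_(i in D) F i) = 0%E.
Proof.
move=> /countable_injP[f injf] mF PF.
have /choice[u hu] : forall n, exists A : set T, [/\ measurable A, P A = 0%E,
    (forall i, D i -> f i = n -> A = F i) & A `<=` \bigcup_(i in D) F i].
  move=> n; have [[i [Di fi]]|ni] := pselect (exists i, D i /\ f i = n).
    exists (F i); split; [exact: mF|exact: PF| |by move=> x Fx; exists i].
    by move=> j Dj fj; congr F; apply: injf; rewrite ?inE// fi fj.
  exists set0; split=> // i Di fi; exfalso; apply: ni; by exists i.
rewrite (_ : \bigcup_(i in D) F i = \bigcup_n u n).
  apply/eqP; rewrite -measure_le0.
  have mu_u n : measurable (u n) by case: (hu n).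
  have := generalized_Boole_inequality P mu_u (bigcupT_measurable _ mu_u).
  by rewrite eseries0// => n _ _; case: (hu n).
apply/seteqP; split=> [x [i Di Fx]|x [n _ ux]].
  by exists (f i) => //; case: (hu (f i)) => _ _ /(_ i Di erefl) -> _.
by case: (hu n) => _ _ _; apply.
Qed.

Lemma pair_setT_measurable_eq (R : realType) d1 d2 (T1 : measurableType d1) (T2 : measurableType d2)
    (m1 m2 : {finite_measure set (T1 * T2)%type -> \bar R}) :
  (forall A B, measurable A -> measurable B -> m1 (A `*` B) = m2 (A `*` B)) ->
  forall E, measurable E -> m1 E = m2 E.
Proof.
move=> h E mE.
apply: (measure_unique [set A `*` B | A in measurable & B in measurable] (fun=> setT)) => //.
- exact: measurable_prod_measurableType.
- move=> _ _ [A mA [B mB <-]] [C mC [D mD <-]].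
  exists (A `&` C); first exact: measurableI.
  by exists (B `&` D); [exact: measurableI|rewrite setXI].
- by move=> _; exists setT => //; exists setT => //; rewrite setXTT.
- by rewrite bigcup_const.
- by move=> _ [A mA [B mB <-]]; exact: h.
- by move=> _; rewrite -ge0_fin_numE ?fin_num_measure.
Qed.

Lemma product_measure_swap (R : realType) d1 d2 (T1 : measurableType d1)
    (T2 : measurableType d2) (mu : probability T1 R) (nu : probability T2 R) E :
  measurable E -> (nu \x mu)%E ((fun p => (p.2, p.1)) @^-1` E) = (mu \x nu)%E E.
Proof.
move=> mE; apply/esym.
have ms : measurable_fun setT (fun p : T2 * T1 => (p.2, p.1)).
  by apply: measurable_fun_pair; [exact: measurable_snd|exact: measurable_fst].
have := @product_measure_unique _ _ _ _ _ mu nu (pushforward (nu \x mu)%E (fun p : T2 * T1 => (p.2, p.1))).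
apply => // A B mA mB.
transitivity ((nu \x mu)%E (B `*` A)); last by rewrite product_measure1E// muleC.
suff -> : B `*` A = (fun p => (p.2, p.1)) @^-1` (A `*` B) by [].
by apply/seteqP; split=> -[x y] /= [].
Qed.

(** * Weights of arrows of one factor relative to a product bisection *)

Section fiberwise_atoms.
Context (R : realType) d1 d2 (G : measurableType d1) (H : measurableType d2).
Variables (a : G -> G) (b : H -> H) (D : set (G * H)).
Variables (mu : probability G R) (nu : probability H R).
Hypotheses (sG : standard_borel R G) (sH : standard_borel R H).
Hypotheses (ma : measurable_fun setT a) (mb : measurable_fun setT b).
Hypothesis mD : measurable D.

Let c (p : G * H) := (a p.1, b p.2).

Hypothesis ic : set_inj D c.

Let mc : measurable_fun setT c.
Proof.
apply: measurable_fun_pair.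
  exact: measurableT_comp ma measurable_fst.
exact: measurableT_comp mb measurable_snd.
Qed.

Lemma pair_measurable_injection : measurable_injection R c D.
Proof. by split=> //; exact: standard_borel_prod. Qed.

(** Only the second coordinate is mapped, so that the image of [D] has as sections exactly the sets
    weighed below; their measure is then a Borel function of [g]. *)
Let c2 (p : G * H) := (p.1, b p.2).

Let mT : measurable (c2 @` D).
Proof.
apply: (measurable_image (standard_borel_prod sG sH) (standard_borel_prod sG sH)) => //.
  apply: measurable_funTS; apply: measurable_fun_pair; first exact: measurable_fst.
  exact: measurableT_comp mb measurable_snd.
move=> [g h] [g' h'] Dx Dy -[gg hh]; apply: ic => //.
by rewrite /c /= gg hh.
Qed.

Definition atom_weight (g : G) : \bar R := nu (b @` xsection D g).

Let weightE g : atom_weight g = nu (xsection (c2 @` D) g).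
Proof.
rewrite /atom_weight; congr (nu _); apply/seteqP; split=> y.
  by move=> [h /xsectionP Dh <-]; apply/xsectionP; exists (g, h).
by move/xsectionP => [[g' h] Dh [<- <-]]; exists h => //; exact/xsectionP.
Qed.

Lemma measurable_atom_weight : measurable_fun setT atom_weight.
Proof.
rewrite (_ : atom_weight = nu \o xsection (c2 @` D)); last by apply/funext => g; exact: weightE.
exact: measurable_fun_xsection.
Qed.

Let mbx g : measurable (b @` xsection D g).
Proof.
apply: (measurable_image sH sH); [exact: measurable_xsection|exact: measurable_funTS|].
move=> h h' /set_mem/xsectionP Dh /set_mem/xsectionP Dh' hh.
by have [] : (g, h) = (g, h') by apply: ic; rewrite ?inE// /c /= hh.
Qed.

Let csectionE Z x : xsection (c @` (D `&` (Z `*` setT))) x =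
  \bigcup_(g in Z `&` a @^-1` [set x]) b @` xsection D g.
Proof.
apply/seteqP; split=> y.
  move/xsectionP => [[g h] [Dh [/= Zg _]] [gx hy]].
  by exists g => //; exists h => //; exact/xsectionP.
move=> [g [Zg gx] [h /xsectionP Dh <-]]; apply/xsectionP.
by exists (g, h) => //; rewrite /c /= gx.
Qed.

(** By Fubini it is enough to look over a fixed [x]. There the image is a union over the arrows of
    [Z] in the fibre of [a], countably many null sets. *)
Lemma pullback_weight0 Z : (forall x, countable (a @^-1` [set x])) -> measurable Z ->
  (forall g, Z g -> atom_weight g = 0%E) ->
  (mu \x nu)%E (c @` (D `&` (Z `*` setT))) = 0%E.
Proof.
move=> ca mZ Z0; rewrite /product_measure1 integral0_eq// => x _ /=.
rewrite csectionE; apply: measure_countable_bigcup0 => // [|g [Zg _]].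
  by apply: sub_countable (ca x); apply: subset_card_le => g [].
exact: Z0.
Qed.

(* The sets [b @` xsection D g], for [g] in a fiber of [a], are disjoint.  So if [g]
   has positive weight, some Borel cell [E s] around [g] is small enough for the
   points of the fiber in it to have total weight less than twice that of [g]; two
   such points cannot share a cell. *)
Lemma weight_gt0_cover : exists A : seq nat -> set G,
  [/\ forall s, measurable (A s), forall s, set_inj (A s) a &
      [set g | (0 < atom_weight g)%E] `<=` \bigcup_s A s].
Proof.
have [phi ephi] := standard_borel_embedding sG.
have [iphi _ _] := ephi.
pose E (s : seq nat) := [set g | forall k, (k < size s)%N -> phi g k = nth 0%N s k].
have mE s : measurable (E s).
  apply: measurable_pred_all => k; apply: measurable_pred_imply.
    exact: measurable_pred_cst.
  have := borel_embedding_fun ephi measurableT (measurable_cylinder k (nth 0%N s k)).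
  by rewrite setTI.
pose S s := c @` (D `&` (E s `*` setT)).
have mS s : measurable (S s).
  apply: (measurable_injection_image pair_measurable_injection).
  exact: measurableX.
pose q s x := nu (xsection (S s) x).
pose A s := E s `&` [set g | (q s (a g) < atom_weight g + atom_weight g)%E].
have mq s : measurable_fun setT (q s \o a).
  by apply: measurableT_comp ma; exact: measurable_fun_xsection.
have fin_w g : atom_weight g \is a fin_num by rewrite fin_num_measure.
exists A; split.
- move=> s; apply: measurableI => //.
  have := measurable_lte measurableT (mq s) (emeasurable_funD measurable_atom_weight measurable_atom_weight).
  by rewrite setTI.
- move=> s g g' /set_mem[Eg /= qg] /set_mem[Eg' /= qg'] gg.
  apply: contrapT => ne.
  have dis : b @` xsection D g `&` b @` xsection D g' = set0.
    rewrite -subset0 => _ [[h /xsectionP Dh <-] [h' /xsectionP Dh' hh]].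
    by apply: ne; have [] : (g, h) = (g', h') by apply: ic; rewrite ?inE// /c /= hh gg.
  have : (atom_weight g + atom_weight g' <= q s (a g))%E.
    rewrite -measureU//; apply: le_measure; rewrite ?inE.
    + exact: measurableU.
    + exact: measurable_xsection.
    + rewrite csectionE => y [hy|hy]; first by exists g.
      by exists g' => //; split.
  move: qg qg'; rewrite -gg /q.
  have := fin_w g; have := fin_w g'.
  have : nu (xsection (S s) (a g)) \is a fin_num.
    by rewrite fin_num_measure//; exact: measurable_xsection.
  case: (nu _) => // r _; case: (atom_weight g) => // r1; case: (atom_weight g') => // r2 _ _.
  rewrite -!EFinD !lte_fin lee_fin; lra.
- move=> g /= g0.
  pose s n := mkseq (phi g) n.
  have sE n g' : E (s n) g' <-> forall k, (k < n)%N -> phi g' k = phi g k.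
    by rewrite /E /s /= size_mkseq; split=> h k kn; have := h k kn; rewrite nth_mkseq.
  have : nu \o (fun n => xsection (S (s n)) (a g)) @ \oo --> nu (\bigcap_n xsection (S (s n)) (a g)).
    apply: nonincreasing_cvg_mu.
    - by rewrite -ge0_fin_numE ?fin_num_measure//; exact: measurable_xsection.
    - by move=> n; exact: measurable_xsection.
    - by apply: bigcapT_measurable => n; exact: measurable_xsection.
    - move=> n m nm; apply/subsetPset; rewrite !csectionE => y [g' [/sE Eg' gx] hy].
      by exists g' => //; split=> //; apply/sE => k kn; apply: Eg'; exact: leq_trans kn nm.
  rewrite (_ : \bigcap_n _ = b @` xsection D g); last first.
    apply/seteqP; split=> y; last first.
      by move=> hy n _; rewrite csectionE; exists g => //; split=> //; apply/sE.
    move=> hy.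
    have /choice[v hv] : forall n, exists g', [/\ E (s n) g', a g' = a g & (b @` xsection D g') y].
      by move=> n; have := hy n I; rewrite csectionE => -[g' [Eg' gx] hg']; exists g'.
    (* The arrows [v n] all account for the same [y] over the same point, so injectivity on [D]
       makes them equal; lying in every cell, this arrow is [g]. *)
    suff vg n : v n = v 0%N.
      suff <- : v 0%N = g by case: (hv 0%N).
      apply: iphi; apply/funext => k; rewrite -(vg k.+1).
      by have [/sE/(_ k (ltnSn k))] := hv k.+1.
    have [_ ag [h /xsectionP Dh hy']] := hv n.
    have [_ ag0 [h0 /xsectionP Dh0 hy0]] := hv 0%N.
    have [//] : (v n, h) = (v 0%N, h0).
    by apply: ic; rewrite ?inE// /c /= ag ag0 hy' hy0.
  rewrite -/(atom_weight g) => cv.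
  have : (atom_weight g < atom_weight g + atom_weight g)%E by rewrite lteDl.
  move=> lt.
  have [n hn] : exists n, (nu (xsection (S (s n)) (a g)) < atom_weight g + atom_weight g)%E.
    have [N _ hN] := cv _ (open_ereal_lt' lt).
    by exists N; exact: (hN N (leqnn N)).
  by exists (s n) => //; split=> //; apply/sE.
Qed.

End fiberwise_atoms.

Lemma ginvK (G : groupoidType) (g : G) : ginv (ginv g) = g.
Proof.
have : gmul (ginv (ginv g)) (gmul (ginv g) g) = g.
  by rewrite gmulA ?gsrc_inv ?gtgt_inv// gmulVg gsrc_inv gmul_tgt.
by rewrite gmulVg => {2}<-; rewrite -[in RHS](gtgt_inv g) -gsrc_inv gmul_src.
Qed.

Lemma countable_gsrc_fiber (R : realType) d (G : mgroupoidType d) (x : G) :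
  Defs.discrete_measurable R G -> countable (@gsrc G @^-1` [set x]).
Proof.
move=> [_ _ _ cG]; have [xu|xu] := pselect (gunits x); first exact: cG.
rewrite (_ : _ @^-1` _ = set0); first exact: countable0.
by rewrite -subset0 => g /= gx; apply: xu; exists g.
Qed.

Lemma countable_gtgt_fiber (R : realType) d (G : mgroupoidType d) (x : G) :
  Defs.discrete_measurable R G -> countable (@gtgt G @^-1` [set x]).
Proof.
move=> dG; rewrite (_ : _ @^-1` _ = @ginv G @` (@gsrc G @^-1` [set x])).
  exact: (card_le_trans (card_image_le _ _) (countable_gsrc_fiber x dG)).
apply/seteqP; split=> [g /= gx|_ [g /= gx <-]]; last by rewrite gtgt_inv.
by exists (ginv g); rewrite ?ginvK//= gsrc_inv.
Qed.

Section bisection_measures.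
Context (R : realType) d (G : mgroupoidType d).
Hypothesis dG : Defs.discrete_measurable R G.

Lemma gsrc_injection (A : set G) : borel_bisection A -> measurable_injection R (@gsrc G) A.
Proof.
have [sG _ _ _] := dG.
by move=> [mA sA tA]; split=> //; exact: measurable_gsrc dG.
Qed.

Lemma gtgt_injection (A : set G) : borel_bisection A -> measurable_injection R (@gtgt G) A.
Proof.
have [sG _ _ _] := dG.
by move=> [mA sA tA]; split=> //; exact: measurable_gtgt dG.
Qed.

End bisection_measures.

Section product_bisections.
Context (R : realType) d1 d2 (G : mgroupoidType d1) (H : mgroupoidType d2).

Lemma borel_bisectionX (A : set G) (B : set H) : borel_bisection A -> borel_bisection B ->
  borel_bisection (A `*` B : set (G * H)%type).
Proof.
move=> [mA sA tA] [mB sB tB]; split; first exact: measurableX.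
- by move=> [g h] [g' h'] /set_mem[/= Ag Bh] /set_mem[/= Ag' Bh'] -[gg hh]; congr pair;
    [apply: sA|apply: sB]; rewrite ?inE.
- by move=> [g h] [g' h'] /set_mem[/= Ag Bh] /set_mem[/= Ag' Bh'] -[gg hh]; congr pair;
    [apply: tA|apply: tB]; rewrite ?inE.
Qed.

Lemma borel_bisection_swap (D : set (G * H)%type) : borel_bisection D ->
  borel_bisection ((fun p : H * G => (p.2, p.1)) @^-1` D : set (H * G)%type).
Proof.
move=> [mD sD tD]; split.
- have ms : measurable_fun setT (fun p : H * G => (p.2, p.1)).
    by apply: measurable_fun_pair; [exact: measurable_snd|exact: measurable_fst].
  by have := ms measurableT _ mD; rewrite setTI.
- move=> [h g] [h' g'] /set_mem/= Dp /set_mem/= Dq -[hh gg].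
  by have [-> ->] : (g, h) = (g', h') by apply: sD; rewrite ?inE// /gsrc /= hh gg.
- move=> [h g] [h' g'] /set_mem/= Dp /set_mem/= Dq -[hh gg].
  by have [-> ->] : (g, h) = (g', h') by apply: tD; rewrite ?inE// /gtgt /= hh gg.
Qed.

Lemma xsection_bisection (D : set (G * H)%type) (g : G) : borel_bisection D ->
  borel_bisection (xsection D g : set H).
Proof.
move=> [mD sD tD]; split; first exact: measurable_xsection.
- move=> h h' /set_mem/xsectionP Dh /set_mem/xsectionP Dh' hh.
  by have [] : (g, h) = (g, h') by apply: sD; rewrite ?inE// /gsrc /= hh.
- move=> h h' /set_mem/xsectionP Dh /set_mem/xsectionP Dh' hh.
  by have [] : (g, h) = (g, h') by apply: tD; rewrite ?inE// /gtgt /= hh.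
Qed.

Variables (mu : probability G R) (nu : probability H R).
Hypotheses (pG : pmp_groupoid mu) (pH : pmp_groupoid nu).

(** The section of [D] over [g] is a bisection of [H], so invariance of [nu] gives [g] the same
    weight for sources as for ranges. Hence one exceptional set serves both, and the arrows of
    positive weight are covered by intersections of a set on which the source is injective with one
    on which the range is. *)
Lemma bisection_left_cover (D : set (G * H)%type) : borel_bisection D ->
  exists A : nat -> set G, [/\ forall n, borel_bisection (A n), trivIset setT A,
    (mu \x nu)%E (@gsrc (G * H)%type @` (D `&` (~` (\bigcup_n A n) `*` setT))) = 0%E &
    (mu \x nu)%E (@gtgt (G * H)%type @` (D `&` (~` (\bigcup_n A n) `*` setT))) = 0%E].
Proof.
move=> bD; have [mD sD tD] := bD.
have [dG _ _] := pG; have [dH _ pmpH] := pH.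
have [sG _ _ _] := dG; have [sH _ _ _] := dH.
have [As [mAs iAs cAs]] := weight_gt0_cover nu sG sH (measurable_gsrc dG) (measurable_gsrc dH) mD sD.
have [At [mAt iAt cAt]] := weight_gt0_cover nu sG sH (measurable_gtgt dG) (measurable_gtgt dH) mD tD.
have wE g : atom_weight (@gsrc H) D nu g = atom_weight (@gtgt H) D nu g.
  by rewrite /atom_weight; apply: pmpH; exact: xsection_bisection.
pose A' n := if @unpickle (seq nat * seq nat)%type n is Some st then As st.1 `&` At st.2 else set0.
have mA' n : measurable (A' n).
  by rewrite /A'; case: unpickle => // st; exact: measurableI.
have bA' n : borel_bisection (A' n).
  split=> //; move=> x y; rewrite /A'; case: unpickle => [st|].
  - by move=> /set_mem[xs _] /set_mem[ys _]; apply: (iAs st.1); rewrite inE.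
  - by move=> /set_mem.
  - by move=> /set_mem[_ xs] /set_mem[_ ys]; apply: (iAt st.2); rewrite inE.
  - by move=> /set_mem.
have w0 g : (~` \bigcup_n seqDU A' n) g -> atom_weight (@gsrc H) D nu g = 0%E.
  rewrite -seqDU_bigcup_eq => ng; apply/eqP; rewrite -measure_le0 leNgt; apply/negP => gt0.
  have [s _ gs] := cAs g gt0.
  have [t _ gt] : (\bigcup_s At s) g by apply: cAt; rewrite /= -wE.
  by apply: ng; exists (pickle (s, t)) => //; rewrite /A' pickleK.
have mS n : measurable (seqDU A' n) by exact: seqDU_measurable.
have mZ : measurable (~` \bigcup_n seqDU A' n).
  by apply: measurableC; exact: bigcupT_measurable.
exists (seqDU A'); split.
- by move=> n; apply: (borel_bisectionS (bA' n)) => //; exact: subset_seqDU.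
- exact: trivIset_seqDU.
- apply: (pullback_weight0 (a := @gsrc G) (b := @gsrc H)) => // [|x].
    exact: measurable_gsrc dH.
  exact: countable_gsrc_fiber dG.
- have w0' g : (~` \bigcup_n seqDU A' n) g -> atom_weight (@gtgt H) D nu g = 0%E.
    by rewrite -wE; exact: w0.
  apply: (pullback_weight0 (a := @gtgt G) (b := @gtgt H)) => // [|x].
    exact: measurable_gtgt dH.
  exact: countable_gtgt_fiber dG.
Qed.

End product_bisections.

Section product_pmp.
Context (R : realType) d1 d2 (G : mgroupoidType d1) (H : mgroupoidType d2).
Variables (mu : probability G R) (nu : probability H R).
Hypotheses (pG : pmp_groupoid mu) (pH : pmp_groupoid nu).

Let dG : Defs.discrete_measurable R G. Proof. by case: pG. Qed.
Let dH : Defs.discrete_measurable R H. Proof. by case: pH. Qed.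
Let dGH := discrete_measurable_prod dG dH.

(** An arrow outside the grid is missed in [G] or in [H]. The first kind is negligible by
    [bisection_left_cover], the second by the same lemma with the factors swapped. *)
Let bisection_grid_cover (D : set (G * H)%type) : borel_bisection D ->
  exists (A : nat -> set G) (B : nat -> set H), [/\
    (forall n, borel_bisection (A n)) /\ (forall n, borel_bisection (B n)),
    trivIset setT A, trivIset setT B,
    (mu \x nu)%E (@gsrc (G * H)%type @` (D `\` (\bigcup_n A n `*` \bigcup_n B n))) = 0%E &
    (mu \x nu)%E (@gtgt (G * H)%type @` (D `\` (\bigcup_n A n `*` \bigcup_n B n))) = 0%E].
Proof.
move=> bD; have [A [bA tA As At]] := bisection_left_cover pG pH bD.
have [B [bB tB Bs Bt]] := bisection_left_cover pH pG (borel_bisection_swap bD).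
have bA' n : measurable (A n) by case: (bA n).
have bB' n : measurable (B n) by case: (bB n).
have mA : measurable (~` \bigcup_n A n) by apply: measurableC; exact: bigcupT_measurable.
have mB : measurable (~` \bigcup_n B n) by apply: measurableC; exact: bigcupT_measurable.
have DE : D `\` (\bigcup_n A n `*` \bigcup_n B n) =
    (D `&` (~` (\bigcup_n A n) `*` setT)) `|` (D `&` (setT `*` ~` (\bigcup_n B n))).
  rewrite -setIUr setDE; congr (_ `&` _); apply/seteqP; split=> -[g h] /=.
    by move=> /not_andP[]; [left|right].
  by move=> [[gA _]|[_ hB]] [].
have mrest (c : (G * H)%type -> (G * H)%type) (mc : measurable_injection R c D) E :
    measurable E -> measurable (c @` (D `&` E)).
  by move=> mE; exact: (measurable_injection_image mc mE).
exists A, B; split=> //.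
- rewrite DE image_setU; apply/eqP; rewrite measureU0//.
  + by apply/eqP; exact: As.
  + exact: (mrest _ (gsrc_injection dGH bD) _ (measurableX mA measurableT)).
  + exact: (mrest _ (gsrc_injection dGH bD) _ (measurableX measurableT mB)).
  + have mDB := mrest _ (gsrc_injection dGH bD) _ (measurableX measurableT mB).
    apply: (etrans (esym (product_measure_swap mu nu mDB))).
    rewrite -[RHS]Bs; congr (product_measure1 nu mu _).
    apply/seteqP; split=> -[h g].
      by move=> [[g' h'] [Dp [_ hB]] [<- <-]]; exists (h', g').
    by move=> [[h' g'] [Dp [hB _]] [<- <-]]; exists (g', h').
- rewrite DE image_setU; apply/eqP; rewrite measureU0//.
  + by apply/eqP; exact: At.
  + exact: (mrest _ (gtgt_injection dGH bD) _ (measurableX mA measurableT)).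
  + exact: (mrest _ (gtgt_injection dGH bD) _ (measurableX measurableT mB)).
  + have mDB := mrest _ (gtgt_injection dGH bD) _ (measurableX measurableT mB).
    apply: (etrans (esym (product_measure_swap mu nu mDB))).
    rewrite -[RHS]Bt; congr (product_measure1 nu mu _).
    apply/seteqP; split=> -[h g].
      by move=> [[g' h'] [Dp [_ hB]] [<- <-]]; exists (h', g').
    by move=> [[h' g'] [Dp [hB _]] [<- <-]]; exists (g', h').
Qed.

Lemma bisection_rectangle_cover (D : set (G * H)%type) : borel_bisection D ->
  exists (A : nat -> set G) (B : nat -> set H), [/\
    forall n, borel_bisection (A n), forall n, borel_bisection (B n),
    trivIset setT (fun n => A n `*` B n),
    (mu \x nu)%E (@gsrc (G * H)%type @` (D `\` \bigcup_n (A n `*` B n))) = 0%E &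
    (mu \x nu)%E (@gtgt (G * H)%type @` (D `\` \bigcup_n (A n `*` B n))) = 0%E].
Proof.
move=> bD; have [A [B [[bA bB] tA tB Ds Dt]]] := bisection_grid_cover bD.
pose F k := A (Cantor.of_nat k).1 `*` B (Cantor.of_nat k).2.
have tF : trivIset setT F.
  move=> i j _ _ [[g h] [[/= Ai Bi] [/= Aj Bj]]].
  rewrite -(Cantor.cancel_to_of i) -(Cantor.cancel_to_of j).
  congr Cantor.to_nat; rewrite [LHS]surjective_pairing [RHS]surjective_pairing.
  by congr pair; [apply: tA => //; exists g|apply: tB => //; exists h].
have FE : \bigcup_k F k = \bigcup_n A n `*` \bigcup_n B n.
  apply/seteqP; split=> -[g h].
    by move=> [k _ [Ag Bh]]; split; [exists (Cantor.of_nat k).1|exists (Cantor.of_nat k).2].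
  move=> [[n _ An] [m _ Bm]]; exists (Cantor.to_nat (n, m)) => //.
  by rewrite /F Cantor.cancel_of_to.
exists (fun k => A (Cantor.of_nat k).1), (fun k => B (Cantor.of_nat k).2).
by rewrite FE; split.
Qed.

Let imX (c : (G * H)%type -> (G * H)%type) (a : G -> G) (b : H -> H) A A' B B' :
  (forall p, c p = (a p.1, b p.2)) ->
  c @` ((A `*` B) `&` (A' `*` B')) = (a @` (A `&` A')) `*` (b @` (B `&` B')).
Proof.
move=> cE; apply/seteqP; split=> -[x y].
  by move=> [[g h] [[/= Ag Bh] [/= Ag' Bh']]]; rewrite cE => -[<- <-]; split; [exists g|exists h].
by move=> [/= [g [Ag Ag'] <-] [h [Bh Bh'] <-]]; exists (g, h).
Qed.

(** Both sides are finite measures in [E]. On measurable rectangles they agree by invariance in each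
    factor, hence they agree everywhere. *)
Lemma pmp_rectangle (A : set G) (B : set H) (E : set (G * H)%type) :
  borel_bisection A -> borel_bisection B -> measurable E ->
  (mu \x nu)%E (@gsrc (G * H)%type @` ((A `*` B) `&` E)) =
  (mu \x nu)%E (@gtgt (G * H)%type @` ((A `*` B) `&` E)).
Proof.
move=> bA bB mE; have bAB := borel_bisectionX bA bB.
have [_ _ pmpG] := pG; have [_ _ pmpH] := pH.
pose P : probability (G * H)%type R := (mu \x nu)%E.
suff h A' B' : measurable A' -> measurable B' ->
    pullback P (gsrc_injection dGH bAB) (A' `*` B') =
    pullback P (gtgt_injection dGH bAB) (A' `*` B').
  exact: (pair_setT_measurable_eq h mE).
move=> mA' mB'.
have bAA := borel_bisectionI bA mA'; have bBB := borel_bisectionI bB mB'.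
rewrite /= /pullback (imX (a := @gsrc G) (b := @gsrc H))// (imX (a := @gtgt G) (b := @gtgt H))//.
rewrite !product_measure1E.
- by congr (_ * _)%E; [exact: pmpG|exact: pmpH].
- by case: (borel_bisection_gtgt dG bAA).
- by case: (borel_bisection_gtgt dH bBB).
- by case: (borel_bisection_gsrc dG bAA).
- by case: (borel_bisection_gsrc dH bBB).
Qed.

Lemma pmp_groupoid_prod : pmp_groupoid (G := (G * H)%type) (mu \x nu)%E.
Proof.
have [_ uG pmpG] := pG; have [_ uH pmpH] := pH.
split=> //.
  rewrite (_ : @gunits (G * H)%type = @gunits G `*` @gunits H).
    rewrite [LHS]product_measure1E.
    - by rewrite -[RHS]mule1; congr (_ * _)%E; [exact: uG|exact: uH].
    - exact: measurable_gunits dG.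
    - exact: measurable_gunits dH.
  apply/seteqP; split=> -[x y].
    by move=> [[g h] _ [<- <-]]; split; [exists g|exists h].
  by move=> [/= [g _ <-] [h _ <-]]; exists (g, h).
move=> D bD; have [A [B [bA bB tF Ds Dt]]] := bisection_rectangle_cover bD.
pose F k := A k `*` B k.
have mF k : measurable (F k) by apply: measurableX; [case: (bA k)|case: (bB k)].
have mU : measurable (\bigcup_k F k) by exact: bigcupT_measurable.
have key (c : (G * H)%type -> (G * H)%type) (mc : measurable_injection R c D) :
    (mu \x nu)%E (c @` (D `\` \bigcup_k F k)) = 0%E ->
    (mu \x nu)%E (c @` D) = (\sum_(k <oo) (mu \x nu)%E (c @` (F k `&` D)))%E.
  rewrite setDE => D0; 
  pose m : {finite_measure set (G * H)%type -> \bar R} :=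
    pullback ((mu \x nu)%E : probability (G * H)%type R) mc.
  transitivity (m setT); first by rewrite -[in LHS](setIT D).
  rewrite -(setUv (\bigcup_k F k)).
  have -> : m (\bigcup_k F k `|` ~` (\bigcup_k F k)) = m (\bigcup_k F k).
    by apply: measureU0 => //; exact: measurableC.
  rewrite (measure_semi_bigcup m mF tF mU); apply: eq_eseriesr => k _.
  by rewrite setIC.
apply: etrans (key _ (gsrc_injection dGH bD) Ds) _.
apply: etrans _ (esym (key _ (gtgt_injection dGH bD) Dt)).
apply: eq_eseriesr => k _; apply: pmp_rectangle => //.
by case: bD.
Qed.

End product_pmp.

(** * Calculus of bisections *)

Section fine_measure.
Context (R : realType) d (T : measurableType d) (mu : probability T R).
Local Notation m E := (fine (mu E)).
Implicit Types E F : set T.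

Lemma fmeasure_ge0 E : 0 <= m E.
Proof. exact: fine_ge0. Qed.

Lemma fmeasure_le E F : measurable E -> measurable F -> E `<=` F -> m E <= m F.
Proof.
move=> mE mF EF; apply: fine_le; rewrite ?fin_num_measure//.
by apply: le_measure; rewrite ?inE.
Qed.

Lemma fmeasure_le1 E : measurable E -> m E <= 1.
Proof.
move=> mE; rewrite -lee_fin fineK ?fin_num_measure//.
exact: probability_le1.
Qed.

Lemma fmeasureU E F : measurable E -> measurable F -> E `&` F = set0 ->
  m (E `|` F) = m E + m F.
Proof. by move=> mE mF EF; rewrite measureU// fineD// fin_num_measure. Qed.

Lemma fmeasureID E F : measurable E -> measurable F -> m E = m (E `&` F) + m (E `\` F).
Proof.
move=> mE mF; rewrite -fmeasureU; first by rewrite setUIDK.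
- exact: measurableI.
- exact: measurableD.
- by rewrite -subset0 => x [[_ Fx] [_ nFx]].
Qed.

Let union_diff (E F : set T) : E `|` F = E `|` (F `\` E).
Proof.
apply/seteqP; split=> x [Ex|]; try by left.
  by have [?|?] := pselect (E x); [left|right].
by move=> []; right.
Qed.

Lemma fmeasureU_le E F : measurable E -> measurable F -> m (E `|` F) <= m E + m F.
Proof.
move=> mE mF; rewrite union_diff fmeasureU//.
  by rewrite lerD2l; apply: fmeasure_le => //; exact: measurableD.
  exact: measurableD.
by rewrite -subset0 => x [Ex [_ nEx]].
Qed.

Lemma fmeasureUI E F : measurable E -> measurable F ->
  m (E `|` F) = m E + m F - m (E `&` F).
Proof.
move=> mE mF; rewrite union_diff fmeasureU//.
- by rewrite (fmeasureID mF mE) (setIC F); lra.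
- exact: measurableD.
- by rewrite -subset0 => x [Ex [_ nEx]].
Qed.

Lemma fmeasure_subU E F G : measurable E -> measurable F -> measurable G ->
  E `<=` F `|` G -> m E <= m F + m G.
Proof.
move=> mE mF mG s; apply: le_trans (fmeasureU_le mF mG).
by apply: fmeasure_le => //; exact: measurableU.
Qed.

Let bigcup_seq_cons (I : eqType) (i : I) (s : seq I) (F : I -> set T) :
  \bigcup_(j in [set j | j \in i :: s]) F j = F i `|` \bigcup_(j in [set j | j \in s]) F j.
Proof.
apply/seteqP; split=> [x [j /=]|x [Fi|[j /= js Fj]]].
- by rewrite inE => /predU1P[->|js] Fj; [left|right; exists j].
- by exists i => //=; rewrite mem_head.
- by exists j => //=; rewrite inE js orbT.
Qed.

Let bigcup_seq_nil (I : eqType) (F : I -> set T) :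
  \bigcup_(j in [set j | j \in [::]]) F j = set0.
Proof. by rewrite -subset0 => x []. Qed.

Let measurable_bigcup_seq (I : eqType) (s : seq I) (F : I -> set T) :
  (forall i, measurable (F i)) -> measurable (\bigcup_(j in [set j | j \in s]) F j).
Proof.
move=> mF; elim: s => [|i s ih]; first by rewrite bigcup_seq_nil.
by rewrite bigcup_seq_cons; exact: measurableU.
Qed.

Let bigcup_enum (I : finType) (F : I -> set T) :
  \bigcup_i F i = \bigcup_(j in [set j | j \in index_enum I]) F j.
Proof.
by apply/seteqP; split=> x [i _ Fi]; exists i => //=; rewrite mem_index_enum.
Qed.

Lemma measurable_finite_bigcup (I : finType) (F : I -> set T) :
  (forall i, measurable (F i)) -> measurable (\bigcup_i F i).
Proof. by move=> mF; rewrite bigcup_enum; exact: measurable_bigcup_seq. Qed.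

Lemma fmeasure_bigcup (I : finType) (F : I -> set T) :
  (forall i, measurable (F i)) -> trivIset setT F ->
  m (\bigcup_i F i) = \sum_i m (F i).
Proof.
move=> mF tF; rewrite bigcup_enum.
elim: (index_enum I) (index_enum_uniq I) => [_|i s ih /andP[/negP nis us]].
  by rewrite bigcup_seq_nil big_nil measure0.
rewrite bigcup_seq_cons big_cons fmeasureU ?ih//; first exact: measurable_bigcup_seq.
rewrite -subset0 => x [Fi [j /= js Fj]]; apply: nis.
by rewrite (tF i j) //; exists x.
Qed.

Lemma fmeasure_bigcup_le (I : finType) (F : I -> set T) :
  (forall i, measurable (F i)) -> m (\bigcup_i F i) <= \sum_i m (F i).
Proof.
move=> mF; rewrite bigcup_enum.
elim: (index_enum I) => [|i s ih].
  by rewrite bigcup_seq_nil big_nil measure0.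
rewrite bigcup_seq_cons big_cons.
apply: le_trans (fmeasureU_le (mF i) (measurable_bigcup_seq s mF)) _.
by rewrite lerD2l.
Qed.

End fine_measure.

Section bisection_calculus.
Context (R : realType) d (G : mgroupoidType d) (mu : probability G R).
Hypothesis pG : pmp_groupoid mu.
Implicit Types A B C D : set G.

Local Notation m E := (fine (mu E)).
Local Notation s := (@gsrc G).
Local Notation t := (@gtgt G).
Local Notation bis := (@borel_bisection d G).

Let dG : Defs.discrete_measurable R G. Proof. by case: pG. Qed.

Definition src_mass A : R := m (s @` A).
Definition src_meet A B : R := m (s @` A `&` s @` B).
Definition tgt_meet A B : R := m (t @` A `&` t @` B).
Definition arrow_meet A B : R := m (s @` (A `&` B)).
Definition bis_dist A B : R := m (s @` (A `+` B)).

Lemma bis_measurable A : bis A -> measurable A.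
Proof. by case. Qed.

Lemma measurable_src A : bis A -> measurable (s @` A).
Proof. by move=> [mA sA _]; exact: (measurable_gsrc_image dG). Qed.

Lemma measurable_tgt A : bis A -> measurable (t @` A).
Proof. by move=> [mA _ tA]; exact: (measurable_gtgt_image dG). Qed.

Lemma pmp_fine A : bis A -> m (t @` A) = m (s @` A).
Proof. by move=> bA; have [_ _ /(_ _ bA) ->] := pG. Qed.

Lemma bisD A B : bis A -> measurable B -> bis (A `\` B).
Proof.
move=> bA mB; apply: (borel_bisectionS bA); first by apply: measurableD => //; exact: bis_measurable.
by move=> x [].
Qed.

Lemma bis0 : bis set0.
Proof. by split=> // x y /set_mem. Qed.

Lemma tgt_preimage A X : measurable X -> bis A -> bis (A `&` t @^-1` X).
Proof.
move=> mX bA; apply: (borel_bisectionI bA).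
by have := measurable_gtgt dG measurableT mX; rewrite setTI.
Qed.

Lemma image_setY (f : G -> G) A B : f @` (A `+` B) = f @` (A `\` B) `|` f @` (B `\` A).
Proof. by rewrite setY_def image_setU. Qed.

Lemma measurable_src_setY A B : bis A -> bis B -> measurable (s @` (A `+` B)).
Proof.
move=> bA bB; rewrite image_setY; apply: measurableU; apply: measurable_src; apply: bisD => //; exact: bis_measurable.
Qed.

Lemma bis_dist_ge0 A B : 0 <= bis_dist A B.
Proof. exact: fmeasure_ge0. Qed.

Lemma bis_dist_le1 A B : bis A -> bis B -> bis_dist A B <= 1.
Proof. by move=> bA bB; apply: fmeasure_le1; exact: measurable_src_setY. Qed.

Lemma bis_distxx A : bis_dist A A = 0.
Proof. by rewrite /bis_dist setYK image_set0 measure0. Qed.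

Lemma bis_distC A B : bis_dist A B = bis_dist B A.
Proof. by rewrite /bis_dist setYC. Qed.

Lemma bis_dist_triangle B A C : bis A -> bis B -> bis C ->
  bis_dist A C <= bis_dist A B + bis_dist B C.
Proof.
move=> bA bB bC; apply: fmeasure_subU; try exact: measurable_src_setY.
move=> _ [g h <-]; have [Bg|nBg] := pselect (B g); last first.
  case: h => -[h1 h2]; [left|right]; exists g => //; [by left|by right].
case: h => -[h1 h2]; [right|left]; exists g => //; [by left|by right].
Qed.

Lemma src_massE A : src_mass A = bis_dist A set0.
Proof. by rewrite /src_mass /bis_dist setY0. Qed.

Lemma src_mass_ge0 A : 0 <= src_mass A.
Proof. exact: fmeasure_ge0. Qed.

Lemma src_mass_dist A B : bis A -> bis B -> `|src_mass A - src_mass B| <= bis_dist A B.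
Proof.
move=> bA bB; rewrite !src_massE.
have := bis_dist_triangle bA bB bis0; have := bis_dist_triangle bB bA bis0.
by rewrite (bis_distC B A) ler_norml => h1 h2; apply/andP; split; lra.
Qed.

(** The union of the two sources is the disjoint union of the sources of [A + B] (symmetric
    difference) and of the arrows in common. This identity converts between the distance and the
    masses that behave well under products. *)
Lemma bis_distE A B : bis A -> bis B ->
  bis_dist A B = src_mass A + src_mass B - src_meet A B - arrow_meet A B.
Proof.
move=> bA bB; have mA := measurable_src bA; have mB := measurable_src bB.
have := fmeasureUI mu mA mB.
rewrite (_ : _ `|` _ = s @` (A `+` B) `|` s @` (A `&` B)).
  rewrite fmeasureU.
  - by rewrite /bis_dist /src_mass /src_meet /arrow_meet => h; lra.
  - exact: measurable_src_setY.
  - by apply: measurable_src; apply: borel_bisectionI => //; exact: bis_measurable.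
  - have [_ sA _] := bA; have [_ sB _] := bB.
    rewrite -subset0 => _ [[g h <-] [k [Ak Bk] kg]].
    case: h => -[h1 h2].
      by apply: h2; rewrite (_ : g = k)//; apply: sA; rewrite ?inE.
    by apply: h2; rewrite (_ : g = k)//; apply: sB; rewrite ?inE.
rewrite -!image_setU; congr (_ @` _); apply/seteqP; split=> g.
  move=> gAB; have [[Ag Bg]|n] := pselect (A g /\ B g); first by right.
  left; case: gAB => h; [left|right]; split=> // h'; exact: n.
by move=> [[[Ag _]|[Bg _]]|[Ag _]]; [left|right|left].
Qed.

Lemma bis_dist_sub A B : B `<=` A -> bis_dist A B = src_mass (A `\` B).
Proof.
move=> BA; rewrite /bis_dist /src_mass; congr (fine (mu (_ @` _))).
by apply/seteqP; split=> g; [move=> [//|[/BA]]|left].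
Qed.

Lemma src_mass_mono A B : bis A -> bis B -> A `<=` B -> src_mass A <= src_mass B.
Proof.
by move=> bA bB AB; apply: fmeasure_le; [exact: measurable_src|exact: measurable_src|exact: image_subset].
Qed.

Let diff_le X X' Y : measurable X -> measurable X' -> measurable Y ->
  m (X `&` Y) - m (X' `&` Y) <= m (X `\` X').
Proof.
move=> mX mX' mY; rewrite lerBlDr; apply: fmeasure_subU.
- exact: measurableI.
- exact: measurableD.
- exact: measurableI.
- by move=> x [Xx Yx]; have [X'x|nX'] := pselect (X' x); [right|left].
Qed.

Let src_diff A A' : bis A -> bis A' -> m (s @` A `\` s @` A') <= bis_dist A A'.
Proof.
move=> bA bA'; apply: fmeasure_le.
- by apply: measurableD; exact: measurable_src.
- exact: measurable_src_setY.
- move=> _ [[g Ag <-] n]; exists g => //; left; split=> // A'g; apply: n; by exists g.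
Qed.

Let tgt_diff A A' : bis A -> bis A' -> m (t @` A `\` t @` A') <= bis_dist A A'.
Proof.
move=> bA bA'.
have bD : bis (A `\` A') by apply: bisD => //; exact: bis_measurable.
apply: (@le_trans _ _ (m (t @` (A `\` A')))).
  apply: fmeasure_le.
  - by apply: measurableD; exact: measurable_tgt.
  - exact: measurable_tgt.
  - move=> _ [[g Ag <-] n]; exists g => //; split=> // A'g; apply: n; by exists g.
rewrite pmp_fine//; apply: fmeasure_le; first exact: measurable_src.
  exact: measurable_src_setY.
by rewrite image_setY; left.
Qed.

Lemma src_meetC A B : src_meet A B = src_meet B A.
Proof. by rewrite /src_meet setIC. Qed.

Lemma tgt_meetC A B : tgt_meet A B = tgt_meet B A.
Proof. by rewrite /tgt_meet setIC. Qed.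

Lemma src_meet_dist A A' B B' : bis A -> bis A' -> bis B -> bis B' ->
  `|src_meet A B - src_meet A' B'| <= bis_dist A A' + bis_dist B B'.
Proof.
move=> bA bA' bB bB'.
have h X X' Y : bis X -> bis X' -> bis Y -> src_meet X Y - src_meet X' Y <= bis_dist X X'.
  move=> bX bX' bY; apply: le_trans (src_diff bX bX').
  by apply: diff_le; exact: measurable_src.
have := h _ _ _ bA bA' bB; have := h _ _ _ bA' bA bB.
have := h _ _ _ bB bB' bA'; have := h _ _ _ bB' bB bA'.
rewrite (bis_distC A') (bis_distC B') (src_meetC A' B') (src_meetC A' B).
by move=> h1 h2 h3 h4; rewrite ler_norml; apply/andP; split; lra.
Qed.

Lemma tgt_meet_dist A A' B B' : bis A -> bis A' -> bis B -> bis B' ->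
  `|tgt_meet A B - tgt_meet A' B'| <= bis_dist A A' + bis_dist B B'.
Proof.
move=> bA bA' bB bB'.
have h X X' Y : bis X -> bis X' -> bis Y -> tgt_meet X Y - tgt_meet X' Y <= bis_dist X X'.
  move=> bX bX' bY; apply: le_trans (tgt_diff bX bX').
  by apply: diff_le; exact: measurable_tgt.
have := h _ _ _ bA bA' bB; have := h _ _ _ bA' bA bB.
have := h _ _ _ bB bB' bA'; have := h _ _ _ bB' bB bA'.
rewrite (bis_distC A') (bis_distC B') (tgt_meetC A' B') (tgt_meetC A' B).
by move=> h1 h2 h3 h4; rewrite ler_norml; apply/andP; split; lra.
Qed.

Lemma bis_dist_mull A B C : bis A -> bis B -> bis C ->
  bis_dist (bisection_mul C A) (bisection_mul C B) <= bis_dist A B.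
Proof.
move=> bA bB bC; apply: fmeasure_le; try exact: measurable_src_setY.
  by apply: measurable_src_setY; exact: (borel_bisection_mul dG).
have h X Y : s @` (bisection_mul C X `\` bisection_mul C Y) `<=` s @` (X `\` Y).
  move=> _ [_ [[c [x [Cc Xx cx ->]]] n] <-]; rewrite gsrc_mul//; exists x => //.
  by split=> // Yx; apply: n; exists c, x.
by rewrite !image_setY => x [/h|/h]; [left|right].
Qed.

(** The source of a product [ac] is that of [c], whereas the error is known at the source of [a],
    which is the range of [c]. Invariance under the part of [C] that ends in the error set compares
    the two. With multiplication on the left the sources stay in place. *)
Lemma bis_dist_mulr A B C : bis A -> bis B -> bis C ->
  bis_dist (bisection_mul A C) (bisection_mul B C) <= bis_dist A B.
Proof.
move=> bA bB bC.
have mX := measurable_src_setY bA bB; have bX := tgt_preimage mX bC.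
apply: (@le_trans _ _ (m (s @` (C `&` t @^-1` (s @` (A `+` B)))))).
  apply: fmeasure_le; first by apply: measurable_src_setY; exact: (borel_bisection_mul dG).
    exact: measurable_src.
  rewrite image_setY => y [] [_ [[c [x [Ac Cx cx ->]]] n] <-]; rewrite gsrc_mul//; exists x => //.
    split=> //=; rewrite -cx; exists c => //; left; split=> // Bc; apply: n; by exists c, x.
  split=> //=; rewrite -cx; exists c => //; right; split=> // Bc; apply: n; by exists c, x.
rewrite -pmp_fine//; apply: fmeasure_le => //; first exact: measurable_tgt.
by move=> _ [g [_ /= h] <-].
Qed.

Lemma bis_dist_mul A B C D : bis A -> bis B -> bis C -> bis D ->
  bis_dist (bisection_mul A C) (bisection_mul B D) <= bis_dist A B + bis_dist C D.
Proof.
move=> bA bB bC bD.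
apply: le_trans (bis_dist_triangle _ (borel_bisection_mul dG bB bC) _) _; try exact: (borel_bisection_mul dG).
by apply: lerD; [exact: bis_dist_mulr|exact: bis_dist_mull].
Qed.

End bisection_calculus.

(** * Ultraproducts and asymptotic homomorphisms *)

(** Compactness of the unit interval gives a cluster point, and for an ultrafilter a cluster point
    is a limit. *)
Lemma cvg_ultra_unit (R : realType) (U : set_system nat) (u : nat -> R) :
  UltraFilter U -> (forall k, 0 <= u k <= 1) -> cvg (u @ U).
Proof.
move=> UU u01.
have cpt : compact `[0:R, 1] by exact: segment_compact.
have [|p [_ clp]] := cpt (u @ U) _.
  by apply: (@filterE _ U) => k /=; rewrite in_itv /=; exact: u01.
apply/cvg_ex; exists p; apply/cvgrPdist_lt => e e0.
have [//|nU] := in_ultra_setVsetC [set k | `|p - u k| < e] UU.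
have := clp (u @` ~` [set k | `|p - u k| < e]) (ball p e).
case.
- by apply: (@filterS _ U _ _ _ _ nU) => k h; exists k.
- exact: nbhsx_ballx.
- by move=> _ [[k h <-]]; rewrite /ball /= => h'; case: (h h').
Qed.

Section null_sequences.
Context (R : realType) (U : set_system nat) {FU : ProperFilter U}.
Implicit Types u v w : nat -> R.

Lemma cvg0_le u v : (forall k, 0 <= u k <= v k) -> v @ U --> (0 : R) -> u @ U --> (0 : R).
Proof.
move=> uv v0; apply: (@squeeze_cvgr _ U _ R (fun=> 0) v u _ 0) => //.
  exact: nearW.
exact: (@cvg_cst R 0 nat U _).
Qed.

Lemma cvg0D u v : u @ U --> (0 : R) -> v @ U --> (0 : R) ->
  (fun k => u k + v k) @ U --> (0 : R).
Proof. by move=> u0 v0; rewrite -[X in _ --> X]addr0; exact: cvgD. Qed.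

Lemma cvg0Z (c : R) u : u @ U --> (0 : R) -> (fun k => c * u k) @ U --> (0 : R).
Proof. by move=> u0; rewrite -[X in _ --> X](mulr0 c); apply: cvgMr. Qed.

Lemma cvg0_sum (I : Type) (s : seq I) (P : pred I) (u : I -> nat -> R) :
  (forall i, P i -> u i @ U --> (0 : R)) ->
  (fun k => \sum_(i <- s | P i) u i k) @ U --> (0 : R).
Proof.
move=> u0; elim: s => [|i s ih].
  rewrite (_ : (fun k => _) = fun=> 0); first exact: (@cvg_cst R 0 nat U _).
  by apply/funext => k; rewrite big_nil.
case Pi: (P i).
  rewrite (_ : (fun k => _) = fun k => u i k + \sum_(j <- s | P j) u j k).
    by apply: cvg0D => //; exact: u0.
  by apply/funext => k; rewrite big_cons Pi.
rewrite (_ : (fun k => _) = fun k => \sum_(j <- s | P j) u j k)//.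
by apply/funext => k; rewrite big_cons Pi.
Qed.

Lemma cvg_dist0 u v (l : R) w : (forall k, `|u k - v k| <= w k) -> w @ U --> (0 : R) ->
  v @ U --> l -> u @ U --> l.
Proof.
move=> uvw w0 vl.
have d0 : (fun k => u k - v k) @ U --> (0 : R).
  apply: norm_cvg0; apply: (cvg0_le _ w0) => k.
  by rewrite normr_ge0 uvw.
have : (fun k => u k - v k + v k) @ U --> 0 + l by exact: cvgD.
rewrite add0r (_ : (fun k => _) = u)//.
by apply/funext => k; rewrite subrK.
Qed.

End null_sequences.

Section pseudometric_semigroup.
Context (R : realType).

(** Distances in the unit interval guarantee that ultralimits exist; the last clause lets the
    product descend to classes. *)
Definition is_pseudometric (M : metricSemigroup R) :=
  [/\ forall x y : M, ms_dom x -> ms_dom y -> ms_dom (ms_mul x y),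
      forall x y : M, ms_dom x -> ms_dom y -> 0 <= ms_dist x y <= 1,
      (forall x : M, ms_dom x -> ms_dist x x = 0) /\
        (forall x y : M, ms_dom x -> ms_dom y -> ms_dist x y = ms_dist y x),
      forall y x z : M, ms_dom x -> ms_dom y -> ms_dom z ->
        ms_dist x z <= ms_dist x y + ms_dist y z &
      forall x y x' y' : M, ms_dom x -> ms_dom y -> ms_dom x' -> ms_dom y' ->
        ms_dist (ms_mul x x') (ms_mul y y') <= ms_dist x y + ms_dist x' y'].

Section quotient.
Variable M : metricSemigroup R.
Hypothesis hM : is_pseudometric M.
Implicit Types x y z : M.

Local Notation cl x := (metric_class x : metric_quotient M).

Lemma class_repr x : ms_dom x ->
  ms_dom (get (metric_class x)) /\ ms_dist x (get (metric_class x)) = 0.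
Proof.
move=> dx; have [_ _ [dxx _] _ _] := hM.
by apply: (@getPex _ (metric_class x)); exists x; split=> //; exact: dxx.
Qed.

Lemma dist0_eq x x' y y' : ms_dom x -> ms_dom x' -> ms_dom y -> ms_dom y' ->
  ms_dist x x' = 0 -> ms_dist y y' = 0 -> ms_dist x y = ms_dist x' y'.
Proof.
move=> dx dx' dy dy' xx yy; have [_ _ [_ sy] tri _] := hM.
apply/eqP; rewrite eq_le; apply/andP; split.
  have := tri x' x y dx dx' dy; have := tri y' x' y dx' dy' dy.
  by rewrite xx (sy y' y)// yy => h1 h2; lra.
have := tri x x' y' dx' dx dy'; have := tri y x y' dx dy dy'.
by rewrite (sy x' x)// xx yy => h1 h2; lra.
Qed.

Lemma class_dist x y : ms_dom x -> ms_dom y -> ms_dist (cl x) (cl y) = ms_dist x y.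
Proof.
move=> dx dy; have [dx' xx] := class_repr dx; have [dy' yy] := class_repr dy.
exact/esym/dist0_eq.
Qed.

Lemma class_eq x y : ms_dom x -> ms_dom y -> ms_dist x y = 0 -> cl x = cl y.
Proof.
move=> dx dy xy; have [_ _ [dxx sy] _ _] := hM.
apply/seteqP; split=> z [dz h]; split=> //.
  by rewrite -h; apply/esym; apply: dist0_eq => //; exact: dxx.
by rewrite -h; apply: dist0_eq => //; exact: dxx.
Qed.

Lemma class_mul x y : ms_dom x -> ms_dom y -> ms_mul (cl x) (cl y) = cl (ms_mul x y).
Proof.
move=> dx dy; have [dx' xx] := class_repr dx; have [dy' yy] := class_repr dy.
have [cm ge0 [_ sy] _ lip] := hM.
apply: class_eq; try exact: cm.
have := lip _ _ _ _ dx' dx dy' dy; rewrite (sy _ x)// (sy _ y)// xx yy addr0 => h.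
apply/eqP; rewrite eq_le h /=.
by have /andP[] := ge0 _ _ (cm _ _ dx' dy') (cm _ _ dx dy).
Qed.

Lemma class_dom x : ms_dom x -> ms_dom (cl x).
Proof. by exists x. Qed.

Lemma pseudometric_quotient : is_pseudometric (metric_quotient M).
Proof.
have [cm ge0 [dxx sy] tri lip] := hM.
split.
- by move=> _ _ [x dx <-] [y dy <-]; rewrite class_mul//; apply: class_dom; exact: cm.
- by move=> _ _ [x dx <-] [y dy <-]; rewrite class_dist//; exact: ge0.
- split; first by move=> _ [x dx <-]; rewrite class_dist//; exact: dxx.
  by move=> _ _ [x dx <-] [y dy <-]; rewrite !class_dist//; exact: sy.
- by move=> _ _ _ [y dy <-] [x dx <-] [z dz <-]; rewrite !class_dist//; exact: tri.
- move=> _ _ _ _ [x dx <-] [y dy <-] [x' dx' <-] [y' dy' <-].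
  by rewrite !class_mul// !class_dist//; [exact: lip|exact: cm|exact: cm].
Qed.

Lemma class_get (C : metric_quotient M) : ms_dom C ->
  ms_dom (get (C : set M)) /\ C = cl (get (C : set M)).
Proof.
move=> [x dx <-]; have [dx' xx] := class_repr dx.
by split=> //; exact: class_eq.
Qed.

End quotient.

(** The semigroup whose metric quotient is [ultraproduct]; naming it makes the general facts on
    quotients applicable. *)
Definition sequence_semigroup (U : set_system nat) (M : nat -> metricSemigroup R) :
    metricSemigroup R :=
  @MetricSemigroup R (forall k, M k)
    [set x | forall k, ms_dom (x k)]
    (fun x y k => ms_mul (x k) (y k))
    (fun x y => lim ((fun k => ms_dist (x k) (y k)) @ U)).

Section sequences.
Variables (U : set_system nat) (M : nat -> metricSemigroup R).
Hypotheses (UU : UltraFilter U) (hM : forall k, is_pseudometric (M k)).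

Lemma cvg_sequence_dist (x y : sequence_semigroup U M) : ms_dom x -> ms_dom y ->
  (fun k => ms_dist (x k) (y k)) @ U --> ms_dist x y.
Proof.
move=> dx dy; apply: cvg_ultra_unit => k.
by have [_ ge0 _ _ _] := hM k; exact: ge0 (dx k) (dy k).
Qed.

Lemma pseudometric_sequence : is_pseudometric (sequence_semigroup U M).
Proof.
have cm (x y : sequence_semigroup U M) : ms_dom x -> ms_dom y -> ms_dom (ms_mul x y).
  by move=> dx dy k; have [h _ _ _ _] := hM k; apply: h; [exact: dx|exact: dy].
split => //.
- move=> x y dx dy; have c := cvg_sequence_dist dx dy.
  have b k : 0 <= ms_dist (x k) (y k) <= 1.
    by have [_ h _ _ _] := hM k; apply: h; [exact: dx|exact: dy].
  apply/andP; split.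
    by apply: (ler_cvg_to (cvg_cst 0) c); apply: nearW => k; case/andP: (b k).
  by apply: (ler_cvg_to c (@cvg_cst R 1 nat U _)); apply: nearW => k; case/andP: (b k).
- split.
    move=> x dx; apply: (cvg_unique _ (cvg_sequence_dist dx dx)) => //.
    rewrite (_ : (fun k => _) = cst 0); first exact: cvg_cst.
    by apply/funext => k; have [_ _ [h _] _ _] := hM k; exact: h (dx k).
  move=> x y dx dy; congr (lim (_ @ U)); apply/funext => k.
  by have [_ _ [_ h] _ _] := hM k; exact: h (dx k) (dy k).
- move=> y x z dx dy dz.
  apply: (ler_cvg_to (cvg_sequence_dist dx dz)
    (cvgD (cvg_sequence_dist dx dy) (cvg_sequence_dist dy dz))).
  by apply: nearW => k; have [_ _ _ h _] := hM k; apply: h.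
- move=> x y x' y' dx dy dx' dy'.
  apply: (ler_cvg_to (cvg_sequence_dist (cm _ _ dx dx') (cm _ _ dy dy'))
    (cvgD (cvg_sequence_dist dx dy) (cvg_sequence_dist dx' dy'))).
  by apply: nearW => k; have [_ _ _ _ h] := hM k; apply: h.
Qed.

End sequences.

Lemma pseudometric_borel_full_semigroup d (G : mgroupoidType d) (mu : probability G R) :
  pmp_groupoid mu -> is_pseudometric (borel_full_semigroup mu).
Proof.
move=> pG; have [dG _ _] := pG; split => /=.
- by move=> A B; exact: (borel_bisection_mul dG).
- by move=> A B bA bB; rewrite fmeasure_ge0; exact: (bis_dist_le1 pG).
- by split=> [A _|A B _ _]; [exact: bis_distxx|exact: bis_distC].
- by move=> B A C bA bB bC; exact: (bis_dist_triangle pG).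
- by move=> A B C D bA bB bC bD; exact: (bis_dist_mul pG).
Qed.

End pseudometric_semigroup.

Section approximation.
Context (R : realType) (U : set_system nat) d (G : mgroupoidType d) (mu : probability G R).
Variables (e : nat -> measure_display) (K : forall k, mgroupoidType (e k))
  (nu : forall k, probability (K k) R).

(** An asymptotic homomorphism on representatives. The domain [D] is a parameter since such maps are
    first built on a dense subsemigroup. *)
Definition sofic_approximation (D : set (set G)) (theta : set G -> forall k, set (K k)) :=
  [/\ forall A, D A -> forall k, borel_bisection (theta A k),
      forall A B, D A -> D B ->
        (fun k => bis_dist (nu k) (theta A k) (theta B k)) @ U --> bis_dist mu A B &
      forall A B, D A -> D B ->
        (fun k => bis_dist (nu k) (theta (bisection_mul A B) k)
           (bisection_mul (theta A k) (theta B k))) @ U --> (0 : R)].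

Hypotheses (UU : UltraFilter U) (pG : pmp_groupoid mu) (pK : forall k, pmp_groupoid (nu k)).

(** Forward, a class of the ultraproduct is unfolded by choosing a sequence of classes and then a
    bisection in each. Backward, [th] is applied to a representative of each class; asymptotic
    isometry makes the choice harmless. *)
Lemma sofic_approximationP :
  (exists f : full_semigroup mu -> ultraproduct U (fun k => full_semigroup (nu k)),
     isometric_embedding f) <->
  (exists theta, sofic_approximation (@borel_bisection d G) theta).
Proof.
have hG := pseudometric_borel_full_semigroup pG.
have hK k := pseudometric_borel_full_semigroup (pK k).
pose Q k := full_semigroup (nu k).
have hQ k : is_pseudometric (Q k) := pseudometric_quotient (hK k).
have hS : is_pseudometric (sequence_semigroup U Q) := pseudometric_sequence UU hQ.
have [cG _ _ _ _] := hG.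
pose kl k (A : set (K k)) : Q k := @metric_class R (borel_full_semigroup (nu k)) A.
have kdist k A B : borel_bisection A -> borel_bisection B ->
    ms_dist (kl k A) (kl k B) = bis_dist (nu k) A B.
  by move=> bA bB; exact: (class_dist (hK k)).
have kmul k A B : borel_bisection A -> borel_bisection B ->
    ms_mul (kl k A) (kl k B) = kl k (bisection_mul A B).
  by move=> bA bB; exact: (class_mul (hK k)).
split.
- move=> [f [fdom fdist fmul]].
  pose c (A : set G) : full_semigroup mu := @metric_class R (borel_full_semigroup mu) A.
  pose z A : sequence_semigroup U Q := get (f (c A) : set (sequence_semigroup U Q)).
  have cdom A : borel_bisection A -> ms_dom (c A) by exists A.
  have zP A : borel_bisection A -> ms_dom (z A) /\ f (c A) = metric_class (z A).
    by move=> bA; apply: (class_get hS); exact/fdom/cdom.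
  pose th A k : set (K k) := get (z A k : set (borel_full_semigroup (nu k))).
  have thP A k : borel_bisection A -> borel_bisection (th A k) /\ z A k = kl k (th A k).
    by move=> bA; apply: (class_get (hK k)); case: (zP A bA) => /(_ k).
  exists th; split.
  + by move=> A bA k; case: (thP A k bA).
  + move=> A B bA bB; have [dzA fA] := zP A bA; have [dzB fB] := zP B bB.
    have := cvg_sequence_dist UU hQ dzA dzB.
    rewrite -(class_dist hS)// -fA -fB.
    have -> : ms_dist (f (c A)) (f (c B)) = bis_dist mu A B.
      by rewrite fdist; [exact: (class_dist hG)|exact: cdom|exact: cdom].
    apply: cvg_trans; apply: near_eq_cvg; apply: nearW => k.
    have [bth ->] := thP A k bA; have [bth' ->] := thP B k bB.
    by rewrite kdist.
  + move=> A B bA bB; have [dzA fA] := zP A bA; have [dzB fB] := zP B bB.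
    have bAB : borel_bisection (bisection_mul A B) by exact: cG.
    have [dzAB fAB] := zP _ bAB.
    have [cS _ [dxx _] _ _] := hS.
    have dm : ms_dom (ms_mul (z A) (z B)) by exact: cS.
    have d0 : ms_dist (z (bisection_mul A B)) (ms_mul (z A) (z B)) = 0.
      rewrite -(class_dist hS)// -(class_mul hS)// -fA -fB -fAB -fmul; try exact: cdom.
      rewrite (class_mul hG)//.
      rewrite fAB (class_dist hS)//; exact: dxx.
    have := cvg_sequence_dist UU hQ dzAB dm; rewrite d0.
    apply: cvg_trans; apply: near_eq_cvg; apply: nearW => k.
    change (ms_dist (z (bisection_mul A B) k) (ms_mul (z A k) (z B k)) =
      bis_dist (nu k) (th (bisection_mul A B) k) (bisection_mul (th A k) (th B k))).
    have [bth ->] := thP A k bA; have [bth' ->] := thP B k bB; have [bth'' ->] := thP _ k bAB.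
    by rewrite kmul// kdist//; have [cK _ _ _ _] := hK k; exact: cK.
- move=> [th [thb thd thm]].
  pose x (C : full_semigroup mu) : sequence_semigroup U Q :=
    fun k => kl k (th (get (C : set (borel_full_semigroup mu))) k).
  have gP (C : full_semigroup mu) : ms_dom C ->
      borel_bisection (get (C : set (borel_full_semigroup mu)) : set G).
    by move=> /(class_get hG)[].
  have xdom C : ms_dom C -> ms_dom (x C).
    by move=> /gP bC k; exists (th (get (C : set (borel_full_semigroup mu))) k) => //; exact: thb.
  have xdist C C' : ms_dom C -> ms_dom C' -> ms_dist (x C) (x C') =
      bis_dist mu (get (C : set (borel_full_semigroup mu))) (get (C' : set (borel_full_semigroup mu))).
    move=> dC dC'; have bC := gP _ dC; have bC' := gP _ dC'.
    apply: (cvg_unique _ (cvg_sequence_dist UU hQ (xdom _ dC) (xdom _ dC'))) => //.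
    have := thd _ _ bC bC'; apply: cvg_trans; apply: near_eq_cvg; apply: nearW => k.
    by rewrite kdist//; exact: thb.
  exists (fun C => @metric_class R (sequence_semigroup U Q) (x C)); split.
  + by move=> C dC; exists (x C) => //; exact: xdom.
  + by move=> C C' dC dC'; rewrite (class_dist hS) ?xdist//; exact: xdom.
  + move=> C C' dC dC'.
    rewrite (class_mul hS); [|exact: xdom|exact: xdom].
    have [cQ _ _ _ _] := pseudometric_quotient hG.
    have dCC : ms_dom (ms_mul C C') by exact: cQ.
    have [cS _ _ _ _] := hS.
    apply: (class_eq hS); [exact: xdom|by apply: cS; exact: xdom|].
    have bC := gP _ dC; have bC' := gP _ dC'; have bCC := gP _ dCC.
    have bm : borel_bisection (bisection_mul
       (get (C : set (borel_full_semigroup mu)) : set G)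
       (get (C' : set (borel_full_semigroup mu)) : set G)) by exact: cG.
    (* The representative of the product class need not be the product of the representatives, but
       it is at distance 0 from it, which [th] preserves asymptotically. *)
    have d0 : bis_dist mu (get (ms_mul C C' : set (borel_full_semigroup mu)) : set G)
      (bisection_mul (get (C : set (borel_full_semigroup mu)) : set G)
       (get (C' : set (borel_full_semigroup mu)) : set G)) = 0.
      have [_ h] := class_repr hG (bm : ms_dom (_ : borel_full_semigroup mu)).
      by rewrite bis_distC; exact: h.
    suff c : (fun k => ms_dist (x (ms_mul C C') k) (ms_mul (x C k) (x C' k))) @ U --> (0 : R).
      exact: (cvg_unique _ (cvg_sequence_dist UU hQ (xdom _ dCC) (cS _ _ (xdom _ dC) (xdom _ dC'))) c).
    have c1 := thd _ _ bCC bm; have c2 := thm _ _ bC bC'.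
    rewrite d0 in c1.
    apply: (cvg0_le _ (cvg0D c1 c2)) => k.
    have [cK ge0 _ triK _] := hK k.
    rewrite /x kmul; [|exact: thb|exact: thb].
    rewrite kdist; [|exact: thb|by apply: cK; exact: thb].
    rewrite bis_dist_ge0 /=; apply: (bis_dist_triangle (pK k)); try exact: thb.
    by apply: cK; exact: thb.
Qed.

End approximation.

Lemma free_ultrafilter_geq (U : set_system nat) n : free_ultrafilter U ->
  U [set k | (n <= k)%N].
Proof.
move=> [UU fU]; elim: n => [|n ih].
  by apply: (@filterS _ U _ setT) => //; exact: filterT.
have [//|nU] := in_ultra_setVsetC [set n] UU; first by have := fU n.
apply: (@filterS _ U _ _ _ _ (filterI ih nU)) => k /= [nk kn].
by rewrite ltn_neqAle nk andbT; apply/negP => /eqP kk; apply: kn.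
Qed.

Lemma filter_lt (U : set_system nat) (FU : Filter U) (P : nat -> set nat) m :
  (forall i, U (P i)) -> U [set k | forall i, (i <= m)%N -> P i k].
Proof.
move=> UP; elim: m => [|m ih].
  by apply: (@filterS _ U _ _ _ _ (UP 0%N)) => k /= Pk i; rewrite leqn0 => /eqP ->.
apply: (@filterS _ U _ _ _ _ (filterI ih (UP m.+1))) => k /= [h Pk] i.
by rewrite leq_eqVlt => /predU1P[->//|]; exact: h.
Qed.

(** * Extending asymptotic homomorphisms from a dense subsemigroup *)

Section extension.
Context (R : realType) (U : set_system nat) d (G : mgroupoidType d) (mu : probability G R).
Variables (e : nat -> measure_display) (K : forall k, mgroupoidType (e k))
  (nu : forall k, probability (K k) R).
Hypotheses (freeU : free_ultrafilter U) (pG : pmp_groupoid mu)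
  (pK : forall k, pmp_groupoid (nu k)).

Local Notation bis := (@borel_bisection _ _).
Local Notation r j := (inv_succ R j).

Let UU : UltraFilter U. Proof. by case: freeU. Qed.
#[local] Existing Instance UU.
Let dG : Defs.discrete_measurable R G. Proof. by case: pG. Qed.
Let dK k : Defs.discrete_measurable R (K k). Proof. by case: (pK k). Qed.

Let r_le i j : (i <= j)%N -> r j <= r i.
Proof. by move=> ij; rewrite /inv_succ lef_pV2 ?posrE// ler_nat ltnS. Qed.

Let cvg_ult (u : nat -> R) (l c : R) : u @ U --> l -> l < c -> U [set k | u k < c].
Proof. by move=> ul lc; exact: (cvgr_lt l ul _ lc). Qed.

(* Completeness of the ultraproduct, in terms of representatives. *)
Lemma ultraproduct_complete (x : nat -> forall k, set (K k)) (l : nat -> nat -> R) :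
  (forall n k, bis (x n k)) ->
  (forall i j, (fun k => bis_dist (nu k) (x i k) (x j k)) @ U --> l i j) ->
  (forall i j, l i j <= r i + r j) ->
  exists y : forall k, set (K k), (forall k, bis (y k)) /\
    forall n, U [set k | bis_dist (nu k) (y k) (x n k) < 3 * r n].
Proof.
move=> bx xl lr.
(* [l j i] is at most [r j + r i], hence at most [2 * r i] for [i <= j]; the margin up to [3 * r i]
   gives a strict inequality for [U]-most [k]. *)
pose P i j k := (i <= j)%N -> bis_dist (nu k) (x j k) (x i k) < 3 * r i.
pose good m k := forall j, (j <= m)%N -> forall i, (i <= m)%N -> P i j k.
have UP i j : U (P i j).
  have [ij|ij] := boolP (i <= j)%N; last first.
    by apply: (@filterE _ U) => k; rewrite /P (negbTE ij).
  have rj := r_le ij; have ri := inv_gt0 R i.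
  have lt : l j i < 3 * r i by have := lr j i; lra.
  have := cvg_ult (xl j i) lt.
  by apply: (@filterS _ U _ _ _ _) => k /= h _.
have Ugood m : U (good m).
  by apply: filter_lt => j; exact: filter_lt.
have good0 k : good 0%N k.
  move=> j; rewrite leqn0 => /eqP -> i; rewrite leqn0 => /eqP -> _.
  by rewrite bis_distxx mulr_gt0// inv_gt0.
(* The diagonal: at index [k] the largest stage up to [k] whose estimates all hold there is used.
   Stage 0 always qualifies, and since [U] contains the tails, [N k] reaches any given [n] for
   [U]-most [k]. *)
have /choice[N hN] : forall k, exists N, good N k /\ forall n, (n <= k)%N -> good n k -> (n <= N)%N.
  move=> k.
  have ex0 : exists m, (m <= k)%N && `[< good m k >] by exists 0%N; apply/andP; split=> //; exact/asboolP.
  have ub m : (m <= k)%N && `[< good m k >] -> (m <= k)%N by case/andP.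
  case: (ex_maxnP ex0 ub) => N /andP[_ /asboolP gN] mN; exists N; split=> // n nk gn.
  by apply: mN; rewrite nk /=; exact/asboolP.
exists (fun k => x (N k) k); split=> // n.
apply: (@filterS _ U _ _ _ _ (filterI (free_ultrafilter_geq n freeU) (Ugood n))) => k /= [nk gn].
have [gN /(_ n nk gn) nN] := hN k.
by apply: (gN (N k) _ n).
Qed.

Variables (D : set (set G)) (theta : set G -> forall k, set (K k)).
Hypotheses (Dbis : forall A, D A -> bis A)
  (Dmul : forall A B, D A -> D B -> D (bisection_mul A B))
  (Ddense : forall A (eps : R), bis A -> 0 < eps -> exists2 B, D B & bis_dist mu A B < eps)
  (htheta : sofic_approximation U mu nu D theta).

Arguments theta : clear implicits.

(** The position of [A] is prescribed relative to the dense part only; by density this determines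
    [y] up to asymptotically vanishing distance. *)
Let represents (A : set G) (y : forall k, set (K k)) := (forall k, bis (y k)) /\
  forall B, D B -> (fun k => bis_dist (nu k) (y k) (theta B k)) @ U --> bis_dist mu A B.

Let exists_representative A : bis A -> exists y, represents A y.
Proof.
move=> bA; have [tb td _] := htheta.
have /choice[B hB] : forall n, exists B, D B /\ bis_dist mu A B < r n.
  by move=> n; have [B DB AB] := Ddense bA (inv_gt0 R n); exists B.
have bB n : bis (B n) by apply: Dbis; case: (hB n).
have [|||y [by' yB]] := @ultraproduct_complete (fun n => theta (B n)) (fun i j => bis_dist mu (B i) (B j)).
- by move=> n k; apply: tb; case: (hB n).
- by move=> i j; apply: td; [case: (hB i)|case: (hB j)].
- move=> i j; apply: le_trans (bis_dist_triangle pG (bB i) bA (bB j)) _.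
  have [_ h1] := hB i; have [_ h2] := hB j.
  by rewrite (bis_distC mu (B i)) lerD// ltW.
exists y; split=> // C DC; apply/cvgrPdist_lt => eps eps0.
(* The five parts: one for replacing [A] by [B n], one for the convergence of the distances, and
   three for the bound [3 * r n] between [y] and [theta (B n)]. *)
have [n hn] : exists n, r n < eps / 5 by apply: inv_lt; rewrite divr_gt0.
have [DBn ABn] := hB n; have bC := Dbis DC.
have /cvgrPdist_lt/(_ (eps / 5)) c := td _ _ DBn DC.
have /c : 0 < eps / 5 by rewrite divr_gt0.
move=> c1; apply: (@filterS _ U _ _ _ _ (filterI c1 (yB n))) => k /= [h1 h2].
have bt := tb _ DBn k; have bt' := tb _ DC k.
have := bis_dist_triangle (pK k) (by' k) bt bt'.
have := bis_dist_triangle (pK k) bt (by' k) bt'.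
rewrite (bis_distC (nu k) (theta (B n) k) (y k)).
have := bis_dist_triangle pG bA (bB n) bC; have := bis_dist_triangle pG (bB n) bA bC.
rewrite (bis_distC mu (B n) A) => h3 h4 h5 h6.
move: h1; rewrite !ltr_norml => /andP[h1 h1']; apply/andP; split; lra.
Qed.

(** Each bisection is sent to a limit of images of approximants from [D]. Isometry and
    multiplicativity survive because distance and product are Lipschitz in [G] and, uniformly in
    [k], in [K k]. *)
Lemma sofic_approximation_extend : exists theta', sofic_approximation U mu nu (@borel_bisection d G) theta'.
Proof.
have [tb td tm] := htheta.
have /choice[th hth] : forall A, exists y, bis A -> represents A y.
  move=> A; have [bA|nA] := pselect (bis A).
    by have [y hy] := exists_representative bA; exists y.
  by exists (theta A).
have thb A : bis A -> forall k, bis (th A k) by move=> /hth[].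
exists th; split=> //.
- move=> A B bA bB; apply/cvgrPdist_lt => eps eps0.
  have e0 : 0 < eps / 5 by rewrite divr_gt0.
  have [C DC AC] := Ddense bA e0; have bC := Dbis DC.
  have [_ rA] := hth _ bA; have [_ rB] := hth _ bB.
  have c1 := cvg_ult (rA _ DC) AC.
  have /cvgrPdist_lt/(_ _ e0) c2 := rB _ DC.
  apply: (@filterS _ U _ _ _ _ (filterI c1 c2)) => k /= [h1 h2].
  have bt := tb _ DC k; have tA := thb _ bA k; have tB := thb _ bB k.
  have := bis_dist_triangle (pK k) tA bt tB; have := bis_dist_triangle (pK k) bt tA tB.
  have := bis_dist_triangle pG bA bC bB; have := bis_dist_triangle pG bC bA bB.
  rewrite (bis_distC mu C) (bis_distC mu C) (bis_distC (nu k) (theta C k)).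
  rewrite (bis_distC (nu k) (theta C k)) => h3 h4 h5 h6.
  by move: h2; rewrite !ltr_norml => /andP[h2 h2']; apply/andP; split; lra.
- move=> A B bA bB; apply/cvgrPdist_lt => eps eps0.
  have e0 : 0 < eps / 8 by rewrite divr_gt0.
  have [C DC AC] := Ddense bA e0; have bC := Dbis DC.
  have [E DE BE] := Ddense bB e0; have bE := Dbis DE.
  have bAB := borel_bisection_mul dG bA bB; have bCE := borel_bisection_mul dG bC bE.
  have [_ rA] := hth _ bA; have [_ rB] := hth _ bB; have [_ rAB] := hth _ bAB.
  have c1 := cvg_ult (rA _ DC) AC.
  have c2 := cvg_ult (rB _ DE) BE.
  have lt : bis_dist mu (bisection_mul A B) (bisection_mul C E) < eps / 4.
    by have := bis_dist_mul pG bA bC bB bE; lra.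
  have c3 := cvg_ult (rAB _ (Dmul DC DE)) lt.
  have c4 := cvg_ult (tm _ _ DC DE) e0.
  apply: (@filterS _ U _ _ _ _ (filterI (filterI c1 c2) (filterI c3 c4))) => k /= [[h1 h2] [h3 h4]].
  have tA := thb _ bA k; have tB := thb _ bB k; have tAB := thb _ bAB k.
  have tC := tb _ DC k; have tE := tb _ DE k; have tCE := tb _ (Dmul DC DE) k.
  have bm1 := borel_bisection_mul (dK k) tC tE; have bm2 := borel_bisection_mul (dK k) tA tB.
  have := bis_dist_triangle (pK k) tAB tCE bm2.
  have := bis_dist_triangle (pK k) tCE bm1 bm2.
  have := bis_dist_mul (pK k) tC tA tE tB.
  rewrite (bis_distC (nu k) (theta C k)) (bis_distC (nu k) (theta E k)) => h5 h6 h7.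
  rewrite sub0r normrN ger0_norm ?bis_dist_ge0//; lra.
Qed.

End extension.

(** * Asymptotic homomorphisms preserve sources and ranges *)

Section idempotents.
Context (G : groupoidType).
Implicit Types A B E : set G.

Local Notation s := (@gsrc G).
Local Notation t := (@gtgt G).

(** If [g = ab] with all three in [A], injectivity of the source gives [b = g]; then [a] is the
    range of [g], and injectivity of the range gives [a = g]. *)
Lemma mul_self_units A : set_inj A s -> set_inj A t -> A `&` bisection_mul A A `<=` @gunits G.
Proof.
move=> sA tA g [Ag [a [b [Aa Ab ab gab]]]].
have bg : b = g by apply: sA; rewrite ?inE// gab gsrc_mul.
rewrite bg in ab Ab gab; have atg : a = t g by apply: gmulKr => //; rewrite -gab.
have ag : a = g by apply: tA; rewrite ?inE// atg gtgt_tgt.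
by rewrite gunitsE /= -ag {1}atg gsrc_tgt -atg.
Qed.

Lemma mul_src A : bisection_mul A (s @` A) = A.
Proof.
apply/seteqP; split=> g.
  move=> [a [_ [Aa [b _ <-] ab ->]]]; rewrite gtgt_src in ab.
  by rewrite -ab gmul_src.
by move=> Ag; exists g, (s g); split=> //; rewrite ?gtgt_src ?gmul_src//; exists g.
Qed.

Lemma mul_tgt A : bisection_mul (t @` A) A = A.
Proof.
apply/seteqP; split=> g.
  move=> [_ [b [[a _ <-] Ab ab ->]]]; rewrite gsrc_tgt in ab.
  by rewrite ab gmul_tgt.
by move=> Ag; exists (t g), g; split=> //; rewrite ?gsrc_tgt ?gmul_tgt//; exists g.
Qed.

Lemma image_src_units E : E `<=` @gunits G -> s @` E = E.
Proof.
rewrite gunitsE => Eu; apply/seteqP; split=> [_ [g Eg <-]|g Eg]; first by rewrite (Eu _ Eg).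
by exists g => //; exact: Eu.
Qed.

Lemma image_tgt_units E : E `<=` @gunits G -> t @` E = E.
Proof.
rewrite gunitsE => Eu; apply/seteqP; split=> [_ [g Eg <-]|g Eg]; first by rewrite gtgt_unit//; exact: Eu.
by exists g => //; apply: gtgt_unit; exact: Eu.
Qed.

Lemma mul_units E : E `<=` @gunits G -> bisection_mul E E = E.
Proof. by move=> Eu; rewrite -{2}(image_src_units Eu) mul_src. Qed.

(** This is how a meet of sources becomes visible to the product: multiplying by units restricts the
    source. *)
Lemma src_mul_units A E : E `<=` @gunits G ->
  s @` bisection_mul A E = s @` A `&` s @` E.
Proof.
move=> Eu; rewrite (image_src_units Eu); apply/seteqP; split.
  move=> _ [_ [a [x [Aa Ex ax ->]]] <-]; rewrite gsrc_mul//.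
  have := Eu _ Ex; rewrite gunitsE /= => xu; rewrite xu; split=> //.
  by exists a => //; rewrite ax gtgt_unit.
move=> _ [[a Aa <-] Ea]; exists a => //; exists a, (s a); split=> //.
  by rewrite gtgt_src.
by rewrite gmul_src.
Qed.

Lemma tgt_mul_units A E : E `<=` @gunits G ->
  t @` bisection_mul E A = t @` A `&` t @` E.
Proof.
move=> Eu; rewrite (image_tgt_units Eu); apply/seteqP; split.
  move=> _ [_ [x [a [Ex Aa xa ->]]] <-]; rewrite gtgt_mul//.
  have := Eu _ Ex; rewrite gunitsE /= => xu; rewrite (gtgt_unit xu); split=> //.
  by exists a => //; rewrite -xa xu.
move=> _ [[a Aa <-] Ea]; exists a => //; exists (t a), a; split=> //.
  by rewrite gsrc_tgt.
by rewrite gmul_tgt.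
Qed.

End idempotents.

Section meet_estimates.
Context (R : realType) d (G : mgroupoidType d) (mu : probability G R).
Hypothesis pG : pmp_groupoid mu.
Implicit Types A B E Z : set G.

Local Notation m E := (fine (mu E)).
Local Notation s := (@gsrc G).
Local Notation t := (@gtgt G).
Local Notation bis := (@borel_bisection d G).
Local Notation dist := (bis_dist mu).
Local Notation mass := (src_mass mu).

Let dG : Defs.discrete_measurable R G. Proof. by case: pG. Qed.
Let bmul := borel_bisection_mul dG.

Lemma mass_diff_dist A B : bis A -> bis B -> mass (A `\` B) <= dist A B.
Proof.
move=> bA bB; apply: fmeasure_le.
- by apply: (measurable_src pG); apply: bisD => //; exact: bis_measurable.
- exact: (measurable_src_setY pG).
- by rewrite image_setY; left.
Qed.

(* A product [A A] meeting [A] lies in the units, so an almost idempotent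
   bisection is almost a set of units. *)
Lemma mass_diff_units E : bis E -> mass (E `\` @gunits G) <= dist E (bisection_mul E E).
Proof.
move=> bE; have [_ sE tE] := bE.
have bEE := bmul bE bE.
apply: le_trans (mass_diff_dist bE bEE).
have mu' := measurable_gunits dG.
apply: (src_mass_mono pG); [exact: bisD|by apply: bisD => //; exact: bis_measurable|].
by move=> g [Eg ng]; split=> // EEg; apply: ng; exact: (mul_self_units sE tE).
Qed.

(** Meant for [O] and [Z] the images of the units and of the empty set. As [Z] is almost idempotent
    and almost fixed by [O], nearly all of it lies in [O]; the distance from [O] to [Z] is then at
    most about [mass O - mass Z], and its closeness to 1 leaves [Z] no mass. *)
Lemma mass_null Z O : bis Z -> bis O ->
  mass Z <= 1 - dist O Z + 2 * (dist Z (bisection_mul O Z) + dist Z (bisection_mul Z Z)).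
Proof.
move=> bZ bO; have bOZ := bmul bO bZ; have bZZ := bmul bZ bZ.
have [_ sZ tZ] := bZ.
have bD : bis (Z `\` O) by apply: bisD => //; exact: bis_measurable.
have bD1 : bis (Z `\` bisection_mul O Z) by apply: bisD => //; exact: bis_measurable.
have bD2 : bis (Z `\` bisection_mul Z Z) by apply: bisD => //; exact: bis_measurable.
have bJ : bis (O `&` Z) by apply: borel_bisectionI => //; exact: bis_measurable.
have h1 : mass (Z `\` O) <= mass (Z `\` bisection_mul O Z) + mass (Z `\` bisection_mul Z Z).
  apply: fmeasure_subU; try exact: (measurable_src pG).
  rewrite -image_setU; apply: image_subset => z [Zz nOz].
  have [OZz|] := pselect (bisection_mul O Z z); last by left.
  right; split=> // ZZz; apply: nOz.
  have zu := mul_self_units sZ tZ (conj Zz ZZz); rewrite gunitsE in zu.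
  move: OZz => [w [z' [Ow Zz' wz' zE]]].
  have zz' : z' = z by apply: sZ; rewrite ?inE// zE gsrc_mul.
  rewrite zz' in wz' zE; have -> : z = w; last by [].
  by rewrite [RHS](gmulKr wz' (esym zE)) (gtgt_unit zu).
have := mass_diff_dist bZ bOZ; have := mass_diff_dist bZ bZZ.
have mO1 : mass O <= 1 by apply: fmeasure_le1; exact: (measurable_src pG).
have := bis_distE pG bO bZ.
have hJ : mass Z <= arrow_meet mu O Z + mass (Z `\` O).
  apply: fmeasure_subU; try exact: (measurable_src pG).
  rewrite -image_setU; apply: image_subset => z Zz.
  by have [Oz|] := pselect (O z); [left|right].
have hI : mass Z <= src_meet mu O Z + mass (Z `\` O).
  apply: fmeasure_subU; try exact: (measurable_src pG).
    by apply: measurableI; exact: (measurable_src pG).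
  move=> _ [z Zz <-]; have [Oz|nOz] := pselect (O z); [left|right].
    by split; exists z.
  by exists z.
by move=> h2 h3 h4; lra.
Qed.

Let meet_diff X Y Z : measurable X -> measurable Y -> measurable Z ->
  `|m (X `&` Y) - m (X `&` Z)| <= m (Y `\` Z) + m (Z `\` Y).
Proof.
move=> mX mY mZ.
have h Y' Z' : measurable Y' -> measurable Z' -> m (X `&` Y') <= m (X `&` Z') + m (Y' `\` Z').
  move=> mY' mZ'; apply: fmeasure_subU; [exact: measurableI|exact: measurableI|exact: measurableD|].
  by move=> x [Xx Yx]; have [Zx|] := pselect (Z' x); [left|right].
have := h _ _ mY mZ; have := h _ _ mZ mY.
have := fmeasure_ge0 mu (Y `\` Z); have := fmeasure_ge0 mu (Z `\` Y).
by move=> h1 h2 h3 h4; rewrite ler_norml; apply/andP; split; lra.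
Qed.

(** [E] stands for the image of the source of [B]: almost idempotent, almost fixing [B] on the
    right, and of nearly the same mass. The first two properties make its unit part [E0] cover most
    of the source of [B], and equality of masses leaves little room for anything else. Then
    [src_mul_units] applies to [E0]. *)
Lemma src_meet_mul A B E : bis A -> bis B -> bis E ->
  `|src_meet mu A B - mass (bisection_mul A E)| <=
    4 * dist E (bisection_mul E E) + 2 * dist B (bisection_mul B E) + `|mass E - mass B|.
Proof.
move=> bA bB bE.
pose E0 := E `&` @gunits G.
have bE0 : bis E0 by apply: borel_bisectionI => //; exact: (measurable_gunits dG).
have E0u : E0 `<=` @gunits G by move=> ? [].
have dE : dist E E0 <= dist E (bisection_mul E E).
  rewrite bis_dist_sub; last by move=> ? [].
  by rewrite setDIr setDv set0U; exact: mass_diff_units.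
have bAE := bmul bA bE; have bAE0 := bmul bA bE0; have bBE := bmul bB bE; have bBE0 := bmul bB bE0.
have h1 := src_mass_dist pG bAE bAE0.
have h2 := bis_dist_mull pG bE bE0 bA.
have sAE0 : mass (bisection_mul A E0) = src_meet mu A E0 by rewrite /src_mass src_mul_units.
have h3 : `|src_meet mu A B - src_meet mu A E0| <= m (s @` B `\` s @` E0) + m (s @` E0 `\` s @` B).
  by apply: meet_diff; exact: (measurable_src pG).
have h4 : m (s @` B `\` s @` E0) <= dist B (bisection_mul B E0).
  apply: le_trans (mass_diff_dist bB bBE0); apply: fmeasure_le.
  - by apply: measurableD; exact: (measurable_src pG).
  - by apply: (measurable_src pG); apply: bisD => //; exact: bis_measurable.
  - move=> _ [[b Bb <-] nE]; exists b => //; split=> //.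
    move=> [b' [x [_ Ex b'x bE']]]; apply: nE; exists x => //.
    by rewrite bE' gsrc_mul.
have h5 := bis_dist_triangle pG bB bBE bBE0.
have h6 := bis_dist_mull pG bE bE0 bB.
have h7 : m (s @` E0 `\` s @` B) = mass E0 - mass B + m (s @` B `\` s @` E0).
  have := fmeasureID mu (measurable_src pG bE0) (measurable_src pG bB).
  have := fmeasureID mu (measurable_src pG bB) (measurable_src pG bE0).
  by rewrite setIC /src_mass; lra.
have h8 := src_mass_dist pG bE bE0.
rewrite sAE0 in h1.
have := ler_norm (mass E - mass B).
move: h1 h3 h8; rewrite !ler_norml => /andP[h1 h1'] /andP[h3 h3'] /andP[h8 h8'] h9.
by apply/andP; split; lra.
Qed.

Lemma tgt_meet_mul A B E : bis A -> bis B -> bis E ->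
  `|tgt_meet mu A B - mass (bisection_mul E A)| <=
    4 * dist E (bisection_mul E E) + 2 * dist B (bisection_mul E B) + `|mass E - mass B|.
Proof.
move=> bA bB bE.
pose E0 := E `&` @gunits G.
have bE0 : bis E0 by apply: borel_bisectionI => //; exact: (measurable_gunits dG).
have E0u : E0 `<=` @gunits G by move=> ? [].
have dE : dist E E0 <= dist E (bisection_mul E E).
  rewrite bis_dist_sub; last by move=> ? [].
  by rewrite setDIr setDv set0U; exact: mass_diff_units.
have bAE := bmul bE bA; have bAE0 := bmul bE0 bA; have bBE := bmul bE bB; have bBE0 := bmul bE0 bB.
have h1 := src_mass_dist pG bAE bAE0.
have h2 := bis_dist_mulr pG bE bE0 bA.
have sAE0 : mass (bisection_mul E0 A) = tgt_meet mu A E0.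
  by rewrite /src_mass -(pmp_fine pG bAE0) tgt_mul_units.
have h3 : `|tgt_meet mu A B - tgt_meet mu A E0| <= m (t @` B `\` t @` E0) + m (t @` E0 `\` t @` B).
  by apply: meet_diff; exact: (measurable_tgt pG).
have bD : bis (B `\` bisection_mul E0 B) by apply: bisD => //; exact: bis_measurable.
have h4 : m (t @` B `\` t @` E0) <= dist B (bisection_mul E0 B).
  apply: le_trans (mass_diff_dist bB bBE0); rewrite /src_mass -(pmp_fine pG bD).
  apply: fmeasure_le.
  - by apply: measurableD; exact: (measurable_tgt pG).
  - exact: (measurable_tgt pG).
  - move=> _ [[b Bb <-] nE]; exists b => //; split=> //.
    move=> [x [b' [Ex _ xb' bE']]]; apply: nE; exists x => //.
    by rewrite bE' gtgt_mul.
have h5 := bis_dist_triangle pG bB bBE bBE0.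
have h6 := bis_dist_mulr pG bE bE0 bB.
have h7 : m (t @` E0 `\` t @` B) = mass E0 - mass B + m (t @` B `\` t @` E0).
  have := fmeasureID mu (measurable_tgt pG bE0) (measurable_tgt pG bB).
  have := fmeasureID mu (measurable_tgt pG bB) (measurable_tgt pG bE0).
  by rewrite setIC /src_mass (pmp_fine pG bE0) (pmp_fine pG bB); lra.
have h8 := src_mass_dist pG bE bE0.
rewrite sAE0 in h1.
have := ler_norm (mass E - mass B).
move: h1 h3 h8; rewrite !ler_norml => /andP[h1 h1'] /andP[h3 h3'] /andP[h8 h8'] h9.
by apply/andP; split; lra.
Qed.

End meet_estimates.

Section approximation_limits.
Context (R : realType) (U : set_system nat) {UU : ProperFilter U}.
Context d (G : mgroupoidType d) (mu : probability G R).
Variables (e : nat -> measure_display) (K : forall k, mgroupoidType (e k))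
  (nu : forall k, probability (K k) R).
Hypotheses (pG : pmp_groupoid mu) (pK : forall k, pmp_groupoid (nu k)).
Variable theta : set G -> forall k, set (K k).
Arguments theta : clear implicits.
Hypothesis htheta : sofic_approximation U mu nu (@borel_bisection d G) theta.

Local Notation bis := (@borel_bisection d G).

Let dG : Defs.discrete_measurable R G. Proof. by case: pG. Qed.
Let dK k : Defs.discrete_measurable R (K k). Proof. by case: (pK k). Qed.
Let bmul := borel_bisection_mul dG.

Let tb A k : bis A -> borel_bisection (theta A k).
Proof. by case: htheta => h _ _ bA; exact: h. Qed.

Let tbm A B k : bis A -> bis B -> borel_bisection (bisection_mul (theta A k) (theta B k)).
Proof. by move=> bA bB; apply: (borel_bisection_mul (dK k)); exact: tb. Qed.

Let cvg_mulE A B C : bis A -> bis B -> bisection_mul A B = C ->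
  (fun k => bis_dist (nu k) (theta C k) (bisection_mul (theta A k) (theta B k))) @ U --> (0 : R).
Proof. by move=> bA bB <-; have [_ _] := htheta; exact. Qed.

(** The units lie at distance 1 from the empty set, and the latter absorbs the units and itself.
    These relations are preserved asymptotically, so that [mass_null] applies. *)
Let cvg_null : (fun k => src_mass (nu k) (theta set0 k)) @ U --> (0 : R).
Proof.
have b0 := @bis0 d G; have bu := borel_bisection_gunits dG.
have [_ td _] := htheta.
have e0 : bisection_mul (@gunits G) set0 = set0.
  by rewrite -subset0 => g [a [b [_ []]]].
have e00 : bisection_mul (@set0 G) set0 = set0.
  by rewrite -subset0 => g [a [b [[]]]].
have c1 := td _ _ bu b0.
have du : bis_dist mu (@gunits G) set0 = 1.
  by rewrite -src_massE /src_mass image_src_units//; have [_ -> _] := pG.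
rewrite du in c1.
have c2 : (fun k => 1 - bis_dist (nu k) (theta (@gunits G) k) (theta set0 k)) @ U --> (1 - 1 : R).
  by apply: cvgB => //; exact: (@cvg_cst R 1 nat U _).
rewrite subrr in c2.
have c3 := cvg0D (FU := UU) (cvg_mulE bu b0 e0) (cvg_mulE b0 b0 e00).
have c4 := cvg0Z (FU := UU) 2 c3.
apply: (cvg0_le _ (cvg0D c2 c4)) => k; rewrite src_mass_ge0 /=.
by apply: (mass_null (pK k)); exact: tb.
Qed.

Lemma cvg_src_mass A : bis A -> (fun k => src_mass (nu k) (theta A k)) @ U --> src_mass mu A.
Proof.
move=> bA; have [_ td _] := htheta; have b0 := @bis0 d G.
have := td _ _ bA b0; rewrite -src_massE; apply: (cvg_dist0 _ cvg_null) => k.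
have tA := tb k bA; have t0 := tb k b0; have b00 := @bis0 _ (K k).
have := bis_dist_triangle (pK k) tA b00 t0; have := bis_dist_triangle (pK k) tA t0 b00.
rewrite !src_massE (bis_distC _ set0) => h1 h2.
by rewrite ler_norml; apply/andP; split; lra.
Qed.

Let cvg_mass_mul A B : bis A -> bis B ->
  (fun k => src_mass (nu k) (bisection_mul (theta A k) (theta B k))) @ U --> src_mass mu (bisection_mul A B).
Proof.
move=> bA bB; have bAB := bmul bA bB.
apply: (cvg_dist0 _ (cvg_mulE bA bB erefl) (cvg_src_mass bAB)) => k.
rewrite distrC; apply: (src_mass_dist (pK k)); [exact: tb|exact: tbm].
Qed.

Let cvg_bound (E B F : set G) (u : nat -> R) : bis E -> bis B -> bis F ->
  bisection_mul E E = E -> src_mass mu E = src_mass mu B -> u @ U --> (0 : R) ->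
  (fun k => 4 * bis_dist (nu k) (theta E k) (bisection_mul (theta E k) (theta E k)) +
     2 * u k + `|src_mass (nu k) (theta E k) - src_mass (nu k) (theta B k)|) @ U --> (0 : R).
Proof.
move=> bE bB bF EE EB u0; apply: cvg0D; first apply: cvg0D.
- by apply: cvg0Z; exact: cvg_mulE.
- exact: cvg0Z.
- apply/norm_cvg0P; rewrite (_ : 0 = src_mass mu E - src_mass mu B); last by rewrite EB subrr.
  by apply: cvgB; exact: cvg_src_mass.
Qed.

(** The source of [B] is an idempotent bisection [E] with [B E = B], and the meet is the mass of
    [A E]. Both are statements on products, hence asymptotically preserved. *)
Lemma cvg_src_meet A B : bis A -> bis B ->
  (fun k => src_meet (nu k) (theta A k) (theta B k)) @ U --> src_meet mu A B.
Proof.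
move=> bA bB; have bE := borel_bisection_gsrc dG bB.
have Eu : @gsrc G @` B `<=` @gunits G by move=> _ [g _ <-]; exists g.
have EE := mul_units Eu.
have -> : src_meet mu A B = src_mass mu (bisection_mul A (@gsrc G @` B)).
  by rewrite /src_mass src_mul_units// (image_src_units Eu).
have SE : src_mass mu (@gsrc G @` B) = src_mass mu B by rewrite /src_mass (image_src_units Eu).
apply: (cvg_dist0 _ (cvg_bound bE bB bE EE SE (cvg_mulE bB bE (mul_src B))) (cvg_mass_mul bA bE)) => k.
by apply: (src_meet_mul (pK k)); exact: tb.
Qed.

Lemma cvg_tgt_meet A B : bis A -> bis B ->
  (fun k => tgt_meet (nu k) (theta A k) (theta B k)) @ U --> tgt_meet mu A B.
Proof.
move=> bA bB; have bE := borel_bisection_gtgt dG bB.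
have Eu : @gtgt G @` B `<=` @gunits G by move=> _ [g _ <-]; rewrite gunitsE /= gsrc_tgt.
have EE := mul_units Eu; have bEA := bmul bE bA.
have -> : tgt_meet mu A B = src_mass mu (bisection_mul (@gtgt G @` B) A).
  by rewrite /src_mass -(pmp_fine pG bEA) tgt_mul_units// (image_tgt_units Eu).
have SE : src_mass mu (@gtgt G @` B) = src_mass mu B.
  by rewrite /src_mass (image_src_units Eu) (pmp_fine pG bB).
apply: (cvg_dist0 _ (cvg_bound bE bB bE EE SE (cvg_mulE bE bB (mul_tgt B))) (cvg_mass_mul bE bA)) => k.
by apply: (tgt_meet_mul (pK k)); exact: tb.
Qed.

Lemma cvg_arrow_meet A B : bis A -> bis B ->
  (fun k => arrow_meet (nu k) (theta A k) (theta B k)) @ U --> arrow_meet mu A B.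
Proof.
move=> bA bB; have [_ td _] := htheta.
have -> : arrow_meet mu A B = src_mass mu A + src_mass mu B - src_meet mu A B - bis_dist mu A B.
  by have := bis_distE pG bA bB; lra.
rewrite (_ : (fun k => _) = fun k => src_mass (nu k) (theta A k) + src_mass (nu k) (theta B k) -
  src_meet (nu k) (theta A k) (theta B k) - bis_dist (nu k) (theta A k) (theta B k)); last first.
  by apply/funext => k; have := bis_distE (pK k) (tb k bA) (tb k bB); lra.
apply: cvgB; last exact: td.
by apply: cvgB; [apply: cvgD; exact: cvg_src_mass|exact: cvg_src_meet].
Qed.

End approximation_limits.

(** * Gluing rectangles *)

(** Suffices for a union of bisections to be a bisection, and makes masses and meets of unions into
    sums. *)
Definition spread (X : groupoidType) (I : Type) (V : I -> set X) :=
  trivIset setT (fun i => @gsrc X @` V i) /\ trivIset setT (fun i => @gtgt X @` V i).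

Section spread_families.
Context (R : realType) d (X : mgroupoidType d) (mu : probability X R).
Hypothesis pX : pmp_groupoid mu.

Local Notation m E := (fine (mu E)).
Local Notation s := (@gsrc X).
Local Notation t := (@gtgt X).
Local Notation bis := (@borel_bisection d X).

Let dX : Defs.discrete_measurable R X. Proof. by case: pX. Qed.

Lemma bis_spread (I : finType) (V : I -> set X) : (forall i, bis (V i)) -> spread V ->
  bis (\bigcup_i V i).
Proof.
move=> bV [sV tV]; split.
- by apply: measurable_finite_bigcup => i; exact: bis_measurable.
- move=> g h /set_mem[i _ Vg] /set_mem[j _ Vh] gh.
  have ij : i = j by apply: sV => //; exists (s g); split; [exists g|exists h].
  by have [_ sVi _] := bV i; apply: sVi; rewrite ?inE// ij.
- move=> g h /set_mem[i _ Vg] /set_mem[j _ Vh] gh.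
  have ij : i = j by apply: tV => //; exists (t g); split; [exists g|exists h].
  by have [_ _ tVi] := bV i; apply: tVi; rewrite ?inE// ij.
Qed.

Lemma src_mass_spread (I : finType) (V : I -> set X) : (forall i, bis (V i)) -> spread V ->
  src_mass mu (\bigcup_i V i) = \sum_i src_mass mu (V i).
Proof.
move=> bV [sV _]; rewrite /src_mass image_bigcup fmeasure_bigcup// => i.
exact: (measurable_src pX).
Qed.

Lemma src_meet_spread (I J : finType) (V : I -> set X) (W : J -> set X) :
  (forall i, bis (V i)) -> spread V -> (forall j, bis (W j)) -> spread W ->
  src_meet mu (\bigcup_i V i) (\bigcup_j W j) = \sum_i \sum_j src_meet mu (V i) (W j).
Proof.
move=> bV [sV _] bW [sW _].
have mV i : measurable (s @` V i) by exact: (measurable_src pX).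
have mW i : measurable (s @` W i) by exact: (measurable_src pX).
rewrite /src_meet !image_bigcup setI_bigcupl fmeasure_bigcup.
- apply: eq_bigr => i _; rewrite setI_bigcupr fmeasure_bigcup//.
    by move=> j; exact: measurableI.
  by move=> j k _ _ [x [[_ Wj] [_ Wk]]]; apply: sW => //; exists x.
- move=> i; apply: measurableI => //; exact: measurable_finite_bigcup.
- by move=> i j _ _ [x [[Vi _] [Vj _]]]; apply: sV => //; exists x.
Qed.

Lemma arrow_meet_spread (I J : finType) (V : I -> set X) (W : J -> set X) :
  (forall i, bis (V i)) -> spread V -> (forall j, bis (W j)) -> spread W ->
  arrow_meet mu (\bigcup_i V i) (\bigcup_j W j) = \sum_i \sum_j arrow_meet mu (V i) (W j).
Proof.
move=> bV [sV _] bW [sW _].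
have bVW i j : bis (V i `&` W j) by apply: borel_bisectionI => //; exact: bis_measurable.
have bVW' i : bis (V i `&` \bigcup_j W j).
  by apply: borel_bisectionI => //; apply: measurable_finite_bigcup => j; exact: bis_measurable.
rewrite /arrow_meet setI_bigcupl image_bigcup fmeasure_bigcup.
- apply: eq_bigr => i _; rewrite setI_bigcupr image_bigcup fmeasure_bigcup//.
    by move=> j; exact: (measurable_src pX).
  move=> j k _ _ [x [[g [_ Wg] gx] [h [_ Wh] hx]]]; apply: sW => //.
  by exists x; split; [exists g|exists h].
- by move=> i; exact: (measurable_src pX).
- move=> i j _ _ [x [[g [Vg _] gx] [h [Vh _] hx]]]; apply: sV => //.
  by exists x; split; [exists g|exists h].
Qed.

(** Solving [bis_distE] for the arrow meet leaves the two masses, the source meet and the distance;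
    the masses together, the meet and the distance each vary by at most the sum of the two
    distances, whence the factor 3. *)
Lemma arrow_meet_dist A A' B B' : bis A -> bis A' -> bis B -> bis B' ->
  `|arrow_meet mu A B - arrow_meet mu A' B'| <= 3 * (bis_dist mu A A' + bis_dist mu B B').
Proof.
move=> bA bA' bB bB'.
have := bis_distE pX bA bB; have := bis_distE pX bA' bB'.
have := src_mass_dist pX bA bA'; have := src_mass_dist pX bB bB'.
have := src_meet_dist pX bA bA' bB bB'.
have := bis_dist_triangle pX bA bA' bB; have := bis_dist_triangle pX bA' bB' bB.
have := bis_dist_triangle pX bA' bA bB'; have := bis_dist_triangle pX bA bB bB'.
rewrite (bis_distC mu A' A) (bis_distC mu B' B) => h1 h2 h3 h4.
rewrite !ler_norml => /andP[i1 i2] /andP[j1 j2] /andP[k1 k2] h5 h6.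
by apply/andP; split; lra.
Qed.

Lemma bis_dist_bigcup (I : finType) (V W : I -> set X) :
  (forall i, bis (V i)) -> (forall i, bis (W i)) ->
  bis (\bigcup_i V i) -> bis (\bigcup_i W i) ->
  bis_dist mu (\bigcup_i V i) (\bigcup_i W i) <= \sum_i bis_dist mu (V i) (W i).
Proof.
move=> bV bW bUV bUW; rewrite /bis_dist.
have mVW i : measurable (s @` (V i `+` W i)) by exact: (measurable_src_setY pX).
apply: le_trans (fmeasure_bigcup_le mu mVW); apply: fmeasure_le.
- exact: (measurable_src_setY pX).
- exact: measurable_finite_bigcup.
- move=> _ [g h <-]; case: h => -[[i _ Vg] nW]; exists i => //; exists g => //.
    by left; split=> // Wg; apply: nW; exists i.
  by right; split=> // Wg; apply: nW; exists i.
Qed.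

(* The arrows of [W i] whose source and range are met by no other member of the
   family: a spread family close to [W] if [W] is almost spread. *)
Definition core (I : finType) (W : I -> set X) i : set X :=
  W i `&` (s @^-1` (~` \bigcup_j (if j == i then set0 else s @` W j)) `&`
           t @^-1` (~` \bigcup_j (if j == i then set0 else t @` W j))).

Definition glue_cores (I : finType) (W : I -> set X) := \bigcup_i core W i.

Lemma core_sub (I : finType) (W : I -> set X) i : core W i `<=` W i.
Proof. by move=> x []. Qed.

Lemma spread_core (I : finType) (W : I -> set X) : spread (core W).
Proof.
split=> i j _ _ [_ [[g [Wg [sg tg]] <-] [h [Wh [sh th]] gh]]]; apply: contrapT => ij.
  apply: sh; exists i => //=; case: eqVneq => [//|_].
  by exists g => //; rewrite gh.
apply: th; exists i => //=; case: eqVneq => [//|_].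
by exists g => //; rewrite gh.
Qed.

Lemma bis_core (I : finType) (W : I -> set X) : (forall i, bis (W i)) ->
  forall i, bis (core W i).
Proof.
move=> bW i; apply: borel_bisectionI => //.
have ms := measurable_gsrc dX measurableT; have mt := measurable_gtgt dX measurableT.
apply: measurableI; rewrite -[X in measurable X]setTI.
  apply: ms; apply: measurableC; apply: measurable_finite_bigcup => j.
  by case: ifP => // _; exact: (measurable_src pX).
apply: mt; apply: measurableC; apply: measurable_finite_bigcup => j.
by case: ifP => // _; exact: (measurable_tgt pX).
Qed.

Lemma bis_glue_cores (I : finType) (W : I -> set X) : (forall i, bis (W i)) -> bis (glue_cores W).
Proof. by move=> bW; apply: bis_spread; [exact: bis_core|exact: spread_core]. Qed.

(** An arrow is removed because its source or its range is met by another member; invariance turns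
    the mass of arrows removed for the second reason into a mass of ranges. *)
Lemma dist_core (I : finType) (W : I -> set X) i : (forall i, bis (W i)) ->
  bis_dist mu (W i) (core W i) <=
    \sum_(j | j != i) (src_meet mu (W i) (W j) + tgt_meet mu (W i) (W j)).
Proof.
move=> bW; rewrite bis_dist_sub; last exact: core_sub.
pose F j := if j == i then set0 else (s @` W i `&` s @` W j) `|`
  s @` (W i `&` t @^-1` (t @` W j)).
have bF j : bis (W i `&` t @^-1` (t @` W j)) by apply: (tgt_preimage pX) => //; exact: (measurable_tgt pX).
have mF j : measurable (F j).
  rewrite /F; case: ifP => // _; apply: measurableU; last exact: (measurable_src pX).
  by apply: measurableI; exact: (measurable_src pX).
apply: (@le_trans _ _ (m (\bigcup_j F j))).
  apply: fmeasure_le.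
  - apply: (measurable_src pX); apply: bisD => //; apply: bis_measurable.
    exact: bis_core.
  - exact: measurable_finite_bigcup.
  - move=> _ [g [Wg nc] <-]; apply: contrapT => nF; apply: nc; split=> //; split.
      move=> [j _] /=; case: ifP => [_ []|ji sg]; apply: nF; exists j => //.
      by rewrite /F ji; left; split=> //; exists g.
    move=> [j _] /=; case: ifP => [_ []|ji tg]; apply: nF; exists j => //.
    by rewrite /F ji; right; exists g.
apply: le_trans (fmeasure_bigcup_le mu mF) _.
rewrite [leRHS]big_mkcond; apply: ler_sum => j _; rewrite /F.
case: eqVneq => [_|_] /=; first by rewrite measure0.
apply: le_trans (fmeasureU_le _ _ _) _.
- by apply: measurableI; exact: (measurable_src pX).
- exact: (measurable_src pX).
rewrite lerD2l -(pmp_fine pX)//; apply: fmeasure_le; first exact: (measurable_tgt pX).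
  by apply: measurableI; exact: (measurable_tgt pX).
by move=> _ [g [Wg tg] <-]; split=> //; exists g.
Qed.

End spread_families.

(** * Masses and meets of rectangles *)

Section rectangles.
Context (R : realType) d1 d2 (G : mgroupoidType d1) (H : mgroupoidType d2).
Variables (mu : probability G R) (nu : probability H R).
Hypotheses (pG : pmp_groupoid mu) (pH : pmp_groupoid nu).

Definition prod_prob : probability (G * H)%type R := (mu \x nu)%E.

Local Notation rect A B := (A `*` B : set (G * H)%type).
Local Notation bis := (@borel_bisection _ _).

Let pGH : pmp_groupoid (G := (G * H)%type) prod_prob := pmp_groupoid_prod pG pH.

Lemma fine_prodE (A : set G) (B : set H) : measurable A -> measurable B ->
  fine (prod_prob (A `*` B)) = fine (mu A) * fine (nu B).
Proof.
move=> mA mB; rewrite -fineM ?fin_num_measure//; congr fine; exact: product_measure1E.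
Qed.

Lemma gsrc_rect (A : set G) (B : set H) :
  @gsrc (G * H)%type @` rect A B = (@gsrc G @` A) `*` (@gsrc H @` B).
Proof.
apply/seteqP; split=> -[x y].
  by move=> [[g h] [/= Ag Bh] [<- <-]]; split; [exists g|exists h].
by move=> [/= [g Ag <-] [h Bh <-]]; exists (g, h).
Qed.

Lemma gtgt_rect (A : set G) (B : set H) :
  @gtgt (G * H)%type @` rect A B = (@gtgt G @` A) `*` (@gtgt H @` B).
Proof.
apply/seteqP; split=> -[x y].
  by move=> [[g h] [/= Ag Bh] [<- <-]]; split; [exists g|exists h].
by move=> [/= [g Ag <-] [h Bh <-]]; exists (g, h).
Qed.

Lemma mul_rect (A A' : set G) (B B' : set H) :
  bisection_mul (rect A B) (rect A' B') = rect (bisection_mul A A') (bisection_mul B B').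
Proof.
apply/seteqP; split=> -[x y].
  move=> [[a b] [[a' b'] [[/= Aa Bb] [/= Aa' Bb'] [aa bb] [-> ->]]]].
  by split; [exists a, a'|exists b, b'].
move=> [/= [a [a' [Aa Aa' aa ->]]] [b [b' [Bb Bb' bb ->]]]].
by exists (a, b), (a', b'); split=> //; congr pair.
Qed.

Lemma src_mass_rect (A : set G) (B : set H) : bis A -> bis B ->
  src_mass prod_prob (rect A B) = src_mass mu A * src_mass nu B.
Proof.
move=> bA bB; rewrite /src_mass gsrc_rect fine_prodE//.
  exact: (measurable_src pG).
exact: (measurable_src pH).
Qed.

(** Unlike distances, meets of rectangles are exact products, so their limits can be taken in each
    factor separately. *)
Lemma src_meet_rect (A A' : set G) (B B' : set H) : bis A -> bis A' -> bis B -> bis B' ->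
  src_meet prod_prob (rect A B) (rect A' B') = src_meet mu A A' * src_meet nu B B'.
Proof.
move=> bA bA' bB bB'; rewrite /src_meet !gsrc_rect -setXI fine_prodE//.
  by apply: measurableI; exact: (measurable_src pG).
by apply: measurableI; exact: (measurable_src pH).
Qed.

Lemma tgt_meet_rect (A A' : set G) (B B' : set H) : bis A -> bis A' -> bis B -> bis B' ->
  tgt_meet prod_prob (rect A B) (rect A' B') = tgt_meet mu A A' * tgt_meet nu B B'.
Proof.
move=> bA bA' bB bB'; rewrite /tgt_meet !gtgt_rect -setXI fine_prodE//.
  by apply: measurableI; exact: (measurable_tgt pG).
by apply: measurableI; exact: (measurable_tgt pH).
Qed.

Lemma arrow_meet_rect (A A' : set G) (B B' : set H) : bis A -> bis A' -> bis B -> bis B' ->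
  arrow_meet prod_prob (rect A B) (rect A' B') = arrow_meet mu A A' * arrow_meet nu B B'.
Proof.
move=> bA bA' bB bB'; rewrite /arrow_meet -setXI gsrc_rect fine_prodE//.
  by apply: (measurable_src pG); apply: borel_bisectionI => //; exact: bis_measurable.
by apply: (measurable_src pH); apply: borel_bisectionI => //; exact: bis_measurable.
Qed.

Lemma bis_dist_rect (A A' : set G) (B B' : set H) : bis A -> bis A' -> bis B -> bis B' ->
  bis_dist prod_prob (rect A B) (rect A' B') <= bis_dist mu A A' + bis_dist nu B B'.
Proof.
move=> bA bA' bB bB'.
have mA : measurable (@gsrc G @` (A `+` A')) by exact: (measurable_src_setY pG).
have mB : measurable (@gsrc H @` (B `+` B')) by exact: (measurable_src_setY pH).
have e1 : bis_dist mu A A' = fine (prod_prob ((@gsrc G @` (A `+` A')) `*` setT)).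
  by rewrite fine_prodE// probability_setT mulr1.
have e2 : bis_dist nu B B' = fine (prod_prob (setT `*` (@gsrc H @` (B `+` B')))).
  by rewrite fine_prodE// probability_setT mul1r.
rewrite e1 e2; apply: fmeasure_subU.
- by apply: (measurable_src_setY pGH); exact: borel_bisectionX.
- exact: measurableX.
- exact: measurableX.
move=> _ [[g h] gh <-]; case: gh => -[[/= Ag Bh] n].
  have [A'g|nA'] := pselect (A' g).
    by right; split=> //=; exists h => //; left; split=> // B'h; apply: n.
  by left; split=> //=; exists g => //; left.
have [A'g|nA'] := pselect (A g).
  by right; split=> //=; exists h => //; right; split=> // B'h; apply: n.
by left; split=> //=; exists g => //; right.
Qed.

End rectangles.

(** The decomposition is kept as data, because the image in the finite groupoids is built from the
    single rectangles and not from their union. *)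
Record rectangle_family (G H : Type) := RectangleFamily {
  rf_index : finType;
  rf_left : rf_index -> set G;
  rf_right : rf_index -> set H }.

Arguments rf_left {G H} _ _.
Arguments rf_right {G H} _ _.

Section rectangle_families.
Context d1 d2 (G : mgroupoidType d1) (H : mgroupoidType d2).
Implicit Types F : rectangle_family G H.

Definition rf_member F i : set (G * H)%type := rf_left F i `*` rf_right F i.
Arguments rf_member : clear implicits.

Definition rf_union F : set (G * H)%type := \bigcup_i rf_member F i.

Definition rf_bisection F := [/\ forall i, borel_bisection (rf_left F i),
  forall i, borel_bisection (rf_right F i) & spread (rf_member F)].

Definition rf_mul F F' : rectangle_family G H :=
  @RectangleFamily G H (rf_index F * rf_index F')%type
    (fun p => bisection_mul (rf_left F p.1) (rf_left F' p.2))
    (fun p => bisection_mul (rf_right F p.1) (rf_right F' p.2)).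

Lemma bis_rf_member F i : rf_bisection F -> borel_bisection (rf_member F i).
Proof. by move=> [bl br _]; exact: borel_bisectionX. Qed.

Lemma rf_member_mul F F' p : rf_member (rf_mul F F') p =
  bisection_mul (rf_member F p.1) (rf_member F' p.2).
Proof. by rewrite mul_rect. Qed.

Lemma mul_bigcup (X : groupoidType) (I J : Type) (V : I -> set X) (W : J -> set X) :
  bisection_mul (\bigcup_i V i) (\bigcup_j W j) = \bigcup_p bisection_mul (V p.1) (W p.2).
Proof.
apply/seteqP; split=> g.
  by move=> [a [b [[i _ Va] [j _ Wb] ab ->]]]; exists (i, j) => //; exists a, b.
by move=> [[i j] _ [a [b [/= Va Wb ab ->]]]]; exists a, b; split=> //; [exists i|exists j].
Qed.

(** The source of [ab] is that of [b], so it determines the index of [b], then [b], and through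
    [gsrc a = gtgt b] the index of [a]. Ranges are dual. *)
Lemma spread_mul (X : groupoidType) (I J : Type) (V : I -> set X) (W : J -> set X) :
  (forall i, set_inj (V i) (@gtgt X)) -> (forall j, set_inj (W j) (@gsrc X)) ->
  (forall i, set_inj (V i) (@gsrc X)) -> (forall j, set_inj (W j) (@gtgt X)) ->
  spread V -> spread W -> spread (fun p => bisection_mul (V p.1) (W p.2)).
Proof.
move=> tVi sWj sVi tWj [sV tV] [sW tW]; split=> -[i j] [i' j'] _ _ [x].
  move=> [[_ [a [b [/= Va Wb ab ->]]] <-] [_ [a' [b' [/= Va' Wb' ab' ->]]] xE]].
  rewrite !gsrc_mul// in xE.
  have jj : j = j' by apply: sW => //; exists (gsrc b); split; [exists b|exists b'].
  rewrite jj in Wb; have bb : b' = b by apply: (sWj j'); rewrite ?inE.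
  have ii : i = i' by apply: sV => //; exists (gsrc a); split; [exists a|exists a'; rewrite // ab' bb].
  by rewrite ii jj.
move=> [[_ [a [b [/= Va Wb ab ->]]] <-] [_ [a' [b' [/= Va' Wb' ab' ->]]] xE]].
rewrite !gtgt_mul// in xE.
have ii : i = i' by apply: tV => //; exists (gtgt a); split; [exists a|exists a'].
rewrite ii in Va; have aa : a' = a by apply: (tVi i'); rewrite ?inE.
have jj : j = j' by apply: tW => //; exists (gtgt b); split; [exists b|exists b'; rewrite // -ab' aa].
by rewrite ii jj.
Qed.

Lemma rf_union_mul F F' : rf_union (rf_mul F F') = bisection_mul (rf_union F) (rf_union F').
Proof. by rewrite mul_bigcup; apply: eq_bigcup => // p _; exact: rf_member_mul. Qed.

Lemma rf_bisection_mul (R : realType) F F' : Defs.discrete_measurable R G ->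
  Defs.discrete_measurable R H -> rf_bisection F -> rf_bisection F' ->
  rf_bisection (rf_mul F F').
Proof.
move=> dG dH bF bF'; have [bl br sp] := bF; have [bl' br' sp'] := bF'.
split; [by move=> p; exact: (borel_bisection_mul dG)|by move=> p; exact: (borel_bisection_mul dH)|].
have -> : rf_member (rf_mul F F') =
    fun p => bisection_mul (rf_member F p.1) (rf_member F' p.2).
  by apply/funext => p; exact: rf_member_mul.
by apply: spread_mul => // i; [case: (bis_rf_member i bF)|case: (bis_rf_member i bF')|
  case: (bis_rf_member i bF)|case: (bis_rf_member i bF')].
Qed.

End rectangle_families.
Arguments rf_member {d1 d2 G H} F i.

(** * The asymptotic homomorphism on finite unions of rectangles *)

Section product_approximation.
Context (R : realType) (U : set_system nat) {UU : ProperFilter U}.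
Context d1 d2 (G : mgroupoidType d1) (H : mgroupoidType d2).
Variables (mu : probability G R) (nu : probability H R).
Variables (e1 : nat -> measure_display) (K : forall k, mgroupoidType (e1 k))
  (muK : forall k, probability (K k) R).
Variables (e2 : nat -> measure_display) (L : forall k, mgroupoidType (e2 k))
  (nuL : forall k, probability (L k) R).
Hypotheses (pG : pmp_groupoid mu) (pH : pmp_groupoid nu)
  (pK : forall k, pmp_groupoid (muK k)) (pL : forall k, pmp_groupoid (nuL k)).
Variables (theta : set G -> forall k, set (K k)) (psi : set H -> forall k, set (L k)).
Arguments theta : clear implicits.
Arguments psi : clear implicits.
Hypotheses (htheta : sofic_approximation U mu muK (@borel_bisection d1 G) theta)
  (hpsi : sofic_approximation U nu nuL (@borel_bisection d2 H) psi).

Implicit Types F : rectangle_family G H.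

Local Notation P := (prod_prob mu nu).
Local Notation PK k := (prod_prob (muK k) (nuL k)).

Let dG : Defs.discrete_measurable R G. Proof. by case: pG. Qed.
Let dH : Defs.discrete_measurable R H. Proof. by case: pH. Qed.
Let dK k : Defs.discrete_measurable R (K k). Proof. by case: (pK k). Qed.
Let dL k : Defs.discrete_measurable R (L k). Proof. by case: (pL k). Qed.
Let pGH : pmp_groupoid P := pmp_groupoid_prod pG pH.
Let pKL k : pmp_groupoid (PK k) := pmp_groupoid_prod (pK k) (pL k).

Definition image_rectangle F k (i : rf_index F) : set (K k * L k)%type :=
  theta (rf_left F i) k `*` psi (rf_right F i) k.
Arguments image_rectangle : clear implicits.

Local Notation W := image_rectangle.

Let tb A k : borel_bisection A -> borel_bisection (theta A k).
Proof. by case: htheta => h _ _ bA; exact: h. Qed.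

Let pb A k : borel_bisection A -> borel_bisection (psi A k).
Proof. by case: hpsi => h _ _ bA; exact: h. Qed.

Let bW F k i : rf_bisection F -> borel_bisection (W F k i).
Proof. by move=> [bl br _]; apply: borel_bisectionX; [exact: tb|exact: pb]. Qed.

Let cvg_W_src_mass F i : rf_bisection F ->
  (fun k => src_mass (PK k) (W F k i)) @ U --> src_mass P (rf_member F i).
Proof.
move=> [bl br _]; rewrite src_mass_rect//.
rewrite (_ : (fun k => _) = fun k => src_mass (muK k) (theta (rf_left F i) k) *
    src_mass (nuL k) (psi (rf_right F i) k)).
  by apply: cvgM; [exact: (cvg_src_mass pG pK htheta)|exact: (cvg_src_mass pH pL hpsi)].
by apply/funext => k; rewrite src_mass_rect//; [exact: tb|exact: pb].
Qed.

Let cvg_W_src_meet F F' i j : rf_bisection F -> rf_bisection F' ->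
  (fun k => src_meet (PK k) (W F k i) (W F' k j)) @ U --> src_meet P (rf_member F i) (rf_member F' j).
Proof.
move=> [bl br _] [bl' br' _]; rewrite src_meet_rect//.
rewrite (_ : (fun k => _) = fun k =>
    src_meet (muK k) (theta (rf_left F i) k) (theta (rf_left F' j) k) *
    src_meet (nuL k) (psi (rf_right F i) k) (psi (rf_right F' j) k)).
  by apply: cvgM; [exact: (cvg_src_meet pG pK htheta)|exact: (cvg_src_meet pH pL hpsi)].
by apply/funext => k; rewrite src_meet_rect//; by [exact: tb|exact: pb].
Qed.

Let cvg_W_tgt_meet F F' i j : rf_bisection F -> rf_bisection F' ->
  (fun k => tgt_meet (PK k) (W F k i) (W F' k j)) @ U --> tgt_meet P (rf_member F i) (rf_member F' j).
Proof.
move=> [bl br _] [bl' br' _]; rewrite tgt_meet_rect//.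
rewrite (_ : (fun k => _) = fun k =>
    tgt_meet (muK k) (theta (rf_left F i) k) (theta (rf_left F' j) k) *
    tgt_meet (nuL k) (psi (rf_right F i) k) (psi (rf_right F' j) k)).
  by apply: cvgM; [exact: (cvg_tgt_meet pG pK htheta)|exact: (cvg_tgt_meet pH pL hpsi)].
by apply/funext => k; rewrite tgt_meet_rect//; by [exact: tb|exact: pb].
Qed.

Let cvg_W_arrow_meet F F' i j : rf_bisection F -> rf_bisection F' ->
  (fun k => arrow_meet (PK k) (W F k i) (W F' k j)) @ U --> arrow_meet P (rf_member F i) (rf_member F' j).
Proof.
move=> [bl br _] [bl' br' _]; rewrite arrow_meet_rect//.
rewrite (_ : (fun k => _) = fun k =>
    arrow_meet (muK k) (theta (rf_left F i) k) (theta (rf_left F' j) k) *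
    arrow_meet (nuL k) (psi (rf_right F i) k) (psi (rf_right F' j) k)).
  by apply: cvgM; [exact: (cvg_arrow_meet pG pK htheta)|exact: (cvg_arrow_meet pH pL hpsi)].
by apply/funext => k; rewrite arrow_meet_rect//; by [exact: tb|exact: pb].
Qed.

(** Distinct members of [F] have disjoint sources and ranges, so the meets of their images tend to
    0; these meets bound what the core removes. *)
Let cvg_core F i : rf_bisection F ->
  (fun k => bis_dist (PK k) (W F k i) (core (W F k) i)) @ U --> (0 : R).
Proof.
move=> bF; have [_ _ [sF tF]] := bF.
have c0 : (fun k => \sum_(j | j != i) (src_meet (PK k) (W F k i) (W F k j) +
    tgt_meet (PK k) (W F k i) (W F k j))) @ U --> (0 : R).
  apply: cvg0_sum => j ji; apply: cvg0D.
    have := @cvg_W_src_meet F F i j bF bF; rewrite /src_meet (_ : _ `&` _ = set0) ?measure0//.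
    by rewrite -subset0 => x h; move/eqP: ji; apply; apply: sF => //; exists x; rewrite setIC.
  have := @cvg_W_tgt_meet F F i j bF bF; rewrite /tgt_meet (_ : _ `&` _ = set0) ?measure0//.
  by rewrite -subset0 => x h; move/eqP: ji; apply; apply: tF => //; exists x; rewrite setIC.
apply: (cvg0_le _ c0) => k; rewrite bis_dist_ge0 /=.
by apply: (dist_core (pKL k)) => j; exact: bW.
Qed.

Definition glued F k : set (K k * L k)%type :=
  glue_cores (image_rectangle F k).
Arguments glued : clear implicits.

Let bC F k i : rf_bisection F -> borel_bisection (core (W F k) i).
Proof. by move=> bF; apply: (bis_core (pKL k)) => j; exact: bW. Qed.

Lemma bis_glued F k : rf_bisection F -> borel_bisection (glued F k).
Proof. by move=> bF; apply: (bis_glue_cores (pKL k)) => j; exact: bW. Qed.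

Let cvg_bigsum (I : finType) (u : I -> nat -> R) (l : I -> R) :
  (forall i, u i @ U --> l i) -> (fun k => \sum_i u i k) @ U --> \sum_i l i.
Proof.
move=> ul; elim: (index_enum I) => [|i s ih].
  rewrite big_nil (_ : (fun k => _) = fun=> 0); first exact: (@cvg_cst R 0 nat U _).
  by apply/funext => k; rewrite big_nil.
rewrite big_cons (_ : (fun k => _) = fun k => u i k + \sum_(j <- s) u j k).
  by apply: cvgD => //; exact: ul.
by apply/funext => k; rewrite big_cons.
Qed.

Let cvg_glued_mass F : rf_bisection F ->
  (fun k => src_mass (PK k) (glued F k)) @ U --> src_mass P (rf_union F).
Proof.
move=> bF; have [_ _ sF] := bF.
rewrite (src_mass_spread pGH) => [|i|]; [|exact: bis_rf_member|exact: sF].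
rewrite (_ : (fun k => _) = fun k => \sum_i src_mass (PK k) (core (W F k) i)).
  apply: cvg_bigsum => i.
  apply: (cvg_dist0 _ (@cvg_core F i bF) (@cvg_W_src_mass F i bF)) => k.
  rewrite distrC; apply: (src_mass_dist (pKL k)); [exact: bW|exact: bC].
apply/funext => k; apply: (src_mass_spread (pKL k)); last exact: spread_core.
by move=> i; exact: bC.
Qed.

Let cvg_core2 F F' i j : rf_bisection F -> rf_bisection F' ->
  (fun k => bis_dist (PK k) (W F k i) (core (W F k) i) +
            bis_dist (PK k) (W F' k j) (core (W F' k) j)) @ U --> (0 : R).
Proof. by move=> bF bF'; apply: cvg0D; exact: cvg_core. Qed.

Let cvg_glued_src_meet F F' : rf_bisection F -> rf_bisection F' ->
  (fun k => src_meet (PK k) (glued F k) (glued F' k)) @ U --> src_meet P (rf_union F) (rf_union F').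
Proof.
move=> bF bF'; have [_ _ sF] := bF; have [_ _ sF'] := bF'.
rewrite (src_meet_spread pGH) => [|i||i|]; [|exact: bis_rf_member|exact: sF|exact: bis_rf_member|exact: sF'].
rewrite (_ : (fun k => _) = fun k => \sum_i \sum_j src_meet (PK k) (core (W F k) i) (core (W F' k) j)).
  apply: cvg_bigsum => i; apply: cvg_bigsum => j.
  apply: (cvg_dist0 _ (@cvg_core2 F F' i j bF bF') (@cvg_W_src_meet F F' i j bF bF')) => k.
  by rewrite distrC; apply: (src_meet_dist (pKL k)); by [exact: bW|exact: bC].
apply/funext => k; apply: (src_meet_spread (pKL k)); try exact: spread_core.
  by move=> i; exact: bC.
by move=> i; exact: bC.
Qed.

Let cvg_glued_arrow_meet F F' : rf_bisection F -> rf_bisection F' ->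
  (fun k => arrow_meet (PK k) (glued F k) (glued F' k)) @ U --> arrow_meet P (rf_union F) (rf_union F').
Proof.
move=> bF bF'; have [_ _ sF] := bF; have [_ _ sF'] := bF'.
rewrite (arrow_meet_spread pGH) => [|i||i|]; [|exact: bis_rf_member|exact: sF|exact: bis_rf_member|exact: sF'].
rewrite (_ : (fun k => _) = fun k => \sum_i \sum_j arrow_meet (PK k) (core (W F k) i) (core (W F' k) j)).
  apply: cvg_bigsum => i; apply: cvg_bigsum => j.
  apply: (cvg_dist0 _ (cvg0Z 3 (@cvg_core2 F F' i j bF bF')) (@cvg_W_arrow_meet F F' i j bF bF')) => k.
  by rewrite distrC; apply: (arrow_meet_dist (pKL k)); by [exact: bW|exact: bC].
apply/funext => k; apply: (arrow_meet_spread (pKL k)); try exact: spread_core.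
  by move=> i; exact: bC.
by move=> i; exact: bC.
Qed.

Let bis_rf_union F : rf_bisection F -> borel_bisection (rf_union F).
Proof. by move=> bF; apply: bis_spread => [i|]; [exact: bis_rf_member|case: bF]. Qed.

(** By [bis_distE] the distance splits into masses and meets, which are sums over members and pass
    to the limit one rectangle at a time. *)
Lemma cvg_glued_dist F F' : rf_bisection F -> rf_bisection F' ->
  (fun k => bis_dist (PK k) (glued F k) (glued F' k)) @ U --> bis_dist P (rf_union F) (rf_union F').
Proof.
move=> bF bF'; rewrite (bis_distE pGH (bis_rf_union bF) (bis_rf_union bF')).
rewrite (_ : (fun k => _) = fun k => src_mass (PK k) (glued F k) + src_mass (PK k) (glued F' k) -
  src_meet (PK k) (glued F k) (glued F' k) - arrow_meet (PK k) (glued F k) (glued F' k)).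
  apply: cvgB; last exact: cvg_glued_arrow_meet.
  by apply: cvgB; [apply: cvgD; exact: cvg_glued_mass|exact: cvg_glued_src_meet].
by apply/funext => k; apply: (bis_distE (pKL k)); exact: bis_glued.
Qed.

Lemma cvg_glued_mul F F' : rf_bisection F -> rf_bisection F' ->
  (fun k => bis_dist (PK k) (glued (rf_mul F F') k) (bisection_mul (glued F k) (glued F' k))) @ U --> (0 : R).
Proof.
move=> bF bF'; have bM := rf_bisection_mul dG dH bF bF'.
have [bl br _] := bF; have [bl' br' _] := bF'.
have [_ _ tm] := htheta; have [_ _ pm] := hpsi.
(* Three sources of error for each pair of members: undoing the core in the product family, the
   defect of multiplicativity in the two factors, and passing to the cores of the factors. *)
pose err p k := bis_dist (PK k) (W (rf_mul F F') k p) (core (W (rf_mul F F') k) p) +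
  (bis_dist (muK k) (theta (bisection_mul (rf_left F p.1) (rf_left F' p.2)) k)
     (bisection_mul (theta (rf_left F p.1) k) (theta (rf_left F' p.2) k)) +
   bis_dist (nuL k) (psi (bisection_mul (rf_right F p.1) (rf_right F' p.2)) k)
     (bisection_mul (psi (rf_right F p.1) k) (psi (rf_right F' p.2) k))) +
  (bis_dist (PK k) (W F k p.1) (core (W F k) p.1) +
            bis_dist (PK k) (W F' k p.2) (core (W F' k) p.2)).
have c0 : (fun k => \sum_p err p k) @ U --> (0 : R).
  apply: cvg0_sum => p _; apply: cvg0D; last exact: cvg_core2.
  by apply: cvg0D; [exact: cvg_core|apply: cvg0D; [exact: tm|exact: pm]].
apply: (cvg0_le _ c0) => k; rewrite bis_dist_ge0 /=.
rewrite /glued /glue_cores mul_bigcup.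
have dKL : Defs.discrete_measurable R (K k * L k)%type by case: (pKL k).
have bm := borel_bisection_mul dKL.
have bCC (p : rf_index F * rf_index F') : borel_bisection (bisection_mul (core (W F k) p.1) (core (W F' k) p.2)).
  by apply: bm; exact: bC.
apply: le_trans (bis_dist_bigcup (pKL k) _ _ _ _) _.
- by move=> p; exact: bC.
- exact: bCC.
- exact: bis_glued.
- by rewrite -mul_bigcup; apply: bm; exact: bis_glued.
apply: ler_sum => p _.
have b1 := @bW _ k p bM; have b2 := @bC _ k p bM.
have b3 : borel_bisection (bisection_mul (W F k p.1) (W F' k p.2)) by apply: bm; exact: bW.
apply: le_trans (bis_dist_triangle (pKL k) b2 b3 (bCC p)) _.
apply: lerD; last by apply: (bis_dist_mul (pKL k)); by [exact: bW|exact: bC].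
apply: le_trans (bis_dist_triangle (pKL k) b2 b1 b3) _.
rewrite bis_distC lerD2l /image_rectangle mul_rect.
by apply: bis_dist_rect => //; by [exact: tb|exact: pb|apply: tb; exact: (borel_bisection_mul dG)|
  apply: pb; exact: (borel_bisection_mul dH)|apply: (borel_bisection_mul (dK k)); exact: tb|
  apply: (borel_bisection_mul (dL k)); exact: pb].
Qed.

Definition rectangular : set (set (G * H)%type) :=
  [set A | exists F, rf_bisection F /\ rf_union F = A].

Lemma rectangular_bisection A : rectangular A -> borel_bisection A.
Proof. by move=> [F [bF <-]]; exact: bis_rf_union. Qed.

Lemma rectangular_mul A B : rectangular A -> rectangular B -> rectangular (bisection_mul A B).
Proof.
move=> [F [bF <-]] [F' [bF' <-]]; exists (rf_mul F F'); split.
  exact: (rf_bisection_mul dG dH).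
exact: rf_union_mul.
Qed.

Lemma rectangular_approximation : exists xi : set (G * H)%type -> forall k, set (K k * L k)%type,
  sofic_approximation U P (fun k => PK k) rectangular xi.
Proof.
have /choice[rep hrep] : forall A, exists F, rectangular A -> rf_bisection F /\ rf_union F = A.
  move=> A; have [[F hF]|nA] := pselect (rectangular A); first by exists F.
  by exists (@RectangleFamily G H 'I_0 (fun=> set0) (fun=> set0)).
exists (fun A k => glued (rep A) k); split.
- by move=> A /hrep[bF _] k; exact: bis_glued.
- by move=> A B /hrep[bF AE] /hrep[bF' BE]; rewrite -{2}AE -{2}BE; exact: cvg_glued_dist.
- move=> A B rA rB; have [bF AE] := hrep _ rA; have [bF' BE] := hrep _ rB.
  have [bM ME] := hrep _ (rectangular_mul rA rB).
  have bM' := rf_bisection_mul dG dH bF bF'.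
  (* The family chosen for the product set need not be [rf_mul] of the chosen families. It has the
     same union, so the glued images are asymptotically equal; the same fact makes the choice of
     [rep] immaterial. *)
  have c1 := cvg_glued_dist bM bM'; rewrite ME rf_union_mul AE BE bis_distxx in c1.
  apply: (cvg0_le _ (cvg0D c1 (cvg_glued_mul bF bF'))) => k; rewrite bis_dist_ge0 /=.
  apply: (bis_dist_triangle (pKL k)); try exact: bis_glued.
  have dKL : Defs.discrete_measurable R (K k * L k)%type by case: (pKL k).
  by apply: (borel_bisection_mul dKL); exact: bis_glued.
Qed.

End product_approximation.

(** * Density of finite unions of rectangles *)

Lemma bigcup_bigsetU (I : finType) (T : Type) (F : I -> set T) :
  \bigcup_i F i = \big[setU/set0]_i F i.
Proof.
rewrite -bigcup_seq; apply: eq_bigcupl; split=> i //= _.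
exact: mem_index_enum.
Qed.

Section spread_facts.
Context (X : groupoidType) (I : Type).
Implicit Types V W : I -> set X.

Lemma spread_sub V W : (forall i, W i `<=` V i) -> spread V -> spread W.
Proof.
move=> WV [sV tV]; split=> i j _ _ [x [[g Wg gx] [h Wh hx]]].
  by apply: sV => //; exists x; split; [exists g|exists h] => //; exact: WV.
by apply: tV => //; exists x; split; [exists g|exists h] => //; exact: WV.
Qed.

Lemma spread_parts (C : set X) V : set_inj C (@gsrc X) -> set_inj C (@gtgt X) ->
  trivIset setT V -> spread (fun i => C `&` V i).
Proof.
move=> sC tC tV; split=> i j _ _ [x [[g [Cg Vg] gx] [h [Ch Vh] hx]]]; apply: tV => //; exists g.
  by split=> //; rewrite (_ : g = h)//; apply: sC; rewrite ?inE// gx hx.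
by split=> //; rewrite (_ : g = h)//; apply: tC; rewrite ?inE// gx hx.
Qed.

End spread_facts.

Section truncation.
Context (R : realType) d (X : mgroupoidType d) (mu : probability X R).
Hypothesis pX : pmp_groupoid mu.

(** Continuity from above of [mu] along the sources of what the first [N] sets leave uncovered. *)
Lemma bis_dist_truncate (V : set X) (E : nat -> set X) (eps : R) : borel_bisection V ->
  (forall n, measurable (E n)) -> mu (@gsrc X @` (V `\` \bigcup_n E n)) = 0%E -> 0 < eps ->
  exists N, bis_dist mu V (V `&` \bigcup_(i : 'I_N) E i) < eps.
Proof.
move=> bV mE V0 e0; pose F N := @gsrc X @` (V `\` \bigcup_(i : 'I_N) E i).
have mU N : measurable (\bigcup_(i : 'I_N) E i) by exact: measurable_finite_bigcup.
have mF N : measurable (F N) by apply: (measurable_src pX); exact: bisD.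
(* An intersection of images is an image of the intersection only because the source is injective on
   [V]. *)
have capF : \bigcap_N F N = @gsrc X @` (V `\` \bigcup_n E n).
  apply/seteqP; split=> [x Fx|_ [g [Vg nE] <-] N _].
    have [g [Vg _] gx] := Fx 0%N I; exists g => //; split=> // -[n _ En].
    have [h [Vh nEh] hx] := Fx n.+1 I; apply: nEh; exists (Ordinal (ltnSn n)) => //=.
    have [_ sV _] := bV; rewrite (_ : h = g)//; apply: sV; rewrite ?inE//.
    by rewrite gx hx.
  by exists g => //; split=> // -[i _ Ei]; apply: nE; exists (nat_of_ord i).
have c : mu \o F @ \oo --> 0%E.
  rewrite -V0 -capF; apply: nonincreasing_cvg_mu => //.
  - by rewrite ltey_eq fin_num_measure.
  - by rewrite capF; apply: (measurable_src pX); apply: bisD => //; exact: bigcupT_measurable.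
  - move=> m n mn; apply/subsetPset; apply: image_subset => g [Vg nE]; split=> // -[i _ Ei].
    by apply: nE; exists (widen_ord mn i).
have /fine_cvgP[_ /cvgr0Pnorm_lt/(_ _ e0)[N _ hN]] := c.
exists N; rewrite bis_dist_sub; last by move=> x [].
have := hN N (leqnn N); rewrite /= ger0_norm; last exact: fmeasure_ge0.
by rewrite /src_mass /F setDIr setDv set0U.
Qed.

End truncation.

Lemma measurable_asbool d (T : measurableType d) (A : set T) b : measurable A ->
  measurable ((fun x => `[<A x>]) @^-1` [set b]).
Proof.
move=> mA; rewrite (_ : _ @^-1` _ = if b then A else ~` A).
  by case: b => //; exact: measurableC.
by apply/seteqP; split=> x; case: b => /=;
  [move/asboolP|move/negbT/asboolPn|move/asboolT|move/asboolF].
Qed.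

Section elementary_sets.
Context d1 d2 (G : measurableType d1) (H : measurableType d2).

(* The sets that depend only on the cells of a finite measurable partition of each
   factor: the algebra generated by measurable rectangles. *)
Definition elementary : set (set (G * H)) := [set E |
  exists (I J : finType) (p : G -> I) (q : H -> J) (S : set (I * J)),
  [/\ forall i, measurable (p @^-1` [set i]), forall j, measurable (q @^-1` [set j]) &
      E = [set x | S (p x.1, q x.2)]]].

Lemma elementary_rect (A : set G) (B : set H) : measurable A -> measurable B ->
  elementary (A `*` B).
Proof.
move=> mA mB; exists bool, bool, (fun g => `[<A g>]), (fun h => `[<B h>]), [set (true, true)].
split.
- by move=> b; exact: measurable_asbool.
- by move=> b; exact: measurable_asbool.
- by apply/seteqP; split=> -[x y] /=; [move=> [Ax By]; rewrite !asboolT|move=> [/asboolP ? /asboolP ?]].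
Qed.

Lemma elementaryC E : elementary E -> elementary (~` E).
Proof. by move=> [I [J [p [q [S [mp mq ->]]]]]]; exists I, J, p, q, (~` S). Qed.

Lemma elementaryU E F : elementary E -> elementary F -> elementary (E `|` F).
Proof.
move=> [I [J [p [q [S [mp mq ->]]]]]] [I' [J' [p' [q' [S' [mp' mq' ->]]]]]].
exists (I * I')%type, (J * J')%type, (fun g => (p g, p' g)), (fun h => (q h, q' h)),
  [set x | S (x.1.1, x.2.1) \/ S' (x.1.2, x.2.2)]; split=> //.
- move=> [i i']; rewrite (_ : _ @^-1` _ = p @^-1` [set i] `&` p' @^-1` [set i']).
    exact: measurableI.
  by apply/seteqP; split=> x /=; case=> -> ->.
- move=> [i i']; rewrite (_ : _ @^-1` _ = q @^-1` [set i] `&` q' @^-1` [set i']).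
    exact: measurableI.
  by apply/seteqP; split=> x /=; case=> -> ->.
Qed.

Lemma elementaryI E F : elementary E -> elementary F -> elementary (E `&` F).
Proof.
move=> eE eF; rewrite -(setCK (E `&` F)) setCI; apply: elementaryC.
by apply: elementaryU; exact: elementaryC.
Qed.

Lemma elementary0 : elementary set0.
Proof.
rewrite (_ : set0 = setT `*` set0); first exact: elementary_rect.
by apply/seteqP; split=> x // [].
Qed.

Lemma elementary_bigcup (N : finType) (E : N -> set (G * H)) : (forall n, elementary (E n)) ->
  elementary (\bigcup_n E n).
Proof.
move=> eE; rewrite bigcup_bigsetU.
by apply: big_ind => //; [exact: elementary0|exact: elementaryU].
Qed.

Lemma elementary_measurable E : elementary E -> measurable E.
Proof.
move=> [I [J [p [q [S [mp mq ->]]]]]].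
rewrite (_ : mkset _ = \bigcup_(ij : I * J) (if `[<S ij>] then
    (p @^-1` [set ij.1]) `*` (q @^-1` [set ij.2]) else set0)).
  by apply: measurable_finite_bigcup => ij; case: ifP => // _; exact: measurableX.
apply/seteqP; split=> x /= => [Sx|[[i j] _]].
  by exists (p x.1, q x.2) => //; rewrite asboolT.
by case: asboolP => // Sij [/= -> ->].
Qed.

End elementary_sets.

Section rectangular_density.
Context (R : realType) d1 d2 (G : mgroupoidType d1) (H : mgroupoidType d2).
Variables (mu : probability G R) (nu : probability H R).
Hypotheses (pG : pmp_groupoid mu) (pH : pmp_groupoid nu).

Local Notation X := (G * H)%type.
Local Notation P := (prod_prob mu nu).
Local Notation s := (@gsrc X).
Local Notation t := (@gtgt X).
Local Notation bis := (@borel_bisection _ X).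
Local Notation rectangular := (@rectangular _ _ G H).

Let dG : Defs.discrete_measurable R G. Proof. by case: pG. Qed.
Let dH : Defs.discrete_measurable R H. Proof. by case: pH. Qed.
Let pX : pmp_groupoid P := pmp_groupoid_prod pG pH.

Lemma elementary_src (E : set X) : elementary E -> elementary (s @^-1` E).
Proof.
move=> [I [J [p [q [S [mp mq ->]]]]]].
exists I, J, (p \o @gsrc G), (q \o @gsrc H), S; split=> // i; rewrite comp_preimage.
  by have := measurable_gsrc dG measurableT (mp i); rewrite setTI.
by have := measurable_gsrc dH measurableT (mq i); rewrite setTI.
Qed.

Lemma elementary_tgt (E : set X) : elementary E -> elementary (t @^-1` E).
Proof.
move=> [I [J [p [q [S [mp mq ->]]]]]].
exists I, J, (p \o @gtgt G), (q \o @gtgt H), S; split=> // i; rewrite comp_preimage.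
  by have := measurable_gtgt dG measurableT (mp i); rewrite setTI.
by have := measurable_gtgt dH measurableT (mq i); rewrite setTI.
Qed.

Lemma rectangular_spread (N : finType) (V : N -> set X) :
  (forall n, rectangular (V n)) -> spread V -> rectangular (\bigcup_n V n).
Proof.
move=> /choice[F hF] [sV tV].
have bF n : rf_bisection (F n) by case: (hF n).
have sub n i : rf_member (F n) i `<=` V n.
  by case: (hF n) => _ <- x; exists i.
exists (@RectangleFamily G H {n : N & rf_index (F n)}
  (fun u => rf_left (F (tag u)) (tagged u)) (fun u => rf_right (F (tag u)) (tagged u))); split.
  split=> [[n i]|[n i]|]; [by have [+ _ _] := bF n; exact|by have [_ + _] := bF n; exact|].
  split=> -[n i] [n' j] _ _ [x [[g /= Fg gx] [h /= Fh hx]]].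
    have nn : n = n'.
      by apply: sV => //; exists x; split; [exists g|exists h] => //; apply: sub; [exact: Fg|exact: Fh].
    move: i Fg; rewrite nn => i Fg; congr existT; have [_ _ [sF _]] := bF n'.
    by apply: sF => //; exists x; split; [exists g|exists h].
  have nn : n = n'.
    by apply: tV => //; exists x; split; [exists g|exists h] => //; apply: sub; [exact: Fg|exact: Fh].
  move: i Fg; rewrite nn => i Fg; congr existT; have [_ _ [_ tF]] := bF n'.
  by apply: tF => //; exists x; split; [exists g|exists h].
apply/seteqP; split=> x.
  by move=> [[n i] _ Fx]; exists n => //; apply: sub; exact: Fx.
by move=> [n _]; case: (hF n) => _ <- [i _ Fx]; exists (Tagged (fun n => rf_index (F n)) i).
Qed.

(** Cores are cut out by conditions on sources and ranges of other members; these must be elementary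
    for cores to remain rectangular. *)
Lemma rectangular_elementary A : rectangular A ->
  [/\ elementary A, elementary (s @` A) & elementary (t @` A)].
Proof.
move=> [F [[bl br _] <-]]; rewrite /rf_union !image_bigcup; split.
- apply: elementary_bigcup => i; apply: elementary_rect; exact: bis_measurable.
- apply: elementary_bigcup => i; rewrite gsrc_rect; apply: elementary_rect.
    exact: (measurable_src pG).
  exact: (measurable_src pH).
- apply: elementary_bigcup => i; rewrite gtgt_rect; apply: elementary_rect.
    exact: (measurable_tgt pG).
  exact: (measurable_tgt pH).
Qed.

(** The cells of the two partitions cut [A] and [B] into smaller bisections. Pairs of cells outside
    [S] receive an empty factor, so that the index type stays a plain product. *)
Let rectangularI_rect (A : set G) (B : set H) (E : set X) : borel_bisection A ->
  borel_bisection B -> elementary E -> rectangular ((A `*` B) `&` E).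
Proof.
move=> bA bB [I [J [p [q [S [mp mq ->]]]]]].
have b0 d (Y : mgroupoidType d) : borel_bisection (set0 : set Y).
  by split=> // x y; rewrite inE.
pose F : rectangle_family G H := @RectangleFamily G H (I * J)%type
  (fun i => if `[<S i>] then A `&` p @^-1` [set i.1] else set0)
  (fun i => B `&` q @^-1` [set i.2]).
have [_ sAB tAB] := borel_bisectionX bA bB.
exists F; split.
  split=> [i|i|].
  - by rewrite /=; case: ifP => [_|_]; [exact: borel_bisectionI|exact: b0].
  - exact: borel_bisectionI.
  - pose V (i : I * J) : set X := [set x | p x.1 = i.1 /\ q x.2 = i.2].
    apply: (@spread_sub _ _ (fun i => (A `*` B) `&` V i)).
      move=> i [g h]; rewrite /rf_member /=; case: ifP => _; last by case.
      by move=> [[? ?] [? ?]].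
    apply: spread_parts => // -[i j] [i' j'] _ _ [x [[/= <- <-] [/= <- <-]]].
    by [].
apply/seteqP; split=> -[g h].
  move=> [[i j] _ [/=]]; case: asboolP => // Sij [Ag pg] [Bh qh].
  by split=> //=; rewrite pg qh.
move=> [[/= Ag Bh] Sgh]; exists (p g, q h) => //; split=> //=.
by rewrite asboolT.
Qed.

Lemma rectangularI A E : rectangular A -> elementary E -> rectangular (A `&` E).
Proof.
move=> [F [[bl br sF] <-]] eE; rewrite /rf_union setI_bigcupl; apply: rectangular_spread.
  by move=> i; exact: rectangularI_rect.
by apply: spread_sub sF => i x [].
Qed.

Lemma rectangular_glue_cores (N : finType) (W : N -> set X) : (forall n, rectangular (W n)) ->
  rectangular (glue_cores W).
Proof.
move=> rW; apply: rectangular_spread; last exact: spread_core.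
move=> n; apply: rectangularI => //; apply: elementaryI.
  apply: elementary_src; apply: elementaryC; apply: elementary_bigcup => j.
  by case: ifP => _; [exact: elementary0|have [] := rectangular_elementary (rW j)].
apply: elementary_tgt; apply: elementaryC; apply: elementary_bigcup => j.
by case: ifP => _; [exact: elementary0|have [] := rectangular_elementary (rW j)].
Qed.

(** The usual approximation of measurable sets by an algebra, relative to the bisection [C] so that
    the distance is controlled. Complements and finite unions preserve approximability, and a
    countable union is first truncated to a finite one. *)
Lemma elementary_dense (C E : set X) (eps : R) : bis C -> measurable E -> 0 < eps ->
  exists2 E', elementary E' & bis_dist P (C `&` E) (C `&` E') < eps.
Proof.
move=> bC mE e0.
pose M : set (set X) := [set E | measurable E /\ forall e, 0 < e ->
  exists2 E', elementary E' & bis_dist P (C `&` E) (C `&` E') < e].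
have bI F : measurable F -> bis (C `&` F) by exact: borel_bisectionI.
have MC F : M F -> M (~` F).
  move=> [mF hF]; split; first exact: measurableC.
  move=> e /hF[F' eF' h]; exists (~` F'); first exact: elementaryC.
  rewrite /bis_dist (_ : _ `+` _ = (C `&` F) `+` (C `&` F'))//.
  apply/seteqP; split=> x; rewrite /setY /=.
    move=> [[[Cx nF] n]|[[Cx nF] n]]; [right|left]; split; try by [move=> []].
      by split=> //; apply: contrapT => nF'; apply: n.
    by split=> //; apply: contrapT => nF'; apply: n.
  by move=> [[[Cx Fx] n]|[[Cx Fx] n]]; [right|left]; split=> [|[_]]//; split=> // Fx'; exact: n.
have MU F F' : M F -> M F' -> M (F `|` F').
  move=> [mF hF] [mF' hF']; split; first exact: measurableU.
  move=> e e1; have e2 : 0 < e / 2 by lra.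
  have [V eV hV] := hF _ e2; have [V' eV' hV'] := hF' _ e2.
  have mV := elementary_measurable eV; have mV' := elementary_measurable eV'.
  exists (V `|` V'); first exact: elementaryU.
  apply: (@le_lt_trans _ _ (bis_dist P (C `&` F) (C `&` V) + bis_dist P (C `&` F') (C `&` V'))); last lra.
  have b Z Z' : measurable Z -> measurable Z' -> measurable (s @` ((C `&` Z) `+` (C `&` Z'))).
    by move=> mZ mZ'; apply: (measurable_src_setY pX); exact: bI.
  apply: fmeasure_subU; [by apply: b; exact: measurableU|exact: b|exact: b|].
  move=> _ [g h <-]; case: h => -[[Cg [Fg|Fg]] n].
  - by left; exists g => //; left; split=> // -[_ Vg]; apply: n; split=> //; left.
  - by right; exists g => //; left; split=> // -[_ Vg]; apply: n; split=> //; right.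
  - by left; exists g => //; right; split=> // -[_ Vg]; apply: n; split=> //; left.
  - by right; exists g => //; right; split=> // -[_ Vg]; apply: n; split=> //; right.
have Me F : elementary F -> M F.
  move=> eF; split; first exact: elementary_measurable.
  by move=> e e1; exists F => //; rewrite bis_distxx.
have MUn (F : nat -> set X) : (forall n, M (F n)) -> M (\bigcup_n F n).
  move=> MF; have mF n : measurable (F n) by case: (MF n).
  have mUF : measurable (\bigcup_n F n) by exact: bigcupT_measurable.
  split=> // e e1; have e2 : 0 < e / 2 by lra.
  have [N hN] : exists N, bis_dist P (C `&` \bigcup_n F n)
      ((C `&` \bigcup_n F n) `&` \bigcup_(i : 'I_N) F i) < e / 2.
    apply: (bis_dist_truncate pX) => //; first exact: bI.
    by rewrite (_ : _ `\` _ = set0) ?image_set0 ?measure0// -subset0 => x [[]].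
  have [_ /(_ _ e2)[E' eE' hE']] : M (\bigcup_(i : 'I_N) F i).
    by rewrite bigcup_bigsetU; apply: big_ind => //; apply: Me; exact: elementary0.
  have mN : measurable (\bigcup_(i : 'I_N) F i) by exact: measurable_finite_bigcup.
  exists E' => //; apply: le_lt_trans.
    apply: (@bis_dist_triangle _ _ _ _ pX (C `&` \bigcup_(i : 'I_N) F i)); apply: bI => //.
    exact: elementary_measurable.
  rewrite -setIA (setIidr (B := \bigcup_(i : 'I_N) F i)) in hN; first lra.
  by move=> x [i _ Fx]; exists (nat_of_ord i).
suff [_ h] : M E by exact: h.
have := mE; rewrite measurable_prod_measurableType; apply: smallest_sub.
  split=> //; first by apply: Me; exact: elementary0.
  by move=> F MF; rewrite setTD; exact: MC.
by move=> _ [A mA [B mB <-]]; apply: Me; exact: elementary_rect.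
Qed.

(* On each rectangle of a cover of [D] by disjoint rectangles of bisections, [D] is
   close to an elementary set; the resulting pieces almost fit together, and passing
   to their cores makes them fit. *)
Lemma rectangular_dense (D : set X) (eps : R) : bis D -> 0 < eps ->
  exists2 B, rectangular B & bis_dist P D B < eps.
Proof.
move=> bD e0; have [A [B [bA bB tAB D0 _]]] := bisection_rectangle_cover pG pH bD.
pose C n : set X := A n `*` B n.
have bC n : bis (C n) by exact: borel_bisectionX.
have mC n : measurable (C n) by exact: bis_measurable.
have mD := bis_measurable bD.
have e2 : 0 < eps / 2 by lra.
have [N hN] := bis_dist_truncate pX bD mC D0 e2.
pose V (i : 'I_N) := D `&` C i.
have bV i : bis (V i) by exact: borel_bisectionI.
have [_ sD tD] := bD.
have sV : spread V.
  apply: spread_parts => // i j _ _ h; apply: val_inj; exact: (tAB _ _ I I h).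
(* Each of the [N] pieces costs [del] for replacing [V i] by [W i] and at most [N * 4 * del] for
   passing to its core. The added 1 keeps the denominator positive and the final inequality
   strict. *)
pose del : R := eps / 2 / (N%:R * (1 + N%:R * 4) + 1).
have N0 : 0 <= N%:R :> R by [].
have den0 : 0 < N%:R * (1 + N%:R * 4) + 1 :> R by nra.
have del0 : 0 < del by exact: divr_gt0.
have /choice[E hE] (i : 'I_N) : exists E, elementary E /\ bis_dist P (V i) (C i `&` E) < del.
  by have [E eE h] := elementary_dense (bC i) mD del0; exists E; rewrite /V setIC.
pose W (i : 'I_N) := C i `&` E i.
have rW i : rectangular (W i) by apply: rectangularI_rect => //; case: (hE i).
have bW i : bis (W i) by exact: (rectangular_bisection (rW i)).
have dW i : bis_dist P (V i) (W i) < del by case: (hE i).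
exists (glue_cores W); first exact: rectangular_glue_cores.
have bUV : bis (\bigcup_i V i) by exact: bis_spread.
have bg := bis_glue_cores pX bW; have bcore := bis_core pX bW.
have DV : D `&` \bigcup_(i : 'I_N) C i = \bigcup_i V i by rewrite setI_bigcupr.
rewrite DV in hN.
apply: (le_lt_trans (bis_dist_triangle pX bD bUV bg)).
suff : bis_dist P (\bigcup_i V i) (glue_cores W) < eps / 2 by lra.
apply: (le_lt_trans (bis_dist_bigcup pX bV bcore bUV bg)).
(* Meets of distinct [V i] vanish, and replacing both sets moves each of the two meets by at most
   [2 * del]. *)
have meet i j : j != i -> src_meet P (W i) (W j) + tgt_meet P (W i) (W j) <= 4 * del.
  move=> /eqP ji; have [ssV tsV] := sV.
  have := src_meet_dist pX (bW i) (bV i) (bW j) (bV j).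
  have := tgt_meet_dist pX (bW i) (bV i) (bW j) (bV j).
  have -> : src_meet P (V i) (V j) = 0.
    rewrite /src_meet (_ : _ `&` _ = set0) ?measure0// -subset0 => x h.
    by apply: ji; apply: ssV => //; exists x; rewrite setIC.
  have -> : tgt_meet P (V i) (V j) = 0.
    rewrite /tgt_meet (_ : _ `&` _ = set0) ?measure0// -subset0 => x h.
    by apply: ji; apply: tsV => //; exists x; rewrite setIC.
  have := dW i; have := dW j.
  rewrite !subr0 !ler_norml (bis_distC _ (V i)) (bis_distC _ (V j)).
  by move=> h1 h2 /andP[_ h3] /andP[_ h4]; lra.
apply: (@le_lt_trans _ _ (\sum_(i < N) (del + N%:R * (4 * del)))).
  apply: ler_sum => i _.
  apply: (le_trans (bis_dist_triangle pX (bV i) (bW i) (bcore i))).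
  apply: lerD; first exact: ltW.
  apply: (le_trans (dist_core pX i bW)); rewrite big_mkcond /=.
  apply: (@le_trans _ _ (\sum_(j < N) 4 * del)).
    by apply: ler_sum => j _; case: ifP => [/meet//|_]; lra.
  by rewrite (mulr_natl (4 * del) N) sumr_const card_ord.
rewrite sumr_const card_ord -[X in X < _](mulr_natl _ N).
rewrite (_ : _ * _ = (N%:R * (1 + N%:R * 4)) * del); last by ring.
rewrite /del mulrA ltr_pdivrMr// mulrC ltr_pM2l//; lra.
Qed.

End rectangular_density.

(** * Soficity of products *)

Lemma image_src_gunits (X : groupoidType) : @gsrc X @` @gunits X = @gunits X.
Proof. exact: image_src_units. Qed.

Section main.
Context (R : realType) (U : set_system nat).
Hypothesis freeU : free_ultrafilter U.
Context d1 d2 (G : mgroupoidType d1) (H : mgroupoidType d2).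
Variables (mu : probability G R) (nu : probability H R).
Hypotheses (pG : pmp_groupoid mu) (pH : pmp_groupoid nu).

Let UU : UltraFilter U. Proof. by case: freeU. Qed.
Let dG : Defs.discrete_measurable R G. Proof. by case: pG. Qed.
Let dH : Defs.discrete_measurable R H. Proof. by case: pH. Qed.
Let pX : pmp_groupoid (prod_prob mu nu) := pmp_groupoid_prod pG pH.

Lemma sofic_prod : sofic U mu -> sofic U nu -> sofic U (prod_prob mu nu).
Proof.
move=> [e1 [K [muK [hK /sofic_approximationP aG]]]] [e2 [L [nuL [hL /sofic_approximationP aH]]]].
have pK k : pmp_groupoid (muK k) by case: (hK k).
have pL k : pmp_groupoid (nuL k) by case: (hL k).
have [theta htheta] := aG UU pG pK; have [psi hpsi] := aH UU pH pL.
exists (fun k => measure_prod_display (e1 k, e2 k)), (fun k => (K k * L k)%type : mgroupoidType _),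
  (fun k => prod_prob (muK k) (nuL k)).
have pKL k : pmp_groupoid (prod_prob (muK k) (nuL k)) by exact: pmp_groupoid_prod.
split=> [k|].
  split=> //; rewrite -setXTT; apply: finite_setX; [by case: (hK k)|by case: (hL k)].
apply/(sofic_approximationP UU pX pKL).
have [xi hxi] := rectangular_approximation (UU := @ultra_proper _ _ UU) pG pH pK pL htheta hpsi.
apply: (sofic_approximation_extend freeU pX pKL _ _ _ hxi).
- exact: rectangular_bisection.
- by move=> A B; exact: (rectangular_mul pG pH).
- by move=> A eps bA e0; exact: rectangular_dense.
Qed.

(** An asymptotic homomorphism stays one after composition with an exact isometric homomorphism [c]
    on bisections. *)
Lemma sofic_transfer d (X : mgroupoidType d) d' (Y : mgroupoidType d') (muX : probability X R)
    (muY : probability Y R) (c : set X -> set Y) : pmp_groupoid muX -> pmp_groupoid muY ->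
  (forall A, borel_bisection A -> borel_bisection (c A)) ->
  (forall A B, borel_bisection A -> borel_bisection B ->
    bis_dist muY (c A) (c B) = bis_dist muX A B) ->
  (forall A B, borel_bisection A -> borel_bisection B ->
    c (bisection_mul A B) = bisection_mul (c A) (c B)) ->
  sofic U muY -> sofic U muX.
Proof.
move=> pmX pmY cb cd cm [e [K [muK [hK /sofic_approximationP aY]]]].
have pK k : pmp_groupoid (muK k) by case: (hK k).
have [theta [tb td tm]] := aY UU pmY pK.
exists e, K, muK; split=> //; apply/(sofic_approximationP UU pmX pK).
exists (theta \o c); split=> /=.
- by move=> A bA k; apply: tb; exact: cb.
- by move=> A B bA bB; rewrite -cd//; apply: td; exact: cb.
- by move=> A B bA bB; rewrite cm//; apply: tm; exact: cb.
Qed.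

(** The factor [gunits H] is idempotent, so products are preserved, and its source has measure one,
    so distances are. *)
Lemma sofic_left : sofic U (prod_prob mu nu) -> sofic U mu.
Proof.
apply: (@sofic_transfer _ _ _ _ _ _ (fun A => A `*` @gunits H)) => //.
- by move=> A bA; apply: borel_bisectionX => //; exact: (borel_bisection_gunits dH).
- move=> A B bA bB; rewrite /bis_dist (_ : _ `+` _ = (A `+` B) `*` @gunits H).
    rewrite gsrc_rect fine_prodE; [|exact: (measurable_src_setY pG)|].
      by rewrite image_src_gunits; case: pH => _ -> _; rewrite mulr1.
    by rewrite image_src_gunits; exact: (measurable_gunits dH).
  apply/seteqP; split=> -[g h]; rewrite /setY /setX /=; tauto.
- by move=> A B bA bB; rewrite mul_rect mul_units.
Qed.

Lemma sofic_right : sofic U (prod_prob mu nu) -> sofic U nu.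
Proof.
apply: (@sofic_transfer _ _ _ _ _ _ (fun A => @gunits G `*` A)) => //.
- by move=> A bA; apply: borel_bisectionX => //; exact: (borel_bisection_gunits dG).
- move=> A B bA bB; rewrite /bis_dist (_ : _ `+` _ = @gunits G `*` (A `+` B)).
    rewrite gsrc_rect fine_prodE; [| |exact: (measurable_src_setY pH)].
      by rewrite image_src_gunits; case: pG => _ -> _; rewrite mul1r.
    by rewrite image_src_gunits; exact: (measurable_gunits dG).
  apply/seteqP; split=> -[g h]; rewrite /setY /setX /=; tauto.
- by move=> A B bA bB; rewrite mul_rect mul_units.
Qed.

End main.

Theorem theorem3p5 (R : realType) (U : set_system nat)
    (freeU : free_ultrafilter U)
    (d1 d2 : measure_display)
    (G : mgroupoidType d1) (H : mgroupoidType d2)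
    (mu : probability G R) (nu : probability H R)
    (pmpG : pmp_groupoid mu) (pmpH : pmp_groupoid nu) :
  (sofic U mu /\ sofic U nu) <->
  sofic (G := (G * H)%type) U (mu \x nu)%E.
Proof.
split=> [[sG sH]|sGH]; first exact: sofic_prod.
by split; [exact: sofic_left sGH|exact: sofic_right sGH].
Qed.
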